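(* Let $u\ge0$ and let $G$ be a positive random variable with $E(\log^+(1/G))<\infty$ and, in case $u=0$, also $E(\log^+G)<\infty$. Let $$\sigma_u(x):=\frac{x\sinh u+\cosh u}{x\cosh u+\sinh u}\qquad(x>0).$$ Then: 1) For every $\lambda>0$, $$-\psi_G(\sigma_u(\lambda))+\psi_{\sigma_u(G)}(\lambda)=\log(\lambda\cosh u+\sinh u)+k_u,\qquad k_u=E\left[\log\left(\frac{G}{G\sinh u+\cosh u}\right)\right].$$ 2) $F^{-1}_{\sigma_u(G)}(y)=\sigma_u\left(F_G^{-1}(1-y)\right)$ for a.e. $y\in[0,1]$; hence, for every $t>0$, $$\Gamma_t(\sigma_u(G))\stackrel{(law)}{=}\int_0^t\frac{d\gamma_s}{\sigma_u\left[F_G^{-1}\left(1-\frac st\right)\right]}\stackrel{(law)}{=}\int_0^t\frac{d\gamma_s}{\sigma_u\left[F_G^{-1}\left(\frac st\right)\right]} .$$ 3) For every $t>0$ the density $f_{\Gamma_t(\sigma_u(G))}$ of $\Gamma_t(\sigma_u(G))$ equals, for $x>0$, $$f_{\Gamma_t(\sigma_u(G))}(x)=\frac{e^{-x\tanh u-tk_u}}{\cosh u}\,E\left\{e^{-\Gamma_t(G)\tanh u}\left(\frac{\Gamma_t(G)}{x}\right)^{\frac{1-t}{2}}J_{t-1}\left(\frac{2\sqrt{x\,\Gamma_t(G)}}{\cosh u}\right)\right\}$$ $$=x^{t-1}\,\frac{e^{-x\tanh u-tk_u}}{\Gamma(t)}\,E\left[\left(\cosh u+D_t(G)\sinh u\right)^{-t}\exp\left(-\frac{x\,D_t(G)}{\cosh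 u\,(\cosh u+D_t(G)\sinh u)}\right)\right].$$
   Context: For a positive random variable $G$, $F_G$ is its cumulative distribution function and $F_G^{-1}$ is the right-continuous inverse of $F_G$ in the sense of composition of functions. For $G$ positive with $E(\log^+(1/G))<\infty$, $(\Gamma_t(G),\,t\ge0)$ denotes the subordinator characterized by $$E(e^{-\lambda\Gamma_t(G)})=\exp\{-t\,\psi_G(\lambda)\},\qquad\psi_G(\lambda):=\int_0^\infty(1-e^{-\lambda x})\frac{dx}{x}E(e^{-xG})=E\left(\log\left(1+\frac\lambda G\right)\right)\quad(\lambda\ge0).$$ For $t>0$, $D_t(G)$ is the positive random variable whose law is characterized by $\Gamma_t(G)\stackrel{(law)}{=}\gamma_t\cdot D_t(G)$ with independent factors. $(\gamma_t,\,t\ge0)$ is the standard gamma process (the subordinator without drift and with Lévy measure $\frac{dx}{x}e^{-x}$, so $\gamma_t$ is a gamma variable with parameter $t$). Integrals $\int_0^th(s)\,d\gamma_s$ with $h\ge0$ are pathwise Stieltjes integrals. $J_\nu(z)=\sum_{k\ge0}\frac{(-1)^k}{\Gamma(k+1)\Gamma(k+\nu+1)}\left(\frac z2\right)^{\nu+2k}$ is the Bessel function of index $\nu$.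
   Formalization: In 3), for u=0 and t<1/2 the first expectation may not exist (the variable grows like Γ_t(G)^{1/4−t/2}); the first formula is stated when that variable is integrable (proved if u>0 or t≥1/2), and in all cases with E{…} read as the limit of E{…; Γ_t(G)≤N} as N→∞. *)

(* Defs.v *)
From HB Require Import structures.
From mathcomp Require Export all_boot all_order all_algebra.
From mathcomp Require Export all_classical all_reals all_analysis.
From mathcomp Require Export measurable_realfun.
Export Order.TTheory GRing.Theory Num.Theory.
Export numFieldNormedType.Exports.

Set Implicit Arguments.
Unset Strict Implicit.
Unset Printing Implicit Defensive.

Local Open Scope classical_set_scope.
Local Open Scope ring_scope.

Section special_functions.
Context {R : realType}.

Definition sinh (u : R) : R := (expR u - expR (- u)) / 2.
Definition cosh (u : R) : R := (expR u + expR (- u)) / 2.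
Definition tanh (u : R) : R := sinh u / cosh u.

(* Euler's integral; meaningful for [0 < a], the only range used below. *)
Definition Gamma (a : R) : R :=
  Rintegral (@lebesgue_measure R) `]0, +oo[
    (fun x => x `^ (a - 1) * expR (- x)).

(* Used for [-1 < nu] and [0 < z], so that every [Gamma] argument is positive
   and the real powers of [z / 2] are the ordinary ones. *)
Definition besselJ (nu z : R) : R :=
  limn (series (fun k : nat =>
    (-1) ^+ k / (Gamma (k%:R + 1) * Gamma (k%:R + nu + 1))
      * (z / 2) `^ (nu + 2 * k%:R))).

Definition sigma (u x : R) : R :=
  (x * sinh u + cosh u) / (x * cosh u + sinh u).

Lemma measurable_invr : measurable_fun [set: R] (@GRing.inv R).
Proof.
have m0 : measurable [set 0 : R] by exact: measurable_set1.
have -> : [set: R] = [set 0] `|` [set~ 0] by rewrite setUv.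
apply/(measurable_funU _ m0 (measurableC m0)); split.
  exact: measurable_fun_set1.
apply: open_continuous_measurable_fun.
  by apply: closed_openC; exact: closed_eq.
by move=> x /set_mem /= /eqP x0; exact: inv_continuous.
Qed.

Lemma measurable_sigma (u : R) : measurable_fun [set: R] (sigma u).
Proof.
apply: measurable_funM.
  by apply: measurable_funD => //; apply: measurable_funM.
apply: (measurableT_comp measurable_invr).
by apply: measurable_funD => //; apply: measurable_funM.
Qed.

HB.instance Definition _ (u : R) :=
  isMeasurableFun.Build _ _ R R (sigma u) (measurable_sigma u).

End special_functions.

Section laws.
Context {R : realType}.

Definition eq_law d1 d2 d (T1 : measurableType d1) (T2 : measurableType d2)
    (E : measurableType d)
    (P1 : {measure set T1 -> \bar R}) (P2 : {measure set T2 -> \bar R})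
    (X : T1 -> E) (Y : T2 -> E) : Prop :=
  [/\ measurable_fun [set: T1] X, measurable_fun [set: T2] Y &
      forall A, measurable A -> P1 (X @^-1` A) = P2 (Y @^-1` A)].

Definition is_density (mu : set R -> \bar R) (f : R -> R) : Prop :=
  [/\ measurable_fun [set: R] f, forall x, 0 <= f x &
      forall A, measurable A ->
        mu A = (\int[@lebesgue_measure R]_(x in A) (f x)%:E)%E].

(* The right-continuous inverse of the cumulative distribution function.  It is
   the usual one for [0 < y < 1]; at [y = 1] the set may be empty, in which
   case [inf] returns 0. *)
Definition cdf_inv d (T : measurableType d) (P : probability T R)
    (X : {RV P >-> R}) (y : R) : R :=
  inf [set x | (y%:E < cdf X x)%E].

End laws.

Section subordinators.
Context {R : realType}.

Definition levy_exponent (l : R -> R) (lambda : R) : \bar R :=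
  (\int[@lebesgue_measure R]_(x in `]0%R, +oo[)
     ((1 - expR (- (lambda * x))) * l x)%:E)%E.

(* A driftless subordinator with Lévy measure [l x dx] on the positive
   half-line.  Only times [0 <= s] are meaningful. *)
Record subordinator d (T : measurableType d) (P : probability T R)
    (l : R -> R) := Subordinator {
  sub_process :> R -> {RV P >-> R} ;
  sub_start : forall w, sub_process 0 w = 0 ;
  sub_nondecreasing : forall w s t,
    0 <= s -> s <= t -> sub_process s w <= sub_process t w ;
  sub_right_continuous : forall w s,
    0 <= s -> sub_process r w @[r --> s^'+] --> sub_process s w ;
  sub_stationary : forall s t, 0 <= s -> s <= t ->
    eq_law P P (fun w => sub_process t w - sub_process s w)
      (sub_process (t - s)) ;
  sub_independent : forall (n : nat) (tau : nat -> R) (A : nat -> set R),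
    0 <= tau 0%N -> nondecreasing_seq tau -> (forall i, measurable (A i)) ->
    P (\bigcap_(i in `I_n)
         [set w | A i (sub_process (tau i.+1) w - sub_process (tau i) w)]) =
    (\prod_(i < n)
       P [set w | A i (sub_process (tau i.+1) w - sub_process (tau i) w)%R])%E ;
  sub_laplace : forall t lambda, 0 <= t -> 0 <= lambda ->
    ('E_P[fun w => expR (- (lambda * sub_process t w))] =
     expeR (- (t%:E * levy_exponent l lambda)))%E }.

Arguments sub_start {d T P l} _ _.
Arguments sub_nondecreasing {d T P l} _ _ _ _ _ _.
Arguments sub_right_continuous {d T P l} _ _ {s} _.
Arguments sub_stationary {d T P l} _ {s t} _ _.
Arguments sub_laplace {d T P l} _ {t lambda} _ _.

(* A path, extended by 0 to negative times. *)
Definition sub_path d (T : measurableType d) (P : probability T R) (l : R -> R)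
    (X : subordinator P l) (w : T) (s : R) : R := X (Num.max 0 s) w.

Section path_cumulative.
Context d (T : measurableType d) (P : probability T R) (l : R -> R).
Variables (X : subordinator P l) (w : T).

Lemma sub_path_nondecreasing : nondecreasing (sub_path X w).
Proof.
move=> s t st; apply: sub_nondecreasing; first by rewrite le_max lexx.
by rewrite ge_max !le_max lexx st orbT.
Qed.

Lemma sub_path_right_continuous : right_continuous (sub_path X w).
Proof.
move=> s; have [s0|s0] := leP 0 s.
  rewrite /sub_path max_r//.
  apply: cvg_trans (sub_right_continuous X w s0).
  apply: near_eq_cvg; near=> r; rewrite max_r//.
  by rewrite (le_trans s0)// ltW//; near: r; exact: nbhs_right_gt.
rewrite /sub_path (max_l (ltW s0)).
apply: cvg_trans (cvg_cst (X 0 w) : cst (X 0 w) @ s^'+ --> X 0 w).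
apply: near_eq_cvg; near=> r; rewrite max_l//.
by rewrite ltW//; near: r; exact: nbhs_right_lt.
Unshelve. all: end_near. Qed.

HB.instance Definition _ := isCumulative.Build R _ R (sub_path X w)
  sub_path_nondecreasing sub_path_right_continuous.

End path_cumulative.

(* The pathwise Stieltjes integral of [h >= 0] over [(0, t]], a value in
   [[0, +oo]]. *)
Definition stieltjes_integral d (T : measurableType d) (P : probability T R)
    (l : R -> R) (X : subordinator P l) (h : R -> R) (t : R) (w : T) : \bar R :=
  (\int[lebesgue_stieltjes_measure (sub_path X w)]_(s in `]0%R, t]) (h s)%:E)%E.

Definition gamma_process d (T : measurableType d) (P : probability T R) :=
  subordinator P (fun x => expR (- x) / x).

Definition ggc_levy_density d (T : measurableType d) (P : probability T R)
    (G : T -> R) (x : R) : R :=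
  fine 'E_P[fun w => expR (- (x * G w))] / x.

Definition psi d (T : measurableType d) (P : probability T R)
    (G : T -> R) (lambda : R) : \bar R :=
  levy_exponent (ggc_levy_density P G) lambda.

(* The process written Gamma_t(G); it may live on a space other than that
   of [G], of which only the law matters. *)
Definition ggc_subordinator d (T : measurableType d) (P : probability T R)
    (G : T -> R) d' (T' : measurableType d') (P' : probability T' R) :=
  subordinator P' (ggc_levy_density P G).

(* [D] has the law of D_t(G), given that [Y] has that of Gamma_t(G): the
   product space makes gamma_t and [D] independent. *)
Definition gamma_factor
    d1 (T1 : measurableType d1) (P1 : probability T1 R) (Y : T1 -> R)
    d2 (T2 : measurableType d2) (P2 : probability T2 R)
    (gam : gamma_process P2) (t : R)
    d3 (T3 : measurableType d3) (P3 : probability T3 R) (D : {RV P3 >-> R}) :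
    Prop :=
  {ae P3, forall w, 0 < D w} /\
  eq_law P1 (P2 \x P3)%E Y (fun w => gam t w.1 * D w.2).

Definition kconst d (T : measurableType d) (P : probability T R)
    (u : R) (G : T -> R) : \bar R :=
  'E_P[fun w => ln (G w / (G w * sinh u + cosh u))].

End subordinators.

(* Main.v *)
From HB Require Import structures.
Require Import Defs.
From mathcomp Require Import ring lra.

(** Two finite measures on [0, +oo] with the same Laplace transform agree
    ([laplace_uniqueness]): (1 - r^n)^(n 2^n) tends to the indicator of r < 1/2,
    and evaluated at r = e^(-l s) it is a combination of exponentials of s, so
    the transform determines all tails. Frullani's integral and Tonelli's
    theorem give psi_G(l) = E log(1 + l/G) ([psiE]). Every equality in law
    stated is therefore an identity between expected logarithms.

    With s = sigma_u one has, for every g > 0,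
      1 + l/s(g) = (1 + s(l)/g) (l cosh u + sinh u) g/(g sinh u + cosh u),
    and taking logarithms and expectations gives [psi_duality]. The quotient
    g/(g sinh u + cosh u) has an integrable logarithm: for u > 0 it is bounded
    by 1/sinh u and its smallness is controlled by log^+ (1/G), while for u = 0
    it is G itself and log^+ G has to be integrable too ([integrable_kconst]).

    The function s is continuous and decreasing, so for y in ]0, 1[ the quantile
    relation can fail only when 1 - y is the height of a flat piece of the
    distribution function; such a piece contains a rational point, which leaves
    countably many y ([cdf_inv_sigma]). Independence and stationarity of the
    gamma increments show that the integral of a step function h against the
    gamma process has Laplace exponent equal to the integral of log(1 + l h);
    limits of step functions extend this to functions continuous from one side
    ([wiener_law_left_continuous], [wiener_law_right_continuous]). As the
    quantile of a uniform variable has the law of G, the exponents of both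
    integrals are t times that of sigma_u(G) ([eq_law_quantile_representation]).

    The density is defined by the formula in D = D_t(G). Integrating e^(-l x)
    first in x and using
      (cosh u + D sinh u) (l + tanh u + D/(cosh u (cosh u + D sinh u)))
        = (l cosh u + sinh u) (1 + s(l) D)
    together with E (1 + r D)^(-t) = E e^(-r Gamma_t(G)) for r = s(l), the
    Laplace transform is computed by [psi_duality] ([is_density_sigma]).

    For the Bessel formula, J_(t-1)(2 z) = z^(t-1) j_t(z^2) where
    j_t(y) = sum_k (-y)^k/(k! Gamma(k+t)). As Gamma_t(G) is the product of a
    gamma variable g and an independent D, the expectation truncated at
    Gamma_t(G) <= N is, up to a constant factor, the expectation over D of the
    integral over [0, N/D] of g^(t-1) e^(-b g) j_t(y g), with b = 1 + D tanh u
    and y = x D/cosh^2 u; for N = +oo that integral is b^(-t) e^(-y/b)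
    ([integral_gamma_bessel]) and yields the other formula. Exchanging the limit
    in N with the expectation requires a bound uniform in N, b and y
    ([gamma_bessel_bound]). For t >= 1/2 the function j_t is bounded, because
    j_t^2 + y j_(t+1)^2 is nonincreasing. For t < 1/2 it grows like y^(1/4 -
    t/2) and the integrand is not dominated; integration by parts moves the
    oscillation to the primitive g^t j_(t+1)(y g), which is bounded
    ([bessel_primitive_bounded]). *)

Set Implicit Arguments.
Unset Strict Implicit.
Unset Printing Implicit Defensive.

Local Open Scope classical_set_scope.
Local Open Scope ring_scope.

(** * Laplace transforms determine finite laws on the half-line *)

Section density_measure.
Context d (T : measurableType d) {R : realType}.
Local Open Scope ereal_scope.

(** The proofs of measurability and nonnegativity are arguments so that the
    measure structure can be attached to this name. *)
Definition density_measure (mu : {measure set T -> \bar R}) (f : T -> R)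
    of measurable_fun [set: T] f & (forall x, 0 <= f x)%R :=
  fun A : set T => \int[mu]_(x in A) (f x)%:E.

Section instance.
Variable mu : {measure set T -> \bar R}.
Variables (f : T -> R) (mf : measurable_fun [set: T] f).
Variable f0 : (forall x, 0 <= f x)%R.

Let density0 : density_measure mu mf f0 set0 = 0.
Proof. by rewrite /density_measure integral_set0. Qed.

Let density_ge0 A : 0 <= density_measure mu mf f0 A.
Proof. by apply: integral_ge0 => x _; rewrite lee_fin. Qed.

Let density_sigma : semi_sigma_additive (density_measure mu mf f0).
Proof.
move=> F mF tF mUF; rewrite /density_measure ge0_integral_bigcup//.
- by apply: is_cvg_nneseries => n _ _; exact: density_ge0.
- by apply: measurable_funTS; exact/measurable_EFinP.
- by move=> x _; rewrite lee_fin.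
Qed.

HB.instance Definition _ := isMeasure.Build _ _ _ (density_measure mu mf f0)
  density0 density_ge0 density_sigma.

Import HBNNSimple.

(** For the indicator of a set this is the definition of the measure; linearity
    gives simple functions, and both sides pass to increasing limits. *)
Lemma ge0_integral_density (g : T -> \bar R) :
  measurable_fun [set: T] g -> (forall x, 0 <= g x) ->
  \int[density_measure mu mf f0]_x g x = \int[mu]_x (g x * (f x)%:E).
Proof.
move=> mg g0; pose h := nnsfun_approx measurableT mg.
have mfE : measurable_fun [set: T] (fun x => (f x)%:E) by exact/measurable_EFinP.
have hnd x a b : (a <= b)%N -> (h a x <= h b x)%R.
  by move=> ab; exact/lefP/nd_nnsfun_approx.
have -> : \int[density_measure mu mf f0]_x g x =
    lim (\int[density_measure mu mf f0]_x (EFin \o h n) x @[n --> \oo]).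
  under eq_integral.
    move=> x _.
    have -> : g x = limn (fun n => (EFin \o h n) x).
      by apply/esym/cvg_lim => //; exact: cvg_nnsfun_approx.
    over.
  apply: monotone_convergence => //.
  - by move=> n; exact/measurable_EFinP.
  - by move=> n x _; rewrite lee_fin.
  - by move=> x _ a b ab; rewrite lee_fin; exact: hnd.
have -> : \int[mu]_x (g x * (f x)%:E) =
    lim (\int[mu]_x ((EFin \o h n) x * (f x)%:E) @[n --> \oo]).
  under eq_integral.
    move=> x _.
    have -> : g x * (f x)%:E = limn (fun n => (EFin \o h n) x * (f x)%:E).
      apply/esym/cvg_lim => //; apply: cvgeZr => //; exact: cvg_nnsfun_approx.
    over.
  apply: monotone_convergence => //.
  - move=> n.
    have mh : measurable_fun [set: T] (EFin \o h n) by exact/measurable_EFinP.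
    exact: emeasurable_funM mh mfE.
  - by move=> n x _; rewrite mule_ge0 ?lee_fin.
  - move=> x _ a b ab; by apply: lee_wpmul2r; rewrite lee_fin//; exact: hnd.
congr (limn _); apply/funext => n.
have sumE x : (EFin \o h n) x =
    \sum_(y \in range (h n)) (y * \1_(h n @^-1` [set y]) x)%:E.
  by rewrite /= {1}fimfunE -fsumEFin.
under [LHS]eq_integral do rewrite sumE.
under [RHS]eq_integral => x _.
  rewrite sumE ge0_mule_fsuml; last by move=> y; exact: nnfun_muleindic_ge0.
  over.
have mi r : measurable_fun setT (fun x => (r * \1_(h n @^-1` [set r]) x)%:E).
  by apply/measurable_EFinP; exact: measurable_funM.
have nn r x : (0 <= r * \1_(h n @^-1` [set r]) x)%R.
  by rewrite -lee_fin; exact: nnfun_muleindic_ge0.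
rewrite !ge0_integral_fsum//; first last.
- by move=> m y Ey; exact: nn.
- by move=> m y Ey; rewrite mule_ge0 ?lee_fin// nn.
- by move=> y; exact: emeasurable_funM (mi y) mfE.
apply: eq_fsbigr => r /[!inE] -[z _ <-].
under eq_integral do rewrite EFinM.
under [RHS]eq_integral do rewrite EFinM -muleA.
rewrite integralZl_indic_nnsfun// ge0_integralZl//.
- congr (_ * _); rewrite integral_indic// setIT.
  transitivity (\int[mu]_(x in h n @^-1` [set h n z]) (f x)%:E).
    by rewrite /density_measure.
  rewrite [LHS]integral_mkcond; apply: eq_integral => x _.
  by rewrite epatch_indic muleC.
- have mi1 : measurable_fun [set: T]
      (fun x => (\1_(h n @^-1` [set h n z]) x : R)%:E) by exact/measurable_EFinP.
  exact: emeasurable_funM mi1 mfE.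
- by move=> x _; rewrite mule_ge0 ?lee_fin.
- by rewrite lee_fin.
Qed.

Lemma integral_density (g : T -> R) : measurable_fun [set: T] g ->
  \int[density_measure mu mf f0]_x (g x)%:E = \int[mu]_x (g x * f x)%:E.
Proof.
move=> mg; have mgE : measurable_fun [set: T] (EFin \o g).
  exact/measurable_EFinP.
rewrite [LHS]integralE [RHS]integralE !ge0_integral_density//.
- congr (_ - _); apply: eq_integral => x _.
    rewrite !funeposE -!EFin_max -EFinM; congr EFin.
    by rewrite maxr_pMl// mul0r.
  rewrite !funenegE -!EFinN -!EFin_max -EFinM; congr EFin.
  by rewrite maxr_pMl// mul0r mulNr.
- exact: measurable_funeneg.
- exact: measurable_funepos.
Qed.

End instance.
End density_measure.

Section laplace_uniqueness.
Context {R : realType}.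

(** Bernoulli's inequality, for negative x as well: the sign of x decides which
    side of the threshold it serves. *)
Lemma bernoulli_ineq n (x : R) : -1 <= x -> 1 + n%:R * x <= (1 + x) ^+ n.
Proof.
move=> x1; elim: n => [|n ih]; first by rewrite mul0r addr0 expr0.
rewrite exprS; apply: (@le_trans _ _ ((1 + x) * (1 + n%:R * x))).
  have : 0 <= n%:R * x ^+ 2 by rewrite mulr_ge0 ?sqr_ge0.
  by rewrite -natr1; move: (n%:R : R) => m; nra.
by rewrite ler_wpM2l//; lra.
Qed.

Lemma cvg_mulrn_expr (q : R) : 0 <= q < 1 -> n%:R * q ^+ n @[n --> \oo] --> 0.
Proof.
move=> /andP[q0 q1].
have [->|qn0] := eqVneq q 0.
  apply: (@cvg_trans _ (cst 0 @ \oo)); last exact: cvg_cst.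
  apply: near_eq_cvg; near=> n.
  have n0 : (0 < n)%N by near: n; exact: nbhs_infty_gt.
  by rewrite expr0n gtn_eqF// mulr0.
have q_gt0 : 0 < q by rewrite lt_def qn0.
(* Half of the decay is spent on n: with s = sqrt q, Bernoulli's inequality for
   1/s gives n s^n <= 1/(1/s - 1). *)
pose s := Num.sqrt q.
have s0 : 0 < s by rewrite sqrtr_gt0.
have s1 : s < 1 by rewrite -[ltRHS]sqrtr1 ltr_sqrt.
have ss : q = s ^+ 2 by rewrite sqr_sqrtr.
pose d := s^-1 - 1.
have d0 : 0 < d by rewrite subr_gt0 invf_gt1.
have bnd n : 0 <= n%:R * q ^+ n <= d^-1 * s ^+ n.
  rewrite mulr_ge0 ?exprn_ge0//= ss -exprM mulnC exprM expr2 mulrA.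
  have sn0 : 0 < s ^+ n by rewrite exprn_gt0.
  rewrite ler_wpM2r ?(ltW sn0)//.
  rewrite -ler_pdivlMr// -exprVn.
  have -> : s^-1 = 1 + d by rewrite /d addrC subrK.
  rewrite ler_pdivlMl// mulrC (le_trans _ (bernoulli_ineq n _)) ?lerDr//.
  by rewrite invr_ge0 ltW.
apply: (@squeeze_cvgr _ _ _ _ (cst 0) (fun n => d^-1 * s ^+ n)).
- by near=> n; exact: bnd.
- exact: cvg_cst.
- rewrite -[X in _ --> X](mulr0 d^-1); apply: cvgMr.
  by apply: cvg_expr; rewrite gtr0_norm.
Unshelve. all: by end_near. Qed.

(** For r < 1/2, Bernoulli's inequality bounds the power below by 1 - n (2 r)^n.
    For r >= 1/2, the inequality 1 - x <= 1/(1 + x) followed by Bernoulli's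
    bounds it above by 1/(1 + n (2 r)^n). *)
Lemma cvg_threshold_poly (r : R) : 0 <= r <= 1 ->
  (1 - r ^+ n) ^+ (n * 2 ^ n) @[n --> \oo] --> ((r < 1 / 2)%R%:R : R).
Proof.
move=> /andP[r0 r1].
have rn0 n : 0 <= r ^+ n by rewrite exprn_ge0.
have rn1 n : r ^+ n <= 1 by rewrite exprn_ile1.
have [rlt|rge] := ltP r (1 / 2).
  have q1 : 0 <= 2 * r < 1 by apply/andP; split; lra.
  apply: (@squeeze_cvgr _ _ _ _ (fun n => 1 - n%:R * (2 * r) ^+ n) (cst 1)).
  - near=> n; apply/andP; split; last first.
      by rewrite exprn_ile1// ?subr_ge0// lerBlDr lerDl.
    rewrite -[1 - r ^+ n]/(1 + - r ^+ n).
    apply: le_trans (bernoulli_ineq _ _); last by rewrite lerN2.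
    by rewrite mulrN lerB// natrM natrX exprMn mulrA.
  - rewrite -[X in _ --> X]subr0; apply: cvgB; first exact: cvg_cst.
    exact: cvg_mulrn_expr.
  - exact: cvg_cst.
apply: (@squeeze_cvgr _ _ _ _ (cst 0) (fun n => n.+1%:R^-1)).
- near=> n; apply/andP; split; first by rewrite exprn_ge0// subr_ge0.
  have x1 : 1 - r ^+ n <= (1 + r ^+ n)^-1.
    rewrite -[leRHS]mul1r ler_pdivlMr ?ltr_pwDl//.
    rewrite mulrDr mulr1 mulrBl mul1r addrA subrK lerBlDr lerDl.
    by rewrite mulr_ge0.
  apply: (le_trans (lerXn2r _ _ _ x1)); rewrite ?nnegrE ?subr_ge0// ?invr_ge0.
    by rewrite addr_ge0.
  rewrite exprVn lef_pV2 ?posrE ?ltr0n ?exprn_gt0 ?ltr_pwDl//.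
  apply: le_trans (bernoulli_ineq _ _); last by rewrite (le_trans _ (rn0 n))// oppr_le0.
  rewrite -natr1 addrC lerD2l natrM natrX -mulrA -exprMn.
  rewrite ler_peMr// exprn_ege1//.
  by move: rge; lra.
- exact: cvg_cst.
- exact: cvg_harmonic.
Unshelve. all: by end_near. Qed.

(** The exponential e^(-l s) as a real number, so that polynomials can be
    evaluated at it; at s = +oo it is 0. *)
Definition laplace_kernel (l : R) (s : \bar R) : R := fine (expeR (- (l%:E * s))).

Lemma laplace_kernelE l s : 0 < l -> (0 <= s)%E ->
  (laplace_kernel l s)%:E = expeR (- (l%:E * s)).
Proof.
move=> l0; rewrite /laplace_kernel; case: s => [s|_|//]; first by [].
by rewrite gt0_muley ?lte_fin.
Qed.

Lemma laplace_kernel01 l s : 0 < l -> (0 <= s)%E ->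
  0 <= laplace_kernel l s <= 1.
Proof.
move=> l0 s0; rewrite -!lee_fin laplace_kernelE// expeR_ge0/= -expeR0 lee_expeR.
by rewrite oppe_le0 mule_ge0// lee_fin ltW.
Qed.

Lemma laplace_kernelX n l s : 0 < l -> (0 <= s)%E -> (0 < n)%N ->
  laplace_kernel (n%:R * l) s = laplace_kernel l s ^+ n.
Proof.
move=> l0 + n0; rewrite /laplace_kernel; case: s => [s|_|//] /=.
  by rewrite -mulrA -mulrN expRM_natl.
by rewrite !gt0_muley ?lte_fin ?mulr_gt0 ?ltr0n//= expr0n gtn_eqF.
Qed.

(** The rate is chosen so that e^(-l a) = 1/2: comparing the kernel with 1/2
    then compares s with a. *)
Lemma laplace_kernel_lt a s : 0 < a -> (0 <= s)%E ->
  (laplace_kernel (ln 2 / a) s < 1 / 2) = (a%:E < s)%E.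
Proof.
move=> a0; have l0 : 0 < ln 2 / a by rewrite divr_gt0// ln_gt0// ltr1n.
rewrite /laplace_kernel; case: s => [s|_|//] /=.
  move=> _; rewrite lte_fin mul1r expRN ltf_pV2 ?posrE ?expR_gt0//.
  rewrite -[X in X < _]lnK ?posrE// ltr_expR mulrAC -mulrA -[X in X < _]mulr1.
  by rewrite ltr_pM2l ?ln_gt0 ?ltr1n// ltr_pdivlMr// mul1r.
by rewrite gt0_muley ?lte_fin//= ltry; lra.
Qed.

Lemma measurable_laplace_kernel l :
  measurable_fun [set: \bar R] (laplace_kernel l).
Proof.
have -> : laplace_kernel l = fun s => if s == +oo%E then laplace_kernel l +oo
    else if s == -oo%E then laplace_kernel l -oo else expR (- (l * fine s)).
  by apply/funext => -[s| |].
apply: measurable_fun_ifT => //=; first exact: measurable_fun_eqe.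
apply: measurable_fun_ifT => //=; first exact: measurable_fun_eqe.
apply: measurableT_comp => //; apply: measurableT_comp => //.
exact: measurable_funM.
Qed.

Section one_measure.
Context d (T : measurableType d) (m : {measure set T -> \bar R}).
Variable S : T -> \bar R.
Hypotheses (mS : measurable_fun setT S) (S0 : forall w, (0 <= S w)%E).
Hypothesis mfin : (m setT < +oo)%E.
Local Open Scope ereal_scope.

Let integrable_bounded01 (f : T -> R) : measurable_fun setT f ->
  (forall w, 0 <= f w <= 1)%R -> m.-integrable setT (EFin \o f).
Proof.
move=> mf f01; apply: measurable_bounded_integrable => //.
exists 1%R; split; first exact: num_real.
move=> M M1 w _ /=; have /andP[f0 f1] := f01 w.
by rewrite ger0_norm// (le_trans f1)// ltW.
Qed.

(** Powers of the kernel are kernels at multiples of l, so this integral depends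
    only on the Laplace transform and, through the constant coefficient, on the
    mass. *)
Lemma integral_poly_laplace (p : {poly R}) (l : R) : (0 < l)%R ->
  \int[m]_w (p.[laplace_kernel l (S w)])%:E =
  \sum_(i < size p) (p`_i)%:E *
    if (i : nat) is 0%N then m setT
    else \int[m]_w expeR (- ((i%:R * l)%:E * S w)).
Proof.
move=> l0.
have mi (i : nat) : measurable_fun [set: T] (fun w => laplace_kernel l (S w) ^+ i)%R.
  by apply: measurable_funX; exact: measurableT_comp (measurable_laplace_kernel l) mS.
have ii (i : nat) : m.-integrable setT (fun w => (laplace_kernel l (S w) ^+ i)%:E).
  apply: integrable_bounded01 => // w; have /andP[k0 k1] := laplace_kernel01 l0 (S0 w).
  by rewrite exprn_ge0//= exprn_ile1.
under eq_integral do rewrite horner_coef -sumEFin.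
rewrite integral_sum//; last first.
  move=> i; under eq_fun do rewrite EFinM; exact: integrableZl.
apply: eq_bigr => i _.
under eq_integral do rewrite EFinM.
rewrite integralZl//; congr (_ * _).
case: (i : nat) => [|k].
  by under eq_integral do rewrite expr0; rewrite integral_cst// mul1e.
apply: eq_integral => w _.
by rewrite -laplace_kernelX// laplace_kernelE// mulr_gt0.
Qed.

Definition threshold_poly n : {poly R} := ((1 - 'X^n) ^+ (n * 2 ^ n))%R.

Lemma cvg_integral_threshold (a : R) : (0 < a)%R ->
  \int[m]_w ((threshold_poly n).[laplace_kernel (ln 2 / a) (S w)])%:E @[n --> \oo]
    --> m [set w | a%:E < S w].
Proof.
move=> a0; set l := (ln 2 / a)%R.
have l0 : (0 < l)%R by rewrite divr_gt0// ln_gt0// ltr1n.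
pose A : set T := [set w | a%:E < S w].
have mA : measurable A.
  by rewrite -[X in measurable X]setTI; exact: emeasurable_fun_o_infty.
rewrite -/A.
have -> : m A = \int[m]_w (\1_A w)%:E.
  by rewrite integral_indic// setIT.
have pE n w : (threshold_poly n).[laplace_kernel l (S w)]%R =
    ((1 - laplace_kernel l (S w) ^+ n) ^+ (n * 2 ^ n))%R.
  by rewrite /threshold_poly !hornerE.
under eq_fun do under eq_integral do rewrite pE.
have mk n : measurable_fun [set: T] (fun w =>
    (1 - laplace_kernel l (S w) ^+ n) ^+ (n * 2 ^ n))%R.
  apply: measurable_funX; apply: measurable_funB => //; apply: measurable_funX.
  exact: measurableT_comp (measurable_laplace_kernel l) mS.
have k01 w := laplace_kernel01 l0 (S0 w).
apply: (@dominated_cvg _ _ _ m setT measurableT _ _ (cst 1)).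
- by move=> n; exact/measurable_EFinP.
- move=> w _; apply/cvg_EFin; first by near=> n.
  have := cvg_threshold_poly (k01 w); rewrite laplace_kernel_lt//.
  rewrite indicE (_ : w \in A = (a%:E < S w)); last first.
    by apply/idP/idP => [|h]; [rewrite inE|rewrite inE].
  by apply: cvg_trans.
- by [].
- by apply: integrable_bounded01 => //; move=> w; rewrite ler01 lexx.
- move=> n w _; rewrite lee_fin; have /andP[k0 k1] := k01 w.
  have k1n : (0 <= 1 - laplace_kernel l (S w) ^+ n)%R by rewrite subr_ge0 exprn_ile1.
  rewrite ger0_norm ?exprn_ge0// exprn_ile1// lerBlDr lerDl.
  by rewrite exprn_ge0.
Unshelve. all: by end_near. Qed.

End one_measure.

(** The open rays together with the whole line form a pi-system that generates
    the Borel sets of the extended line. *)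
Lemma eq_measure_tails d1 (T1 : measurableType d1) d2 (T2 : measurableType d2)
    (m1 : {measure set T1 -> \bar R}) (m2 : {measure set T2 -> \bar R})
    (S1 : T1 -> \bar R) (S2 : T2 -> \bar R) :
  measurable_fun setT S1 -> measurable_fun setT S2 ->
  (m1 setT < +oo)%E -> m1 setT = m2 setT ->
  (forall a : R, m1 [set w | a%:E < S1 w]%E = m2 [set w | a%:E < S2 w]%E) ->
  forall A, measurable A -> m1 (S1 @^-1` A) = m2 (S2 @^-1` A).
Proof.
move=> mS1 mS2 m1fin m12 ray A.
pose G : set (set \bar R) := @ErealGenOInfty.G R `|` [set setT].
have mG : @measurable _ (\bar R) = <<s G >>.
  have : @measurable _ (\bar R) = <<s @ErealGenOInfty.G R >>.
    exact: ErealGenOInfty.measurableE.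
  move=> mE; apply/seteqP; split => [B|].
    rewrite mE; apply: sub_smallest2r; first exact: smallest_sigma_algebra.
    by move=> C; left.
  apply: smallest_sub; first exact: sigma_algebra_measurable.
  move=> B [BG|->]; last exact: measurableT.
  by rewrite mE; exact: sub_sigma_algebra.
move=> mA.
apply: (@measure_unique _ _ (\bar R) G (fun=> setT) mG _ _ _
  (pushforward m1 S1) (pushforward m2 S2)) => //.
- move=> B C [[a ->]|->] [[b ->]|->]; rewrite ?setIT ?setTI; try by [left; exists a|left; exists b|right].
  left; exists (Num.max a b); apply/seteqP; split => x /=;
    rewrite !in_itv/= !andbT EFin_max gt_max.
    by move=> [-> ->].
  by move=> /andP[].
- by right.
- by rewrite bigcup_const//; exists 0%N.
- move=> B [[a ->]|->]; rewrite /pushforward ?preimage_setT//.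
  have E d (T : measurableType d) (S : T -> \bar R) :
      S @^-1` `]a%:E, +oo[ = [set w | a%:E < S w]%E.
    by apply/seteqP; split => w /=; rewrite in_itv/= andbT.
  by have := ray a; rewrite -!E.
Qed.

Lemma preimage_EFin (T : Type) (X : T -> R) (A : set R) :
  X @^-1` A = (EFin \o X) @^-1` (EFin @` A).
Proof. by apply/seteqP; split => w /=; [exists (X w)|case=> r Ar [<-]]. Qed.

Section uniqueness.
Context d1 (T1 : measurableType d1) (m1 : {measure set T1 -> \bar R}).
Context d2 (T2 : measurableType d2) (m2 : {measure set T2 -> \bar R}).
Variables (S1 : T1 -> \bar R) (S2 : T2 -> \bar R).
Hypotheses (mS1 : measurable_fun setT S1) (mS2 : measurable_fun setT S2).
Hypotheses (S1_ge0 : forall w, (0 <= S1 w)%E) (S2_ge0 : forall w, (0 <= S2 w)%E).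
Hypotheses (m1fin : (m1 setT < +oo)%E) (m12 : m1 setT = m2 setT).
Hypothesis laplace12 : forall l : R, 0 < l ->
  (\int[m1]_w expeR (- (l%:E * S1 w)) = \int[m2]_w expeR (- (l%:E * S2 w)))%E.
Local Open Scope ereal_scope.

(** For a > 0 this is the limit of equal integrals of threshold polynomials; the
    ray above 0 is the increasing union of the rays above 1/(n+1). *)
Let ray (a : R) : m1 [set w | a%:E < S1 w] = m2 [set w | a%:E < S2 w].
Proof.
have pos b : (0 < b)%R -> m1 [set w | b%:E < S1 w] = m2 [set w | b%:E < S2 w].
  move=> b0; have m2fin : m2 setT < +oo by rewrite -m12.
  have c1 := cvg_integral_threshold mS1 S1_ge0 m1fin b0.
  have c2 := cvg_integral_threshold mS2 S2_ge0 m2fin b0.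
  apply: (cvg_unique _ c1) => //.
  apply: cvg_trans c2; apply: near_eq_cvg; near=> n.
  have l0 : (0 < ln 2 / b)%R by rewrite divr_gt0// ln_gt0// ltr1n.
  rewrite !integral_poly_laplace//; apply: eq_bigr => -[[|i] ilt] _ /=.
    by rewrite m12.
  by rewrite laplace12// mulr_gt0// ltr0n.
have [a0|a0|->] := ltgtP a 0%R; last first.
- have mA d (T : measurableType d) (S : T -> \bar R) (b : R) :
      measurable_fun setT S -> measurable [set w | b%:E < S w].
    by move=> mS; rewrite -[X in measurable X]setTI; exact: emeasurable_fun_o_infty.
  have U d (T : measurableType d) (S : T -> \bar R) :
      [set w | 0%:E < S w] = \bigcup_n [set w | n.+1%:R^-1%:E < S w].
    apply/seteqP; split => w /=; last first.
      by move=> [n _] /=; apply: lt_trans; rewrite lte_fin.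
    case SwE: (S w) => [r| |//] Sw; last by exists 0%N => //=; rewrite SwE ltry.
    rewrite lte_fin in Sw.
    have [n _ /(_ n (leqnn _))/= nr] := near_infty_natSinv_lt (PosNum Sw).
    by exists n => //=; rewrite SwE lte_fin.
  have c d (T : measurableType d) (m : {measure set T -> \bar R}) (S : T -> \bar R) :
      measurable_fun setT S ->
      m [set w | n.+1%:R^-1%:E < S w] @[n --> \oo] --> m [set w | 0%:E < S w].
    move=> mS; rewrite U; apply: nondecreasing_cvg_mu.
    - by move=> n; exact: mA.
    - by apply: bigcup_measurable => n _; exact: mA.
    - move=> i j ij; apply/subsetPset => w /=; apply: le_lt_trans.
      by rewrite lee_fin lef_pV2 ?posrE// ler_nat.
  have := c _ _ m1 _ mS1.
  under eq_fun do rewrite pos ?invr_gt0 ?ltr0n//.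
  by move=> /cvg_unique; apply => //; exact: c.
- exact: pos.
- have -> : [set w | a%:E < S1 w] = setT.
    by apply/seteqP; split => // w _ /=; rewrite (lt_le_trans _ (S1_ge0 w)).
  have -> // : [set w | a%:E < S2 w] = setT.
  by apply/seteqP; split => // w _ /=; rewrite (lt_le_trans _ (S2_ge0 w)).
Unshelve. all: by end_near. Qed.

Lemma laplace_uniqueness A : measurable A -> m1 (S1 @^-1` A) = m2 (S2 @^-1` A).
Proof. exact: eq_measure_tails ray A. Qed.

End uniqueness.

End laplace_uniqueness.

(** * Improper integrals and the gamma function *)

Lemma is_derive_continuous (R : realType) (f : R -> R) (x df : R) :
  is_derive x (1 : R) f df -> {for x, continuous f}.
Proof.
by move=> [fx _]; apply/differentiable_continuous/derivable1_diffP.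
Qed.

Section improper_ftc.
Context {R : realType}.
Local Notation leb := (@lebesgue_measure R).

Section limit_of_segments.
Variables (f F : R -> R) (D : set R) (a_ b_ : nat -> R) (l : R).
Hypothesis mD : measurable D.
Hypothesis ab : forall n, 0 < a_ n < b_ n.
Hypothesis abD : forall n, `[a_ n, b_ n] `<=` D.
Hypothesis Dab : forall x, D x -> \forall n \near \oo, a_ n <= x <= b_ n.
Hypothesis D0 : forall x, D x -> 0 < x.
Hypothesis dF : forall x : R, 0 < x -> is_derive x (1 : R) F (f x).
Hypothesis cf : forall x : R, 0 < x -> {for x, continuous f}.

Let mf : measurable_fun D f.
Proof.
have mf0 : measurable_fun (`]0, +oo[ : set R) f.
  apply: open_continuous_measurable_fun; first exact: interval_open.
  by move=> x /set_mem; rewrite /= in_itv/= andbT => /cf.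
have D0' : D `<=` (`]0, +oo[ : set R) by move=> x /D0; rewrite /= in_itv/= andbT.
exact: (measurable_funS _ D0' mf0).
Qed.

Let segment n : (\int[leb]_(x in `[a_ n, b_ n]) (f x)%:E = (F (b_ n) - F (a_ n))%:E)%E.
Proof.
have /andP[a0 abn] := ab n.
have pos x : x \in `[a_ n, b_ n]%R -> 0 < x.
  by rewrite in_itv/= => /andP[ax _]; exact: lt_le_trans ax.
have cF x : 0 < x -> {for x, continuous F}.
  by move=> x0; exact: is_derive_continuous (dF x0).
rewrite (@continuous_FTC2 _ _ F)//.
- apply: continuous_in_subspaceT => x /set_mem /= xab; apply: cf; exact: pos.
- split.
  + by move=> x xab; have [] := dF (pos x (subset_itv_oo_cc xab)).
  + by apply: cvg_at_right_filter; exact: cF.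
  + by apply: cvg_at_left_filter; apply: cF; rewrite (lt_trans a0).
- move=> x xab; rewrite derive1E.
  by have [_ ->] := dF (pos x (subset_itv_oo_cc xab)).
Qed.

Let indicE_ n x : D x ->
  (f x * \1_(`[a_ n, b_ n]) x)%:E = ((EFin \o f) \_ `[a_ n, b_ n]) x.
Proof.
move=> Dx; rewrite indicE patchE; case: ifPn => _; first by rewrite mulr1.
by rewrite mulr0.
Qed.

Let integral_indic_segment n :
  (\int[leb]_(x in D) (f x * \1_(`[a_ n, b_ n]) x)%:E = (F (b_ n) - F (a_ n))%:E)%E.
Proof.
rewrite -segment -[in RHS](setIidr (@abD n)) integral_mkcondr.
by apply: eq_integral => x /set_mem Dx; exact: indicE_.
Qed.

Let cvg_indic x : D x -> (f x * \1_(`[a_ n, b_ n]) x)%:E @[n --> \oo] --> (f x)%:E.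
Proof.
move=> Dx; apply: cvg_near_cst; near=> n; rewrite indicE mem_set ?mulr1//=.
by rewrite in_itv/=; near: n; exact: Dab.
Unshelve. all: by end_near. Qed.

Let mindic n : measurable_fun D (fun x => (f x * \1_(`[a_ n, b_ n]) x)%:E).
Proof.
by apply/measurable_EFinP; exact: measurable_funM.
Qed.

(** The segments [a_n, b_n] exhaust D, and dominated convergence applies with
    dominating function |f|. *)
Lemma integral_FTC_limit : F (b_ n) - F (a_ n) @[n --> \oo] --> l ->
  leb.-integrable D (EFin \o f) ->
  (\int[leb]_(x in D) (f x)%:E = l%:E)%E.
Proof.
move=> Fl fi.
have c1 : (\int[leb]_(x in D) (f x * \1_(`[a_ n, b_ n]) x)%:E)%E @[n --> \oo]
    --> (\int[leb]_(x in D) (f x)%:E)%E.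
  apply: (@dominated_cvg _ _ _ leb D mD _ _ (abse \o (EFin \o f))) => //.
  - exact: integrable_abse.
  - move=> n x Dx; rewrite /= lee_fin normrM indicE; case: (_ \in _).
      by rewrite normr1 mulr1.
    by rewrite normr0 mulr0.
have c2 : (\int[leb]_(x in D) (f x * \1_(`[a_ n, b_ n]) x)%:E)%E @[n --> \oo] --> l%:E.
  under eq_fun do rewrite integral_indic_segment.
  by apply: cvg_EFin => //; near=> n.
exact: (cvg_unique _ c1 c2).
Unshelve. all: by end_near. Qed.

(** By Fatou's lemma, the integral of f is at most the lower limit of the
    integrals over the segments. *)
Lemma ge0_integrable_FTC_limit : (forall x, D x -> 0 <= f x) ->
  (forall n, F (b_ n) - F (a_ n) <= l) -> leb.-integrable D (EFin \o f).
Proof.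
move=> f0 Fl; apply/integrableP; split; first exact/measurable_EFinP.
under eq_integral.
  move=> x /set_mem Dx; rewrite /= ger0_norm ?f0//.
  rewrite -(cvg_limn_einf_sup (cvg_indic Dx)).1.
  over.
apply: (@le_lt_trans _ _ l%:E); last by rewrite ltry.
apply: le_trans (fatou _ _ _ _) _ => //.
  by move=> n x Dx; rewrite lee_fin mulr_ge0 ?f0.
under eq_fun do rewrite integral_indic_segment.
rewrite limn_einf_lim; apply: lime_le; first exact: is_cvg_einfs.
apply: nearW => n; apply: (@le_trans _ _ (F (b_ n) - F (a_ n))%:E).
  by apply: ereal_inf_lbound; exists n => /=.
by rewrite lee_fin.
Qed.

End limit_of_segments.
Lemma harmonic_in_segment (M x : R) : 0 < x -> 0 < M ->
  \forall n \near \oo, M / n.+2%:R <= x.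
Proof.
move=> x0 M0; have xM : 0 < x / M by rewrite divr_gt0.
have [N _ HN] := near_infty_natSinv_lt (PosNum xM).
exists N => // n /= Nn; rewrite mulrC -ler_pdivlMr//; apply/ltW.
by apply: (HN n.+1); rewrite /= (leq_trans Nn).
Qed.

Let lo n : R := n.+2%:R^-1.
Let hi n : R := n.+2%:R.

Let lohi n : 0 < lo n < hi n.
Proof.
rewrite /lo /hi invr_gt0 ltr0n/= (@lt_trans _ _ 1) ?ltr1n//.
by rewrite invf_lt1 ?ltr1n ?ltr0n.
Qed.

Let lohi_halfline n : `[lo n, hi n] `<=` (`]0, +oo[ : set R).
Proof.
move=> x /=; rewrite !in_itv/= andbT => /andP[+ _].
by apply: lt_le_trans; rewrite invr_gt0.
Qed.

Let cvg_hi : hi n @[n --> \oo] --> +oo.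
Proof.
apply/cvgryPge => A; near=> n; apply: (@le_trans _ _ n%:R).
  by near: n; exact: nbhs_infty_ger.
by rewrite ler_nat ltnW.
Unshelve. all: by end_near. Qed.

Let near_lohi (x : R) : (`]0, +oo[%classic : set R) x -> \forall n \near \oo, lo n <= x <= hi n.
Proof.
rewrite /= in_itv/= andbT => x0; near=> n; apply/andP; split.
  by rewrite /lo -div1r; near: n; exact: harmonic_in_segment.
by near: n; move: cvg_hi => /cvgryPge; exact.
Unshelve. all: by end_near. Qed.

Let cvg_seq_scaled (M : R) : 0 < M -> M / n.+2%:R @[n --> \oo] --> 0.
Proof.
move=> M0; rewrite -[X in _ --> X](mulr0 M); apply: cvgM; first exact: cvg_cst.
have := @cvg_harmonic R; rewrite -cvg_shiftS; exact: cvg_trans.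
Qed.

Lemma ge0_integrable_FTC_halfline (f F : R -> R) (C : R) :
  (forall x : R, 0 < x -> is_derive x (1 : R) F (f x)) ->
  (forall x : R, 0 < x -> {for x, continuous f}) ->
  (forall x : R, 0 < x -> 0 <= f x) ->
  (forall x y : R, 0 < x -> x < y -> F y - F x <= C) ->
  leb.-integrable `]0, +oo[ (EFin \o f).
Proof.
move=> dF cf f0 FC.
apply: (@ge0_integrable_FTC_limit f F _ lo hi C) => //.
- by move=> x; rewrite /= in_itv/= andbT.
- by move=> x; rewrite /= in_itv/= andbT; exact: f0.
- by move=> n; have /andP[lo0 lh] := lohi n; exact: FC.
Qed.

Lemma integral_FTC_halfline (f F : R -> R) (l0 l1 : R) :
  (forall x : R, 0 < x -> is_derive x (1 : R) F (f x)) ->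
  (forall x : R, 0 < x -> {for x, continuous f}) ->
  F x @[x --> 0^'+] --> l0 -> F x @[x --> +oo] --> l1 ->
  leb.-integrable `]0, +oo[ (EFin \o f) ->
  (\int[leb]_(x in `]0%R, +oo[) (f x)%:E = (l1 - l0)%:E)%E.
Proof.
move=> dF cf F0 F1 fi.
apply: (@integral_FTC_limit f F _ lo hi (l1 - l0)) => //.
- by move=> x; rewrite /= in_itv/= andbT.
- apply: cvgB.
    by move/cvg_pinftyP: F1; exact.
  move/cvg_at_rightP: F0; apply; split; first by move=> n; rewrite invr_gt0.
  rewrite (_ : lo = fun n => 1 / n.+2%:R); first exact: cvg_seq_scaled.
  by apply/funext => n; rewrite div1r.
Qed.

Lemma integral_FTC_0M (f F : R -> R) (M l0 : R) : 0 < M ->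
  (forall x : R, 0 < x -> is_derive x (1 : R) F (f x)) ->
  (forall x : R, 0 < x -> {for x, continuous f}) ->
  F x @[x --> 0^'+] --> l0 ->
  leb.-integrable `]0, M] (EFin \o f) ->
  (\int[leb]_(x in `]0%R, M]) (f x)%:E = (F M - l0)%:E)%E.
Proof.
move=> M0 dF cf F0 fi.
have aM n : 0 < M / n.+2%:R < M.
  by rewrite divr_gt0//= ltr_pdivrMr// ltr_pMr// ltr1n.
apply: (@integral_FTC_limit f F _ (fun n => M / n.+2%:R) (fun=> M) (F M - l0)) => //.
- move=> n x /=; rewrite !in_itv/= => /andP[ax ->]; rewrite andbT.
  by apply: lt_le_trans ax; have /andP[] := aM n.
- move=> x /=; rewrite in_itv/= => /andP[x0 ->]; near=> n; rewrite andbT.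
  by near: n; exact: harmonic_in_segment.
- by move=> x; rewrite /= in_itv/= => /andP[].
- apply: cvgB; first exact: cvg_cst.
  move/cvg_at_rightP: F0; apply; split; last exact: cvg_seq_scaled.
  by move=> n; have /andP[] := aM n.
Unshelve. all: by end_near. Qed.

End improper_ftc.

Section tonelli_scaling.
Context {R : realType}.
Local Notation leb := (@lebesgue_measure R).
Local Open Scope ereal_scope.

(** Both sides are integrals against the same measure: the image of Lebesgue
    measure under the homothety of ratio c is 1/c times Lebesgue measure. *)
Lemma ge0_integral_scale (c : R) (f : R -> \bar R) : (0 < c)%R ->
  measurable_fun [set: R] f -> (forall x, 0 <= f x) ->
  \int[leb]_(x in `]0%R, +oo[) f x = c%:E * \int[leb]_(x in `]0%R, +oo[) f (c * x)%R.
Proof.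
move=> c0 mf f0.
have mc : measurable_fun [set: measurableTypeR R] ( *%R c : _ -> measurableTypeR R).
  exact: measurable_funM.
pose m := measure_function_pushforward__canonical__measure_function_Measure leb mc.
have scale A : measurable A -> leb A = mscale (NngNum (ltW c0)) m A.
  move=> mA; apply: lebesgue_measure_unique => //= _ [[a b]] _ <-.
  rewrite /mscale/= /pushforward.
  have -> : *%R c @^-1` `]a, b]%classic = `](a / c)%R, (b / c)%R]%classic.
    by apply/seteqP; split => x /=; rewrite !in_itv/= ltr_pdivrMr// ler_pdivlMr// mulrC.
  rewrite !lebesgue_measure_itv/= !lte_fin ltr_pM2r ?invr_gt0//.
  case: ifPn => _; last by rewrite mule0.
  by rewrite -!EFinB -EFinM -mulrBl mulrCA divff ?mulr1// gt_eqF.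
rewrite (eq_measure_integral (mscale (NngNum (ltW c0)) m)); last first.
  by move=> A mA _; exact: scale.
have mf' : measurable_fun (`]0%R, +oo[%classic : set (measurableTypeR R)) f.
  exact: measurable_funTS mf.
rewrite ge0_integral_mscale//= ge0_integral_pushforward//.
congr (_ * _); congr (integral _ _ _).
by apply/seteqP; split => x /=; rewrite !in_itv/= !andbT pmulr_rgt0.
Qed.

Lemma tonelli_on d1 (T1 : measurableType d1) d2 (T2 : measurableType d2)
    (m1 : {sigma_finite_measure set T1 -> \bar R})
    (m2 : {sigma_finite_measure set T2 -> \bar R})
    (A : set T1) (B : set T2) (f : T1 -> T2 -> \bar R) :
  measurable A -> measurable B ->
  measurable_fun [set: T1 * T2] (fun z => f z.1 z.2) ->
  (forall x y, 0 <= f x y) ->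
  \int[m1]_(x in A) \int[m2]_(y in B) f x y =
  \int[m2]_(y in B) \int[m1]_(x in A) f x y.
Proof.
move=> mA mB mf f0.
pose g := fun z : T1 * T2 => ((\1_A z.1 * \1_B z.2)%:E * f z.1 z.2).
have mg : measurable_fun [set: T1 * T2] g.
  apply: emeasurable_funM => //; apply/measurable_EFinP.
  by apply: measurable_funM; apply: measurableT_comp => //; exact: measurable_indic.
have g0 z : 0 <= g z by rewrite mule_ge0// lee_fin mulr_ge0.
have : \int[m1]_x \int[m2]_y g (x, y) = \int[m2]_y \int[m1]_x g (x, y).
  exact: fubini_tonelli.
rewrite (_ : \int[m1]_x _ = \int[m1]_(x in A) \int[m2]_(y in B) f x y); last first.
  rewrite [RHS]integral_mkcond; apply: eq_integral => x _; rewrite patchE /g/=.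
  case: ifPn => xA; last first.
    by apply: integral0_eq => y _; rewrite indicE (negbTE xA) mul0r mul0e.
  rewrite [RHS]integral_mkcond; apply: eq_integral => y _.
  by rewrite epatch_indic indicE xA mul1r muleC.
move=> ->; rewrite [RHS]integral_mkcond; apply: eq_integral => y _.
rewrite patchE /g/=; case: ifPn => yB; last first.
  have B0 : \1_B y = 0%R :> R by rewrite indicE (negbTE yB).
  by apply: integral0_eq => x _; rewrite B0 mulr0 mul0e.
have B1 : \1_B y = 1%R :> R by rewrite indicE yB.
rewrite [RHS]integral_mkcond; apply: eq_integral => x _.
by rewrite epatch_indic B1 mulr1 muleC.
Qed.

Lemma measurable_integral_on d1 (T1 : measurableType d1) d2 (T2 : measurableType d2)
    (m1 : {sigma_finite_measure set T1 -> \bar R}) (A : set T1)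
    (f : T1 -> T2 -> \bar R) :
  measurable A -> measurable_fun [set: T1 * T2] (fun z => f z.1 z.2) ->
  (forall x y, 0 <= f x y) ->
  measurable_fun [set: T2] (fun y => \int[m1]_(x in A) f x y).
Proof.
move=> mA mf f0.
pose g := fun z : T1 * T2 => ((\1_A z.1)%:E * f z.1 z.2).
have mg : measurable_fun [set: T1 * T2] g.
  apply: emeasurable_funM => //; apply/measurable_EFinP.
  by apply: measurableT_comp => //; exact: measurable_indic.
have g0 z : 0 <= g z by rewrite mule_ge0// lee_fin.
rewrite (_ : (fun y => _) = fun y => \int[m1]_x g (x, y)).
  exact: measurable_fun_fubini_tonelli_G.
apply/funext => y; rewrite integral_mkcond; apply: eq_integral => x _.
by rewrite epatch_indic muleC.
Qed.

End tonelli_scaling.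

Section gamma_function.
Context {R : realType}.
Local Notation leb := (@lebesgue_measure R).

(** A single term of the exponential series dominates the polynomial. *)
Lemma exp_poly_bound (b : R) (n : nat) : 0 < b ->
  exists2 C : R, 0 < C & forall x, 0 <= x -> (1 + x) ^+ n * expR (- (b * x)) <= C.
Proof.
move=> b0.
(* From (b (1 + x))^(n+1)/(n+1)! <= e^(b (1 + x)). *)
exists (n.+1`!%:R / b ^+ n.+1 * expR b).
  by rewrite mulr_gt0 ?expR_gt0// divr_gt0 ?exprn_gt0// ltr0n fact_gt0.
move=> x x0; have x1 : 0 < 1 + x by rewrite ltr_pwDl.
rewrite expRN ler_pdivrMr ?expR_gt0// -[leRHS]mulrA -expRD -{2}(mulr1 b) -mulrDr.
apply: (@le_trans _ _ ((1 + x) ^+ n.+1)).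
  by rewrite exprS ler_peMl ?exprn_ge0 ?(ltW x1)// lerDl.
have f0 : 0 < n.+1`!%:R :> R by rewrite ltr0n fact_gt0.
rewrite mulrAC ler_pdivlMr ?exprn_gt0// -exprMn mulrC -ler_pdivrMl// mulrC.
apply: le_trans (expR_ge1Dxn n _); last by rewrite mulr_ge0 ?ltW.
by rewrite [leLHS]mulrC lerDr.
Qed.

Definition gamma_kernel (a b x : R) : R := x `^ (a - 1) * expR (- (b * x)).

Lemma gamma_kernel_ge0 a b x : 0 <= gamma_kernel a b x.
Proof. by rewrite mulr_ge0 ?powR_ge0 ?expR_ge0. Qed.

Lemma measurable_gamma_kernel a b : measurable_fun [set: R] (gamma_kernel a b).
Proof.
apply: measurable_funM; first exact: measurable_powR.
by apply: measurableT_comp => //; apply: measurable_funN; exact: measurable_funM.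
Qed.

Lemma continuous_gamma_kernel a b (x : R) : 0 < x ->
  {for x, continuous (gamma_kernel a b)}.
Proof.
move=> x0; apply: differentiable_continuous; apply/derivable1_diffP.
apply: derivableM.
  by apply: derivable_powR; rewrite in_itv/= x0.
by apply: ex_derive.
Qed.

(** The derivative of the bounded function (x/(1+x))^a; its singularity at 0 is
    that of x^(a-1). *)
Let dratio (a x : R) : R := a * (x / (1 + x)) `^ (a - 1) * (1 + x) ^- 2.

Let ratio_derive (a x : R) : 0 < x ->
  is_derive x (1 : R) (fun x => (x / (1 + x)) `^ a) (dratio a x).
Proof.
move=> x0; have x1 : 0 < 1 + x by rewrite ltr_pwDl// ltW.
have q0 : 0 < x / (1 + x) by rewrite divr_gt0.
have dq : is_derive x (1 : R) (fun x => x / (1 + x)) ((1 + x) ^- 2).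
  have d1 : is_derive x (1 : R) (fun x => 1 + x) 1.
    by have := is_deriveD (is_derive_cst (1 : R) x 1) (is_derive_id x 1); rewrite add0r.
  have dv : is_derive x (1 : R) (fun x => (1 + x)^-1) (- (1 + x) ^- 2).
    apply: is_derive_eq; first by apply: is_deriveV; rewrite gt_eqF.
    by rewrite /GRing.scale/= mulr1.
  have -> : (fun x : R => x / (1 + x)) = (fun x : R => x) * (fun x => (1 + x)^-1).
    by apply/funext.
  apply: is_derive_eq; rewrite /GRing.scale/= mulr1.
  by field; rewrite gt_eqF.
exact: (@is_derive1_comp _ (fun y => y `^ a) (fun x => x / (1 + x)) x _ _
  (is_derive1_powR a q0) dq).
Qed.

Let continuous_ratio (a x : R) : 0 < x ->
  {for x, continuous (dratio a)}.
Proof.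
move=> x0; have x1 : 0 < 1 + x by rewrite ltr_pwDl// ltW.
apply: cvgM.
  apply: cvgM; first exact: cvg_cst.
  exact: is_derive_continuous (ratio_derive _ x0).
apply: cvgV; first by rewrite gt_eqF// exprn_gt0.
by apply: cvgM; apply: cvgD => //; exact: cvg_cst.
Qed.

(** Since x^(a-1) = (x/(1+x))^(a-1) (1+x)^(a-1) and the exponential absorbs any
    power of 1 + x, the kernel is at most a multiple of the derivative of
    (x/(1+x))^a, which is integrable because its primitive is bounded by 1. *)
Lemma integrable_gamma_kernel (a b : R) : 0 < a -> 0 < b ->
  leb.-integrable `]0, +oo[ (EFin \o gamma_kernel a b).
Proof.
move=> a0 b0.
pose f := dratio a.
have fi : leb.-integrable `]0, +oo[ (EFin \o f).
  apply: (@ge0_integrable_FTC_halfline _ f (fun x => (x / (1 + x)) `^ a) 1).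
  - by move=> x x0; exact: ratio_derive.
  - by move=> x x0; exact: continuous_ratio.
  - move=> x x0; rewrite /f /dratio !mulr_ge0 ?powR_ge0 ?(ltW a0)// invr_ge0 exprn_ge0//.
    by rewrite addr_ge0// ltW.
  - move=> x y x0 xy; have y0 := lt_trans x0 xy.
    have y1 : 0 < 1 + y by rewrite ltr_pwDl// ltW.
    rewrite lerBlDr -[leLHS]addr0 lerD ?powR_ge0//.
    have := @ge0_ler_powR _ a (ltW a0) (y / (1 + y)) 1; rewrite powR1; apply.
    + by rewrite nnegrE divr_ge0// ltW.
    + by rewrite nnegrE.
    + by rewrite ler_pdivrMr// mul1r lerDr.
have [n an] : exists n : nat, a + 1 <= n%:R.
  by exists (Num.bound (a + 1)); rewrite ltW// archi_boundP// addr_ge0 ?(ltW a0).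
have [C C0 HC] := exp_poly_bound n b0.
apply: (@le_integrable _ _ _ leb _ _ _ (fun x => (C / a)%:E * (EFin \o f) x)%E) => //.
- by apply/measurable_EFinP; apply: measurable_funTS; exact: measurable_gamma_kernel.
- move=> x; rewrite /= in_itv/= andbT => x0.
  have x1 : 0 < 1 + x by rewrite ltr_pwDl// ltW.
  rewrite /= ger0_norm ?gamma_kernel_ge0// ger0_norm; last first.
    rewrite mulr_ge0 ?divr_ge0 ?(ltW C0) ?(ltW a0)//.
    rewrite /f /dratio !mulr_ge0 ?powR_ge0 ?(ltW a0)// invr_ge0.
    exact: exprn_ge0 (ltW x1).
  rewrite lee_fin /f /dratio /gamma_kernel.
  have -> : x `^ (a - 1) = (x / (1 + x)) `^ (a - 1) * (1 + x) `^ (a - 1).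
    by rewrite -powRM ?divr_ge0 ?(ltW x0) ?(ltW x1)// divfK// gt_eqF.
  have e : C / a * (a * (x / (1 + x)) `^ (a - 1) / (1 + x) ^+ 2) =
      (x / (1 + x)) `^ (a - 1) * (C / (1 + x) ^+ 2).
    by field; rewrite !gt_eqF.
  rewrite e -mulrA ler_wpM2l ?powR_ge0// ler_pdivlMr ?exprn_gt0// mulrAC.
  apply: le_trans (HC x (ltW x0)); rewrite ler_wpM2r ?expR_ge0//.
  rewrite -powR_mulrn ?(ltW x1)// -powRD; last by rewrite (gt_eqF x1) implybT.
  rewrite -powR_mulrn ?(ltW x1)// ler_powR ?lerDl ?(ltW x0)//.
  by apply: le_trans an; lra.
- exact: integrableZl.
Qed.

Lemma EFin_Gamma (a : R) : 0 < a ->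
  ((Gamma a)%:E = \int[leb]_(x in `]0%R, +oo[) (gamma_kernel a 1 x)%:E)%E.
Proof.
move=> a0; rewrite /Gamma /Rintegral fineK.
  by apply: eq_integral => x _; rewrite /gamma_kernel mul1r.
have -> : (\int[leb]_(x in `]0%R, +oo[) (x `^ (a - 1) * expR (- x))%:E =
    \int[leb]_(x in `]0%R, +oo[) (EFin \o gamma_kernel a 1) x)%E.
  by apply: eq_integral => x _; rewrite /= /gamma_kernel mul1r.
by apply: integrable_fin_num => //; exact: integrable_gamma_kernel.
Qed.

Lemma integral_gamma_kernel (a b : R) : 0 < a -> 0 < b ->
  (\int[leb]_(x in `]0%R, +oo[) (gamma_kernel a b x)%:E =
   (Gamma a * b `^ (- a))%:E)%E.
Proof.
move=> a0 b0; rewrite EFinM EFin_Gamma//.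
rewrite (@ge0_integral_scale _ b (EFin \o gamma_kernel a 1))//; last first.
- by move=> x; rewrite lee_fin gamma_kernel_ge0.
- by apply/measurable_EFinP; exact: measurable_gamma_kernel.
have bx x : (0 < x)%R -> gamma_kernel a 1 (b * x) = b `^ (a - 1) * gamma_kernel a b x.
  by move=> x0; rewrite /gamma_kernel mul1r powRM ?ltW// mulrA.
have -> : (\int[leb]_(x in `]0%R, +oo[) (EFin \o gamma_kernel a 1) (b * x)%R =
    \int[leb]_(x in `]0%R, +oo[) ((b `^ (a - 1))%:E * (gamma_kernel a b x)%:E))%E.
  by apply: eq_integral => x; rewrite inE /= in_itv/= andbT => x0; rewrite bx.
rewrite ge0_integralZl//; last 3 first.
- by apply/measurable_EFinP; apply: measurable_funTS; exact: measurable_gamma_kernel.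
- by move=> x _; rewrite lee_fin gamma_kernel_ge0.
- by rewrite lee_fin powR_ge0.
rewrite muleA -EFinM muleC muleA -EFinM mulrA [b `^ (-a) * b]mulrC.
by rewrite mulrAC powRN mulr_powRB1 ?(ltW b0)// mulfV ?mul1e// powR_eq0 gt_eqF.
Qed.

Lemma Gamma_gt0 (a : R) : 0 < a -> 0 < Gamma a.
Proof.
move=> a0; rewrite -lte_fin EFin_Gamma//.
apply: (@lt_le_trans _ _ (\int[leb]_(x in `[1%R, 2%R]) (expR (- 2) / 2)%:E)%E).
  rewrite integral_cst//= lebesgue_measure_itv/= lte_fin ltr1n -EFinB -EFinM lte_fin.
  by rewrite mulr_gt0 ?divr_gt0 ?expR_gt0// subr_gt0 ltr1n.
apply: (@le_trans _ _ (\int[leb]_(x in `[1%R, 2%R]) (gamma_kernel a 1 x)%:E)%E).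
  apply: ge0_le_integral => //.
  - by apply/measurable_EFinP; apply: measurable_funTS; exact: measurable_gamma_kernel.
  - move=> x; rewrite /= in_itv/= => /andP[x1 x2]; rewrite lee_fin /gamma_kernel mulrC.
    apply: ler_pM => //; rewrite ?expR_ge0 ?invr_ge0//.
      apply: (@le_trans _ _ (x `^ (-1))); last first.
        by rewrite ler_powR// lerBrDr addNr ltW.
      by rewrite powR_inv1 ?(le_trans ler01)// lef_pV2 ?posrE// (lt_le_trans ltr01).
    by rewrite mul1r ler_expR lerN2.
apply: ge0_subset_integral => //.
- by apply/measurable_EFinP; apply: measurable_funTS; exact: measurable_gamma_kernel.
- by move=> x _; rewrite lee_fin gamma_kernel_ge0.
- move=> x; rewrite /= !in_itv/= andbT => /andP[x1 _].
  exact: lt_le_trans x1.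
Qed.

(** The derivative of x^a e^(-x) is a x^(a-1) e^(-x) - x^a e^(-x), and
    x^a e^(-x) vanishes at both ends of the half-line. *)
Lemma GammaS (a : R) : 0 < a -> Gamma (a + 1) = a * Gamma a.
Proof.
move=> a0.
have a10 : 0 < a + 1 by rewrite addr_gt0.
pose f (x : R) := a * gamma_kernel a 1 x - gamma_kernel (a + 1) 1 x.
pose F (x : R) := x `^ a * expR (- x).
have i1 : leb.-integrable `]0, +oo[ (fun x => a%:E * (EFin \o gamma_kernel a 1) x)%E.
  by apply: integrableZl => //; exact: integrable_gamma_kernel.
have i2 := integrable_gamma_kernel a10 ltr01.
have fi : leb.-integrable `]0, +oo[ (EFin \o f) by exact: integrableB i1 i2.
have [n an] : exists n : nat, a <= n%:R.
  by exists (Num.bound a); rewrite ltW// archi_boundP// ltW.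
have [C C0 HC] := exp_poly_bound n.+1 (@ltr01 R).
have F1 : F x @[x --> +oo] --> 0.
  apply: (@squeeze_cvgr _ _ _ _ (cst 0) (fun x => C * x^-1)).
  - near=> x; have x0 : 0 < x by near: x; exact: nbhs_pinfty_gt.
    have x1 : 0 < 1 + x by rewrite ltr_pwDl// ltW.
    rewrite /F mulr_ge0 ?powR_ge0 ?expR_ge0//= ler_pdivlMr// mulrAC.
    apply: le_trans (HC x (ltW x0)); rewrite mul1r ler_wpM2r ?expR_ge0//.
    rewrite exprSr ler_pM ?powR_ge0 ?(ltW x0)//; last by rewrite lerDr.
    apply: (@le_trans _ _ ((1 + x) `^ a)).
      by rewrite ge0_ler_powR ?nnegrE ?(ltW a0) ?(ltW x0) ?(ltW x1)// lerDr.
    by rewrite -powR_mulrn ?(ltW x1)// ler_powR// lerDl ltW.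
  - exact: cvg_cst.
  - rewrite -[X in _ --> X](mulr0 C); apply: cvgM; first exact: cvg_cst.
    by apply/gtr0_cvgV0 => //; near=> x; near: x; exact: nbhs_pinfty_gt.
have dexp (x : R) : is_derive x (1 : R) (fun x => expR (- x)) (- expR (- x)).
  by apply: is_derive_eq; rewrite /GRing.scale/=; ring.
have F0 : F x @[x --> 0^'+] --> 0.
  rewrite -[X in _ --> X](mul0r (expR (- 0))); apply: cvgM; first exact: powR_cvg0.
  by apply: cvg_at_right_filter; exact: is_derive_continuous (dexp 0).
have dF (x : R) : 0 < x -> is_derive x (1 : R) F (f x).
  move=> x0; apply: is_derive_eq; first exact: is_deriveM (is_derive1_powR a x0) (dexp x).
  rewrite /f /gamma_kernel addrK mul1r /GRing.scale/=; ring.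
have cf (x : R) : 0 < x -> {for x, continuous f}.
  move=> x0; apply: cvgB; last exact: continuous_gamma_kernel.
  by apply: cvgM; [exact: cvg_cst|exact: continuous_gamma_kernel].
have := integral_FTC_halfline dF cf F0 F1 fi.
have -> : (\int[leb]_(x in `]0%R, +oo[) (f x)%:E = (a * Gamma a - Gamma (a + 1))%:E)%E.
  rewrite EFinB EFinM !EFin_Gamma//.
  rewrite -integralZl//; last exact: integrable_gamma_kernel.
  exact: integralB i1 i2.
by rewrite subrr => -[] /eqP; rewrite subr_eq0 => /eqP.
Unshelve. all: by end_near. Qed.

Lemma Gamma1 : Gamma (1 : R) = 1.
Proof.
suff : (\int[leb]_(x in `]0%R, +oo[) (gamma_kernel 1 1 x)%:E = 1%:E)%E.
  by rewrite -EFin_Gamma// => -[].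
have E x : gamma_kernel 1 1 x = expR (- x).
  by rewrite /gamma_kernel subrr powRr0 !mul1r.
have dexp (x : R) : is_derive x (1 : R) (fun x => - expR (- x)) (gamma_kernel 1 1 x).
  by rewrite E; apply: is_derive_eq; rewrite /GRing.scale/=; ring.
rewrite (@integral_FTC_halfline _ _ (fun x => - expR (- x)) (- 1) 0).
- by rewrite sub0r opprK.
- by move=> x x0; exact: continuous_gamma_kernel.
- rewrite -[X in - X]expR0 -[X in expR X]oppr0.
  by apply: cvg_at_right_filter; exact: is_derive_continuous (dexp 0).
- by rewrite -oppr0; apply: cvgN; exact: cvgr_expR.
- exact: integrable_gamma_kernel.
Qed.

Lemma Gamma_nat (k : nat) : Gamma (k%:R + 1 : R) = k`!%:R.
Proof.
elim: k => [|k ih]; first by rewrite add0r Gamma1.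
by rewrite -natr1 GammaS ?ltr_pwDr// ih factS natrM -natr1.
Qed.

End gamma_function.

(** * The exponent of a generalized gamma convolution *)

Section hyperbolic.
Context {R : realType}.
Implicit Types u x : R.

Lemma cosh_gt0 u : 0 < cosh u.
Proof. by rewrite divr_gt0// addr_gt0 ?expR_gt0. Qed.

Lemma sinh_ge0 u : 0 <= u -> 0 <= sinh u.
Proof.
move=> u0; rewrite divr_ge0// subr_ge0 ler_expR.
by rewrite (le_trans _ u0)// oppr_le0.
Qed.

Lemma sinh_gt0 u : 0 < u -> 0 < sinh u.
Proof.
move=> u0; rewrite divr_gt0// subr_gt0 ltr_expR.
by rewrite (lt_trans _ u0)// oppr_lt0.
Qed.

Lemma sinh0 : sinh 0 = 0 :> R.
Proof. by rewrite /sinh oppr0 subrr mul0r. Qed.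

Lemma cosh0 : cosh 0 = 1 :> R.
Proof. by rewrite /cosh oppr0 expR0; field. Qed.

Lemma cosh2_sinh2 u : cosh u ^+ 2 = 1 + sinh u ^+ 2.
Proof.
rewrite /cosh /sinh expRN; field; exact: lt0r_neq0 (expR_gt0 u).
Qed.

Lemma cosh_ge1 u : 1 <= cosh u.
Proof.
rewrite -(@ler_pXn2r _ 2)// ?nnegrE ?(ltW (cosh_gt0 _))//.
by rewrite expr1n cosh2_sinh2 lerDl sqr_ge0.
Qed.

Lemma affine_gt0 u x : 0 <= u -> 0 < x -> 0 < x * cosh u + sinh u.
Proof. by move=> u0 x0; rewrite ltr_pwDl ?sinh_ge0// mulr_gt0 ?cosh_gt0. Qed.

Lemma coaffine_gt0 u x : 0 <= u -> 0 <= x -> 0 < x * sinh u + cosh u.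
Proof. by move=> u0 x0; rewrite ltr_wpDl ?cosh_gt0// mulr_ge0 ?sinh_ge0. Qed.

Lemma sigma_gt0 u x : 0 <= u -> 0 < x -> 0 < sigma u x.
Proof. by move=> u0 x0; rewrite divr_gt0 ?affine_gt0 ?coaffine_gt0// ltW. Qed.

End hyperbolic.

Section frullani.
Context {R : realType}.
Local Notation leb := (@lebesgue_measure R).

(** The integrand is the integral of e^(-(v+g) x) over v in [0, l]. After
    exchanging the integrals, x contributes 1/(v+g), whose integral over [0, l]
    is log(1 + l/g). *)
Lemma frullani (g l : R) : 0 < g -> 0 < l ->
  (\int[leb]_(x in `]0%R, +oo[) ((1 - expR (- (l * x))) * (expR (- (x * g)) / x))%:E =
   (ln (1 + l / g))%:E)%E.
Proof.
move=> g0 l0.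
have inner (x : R) : 0 < x -> (\int[leb]_(v in `[0%R, l]) (expR (- ((v + g) * x)))%:E =
    ((1 - expR (- (l * x))) * (expR (- (x * g)) / x))%:E)%E.
  move=> x0.
  have dF (v : R) : is_derive v (1 : R) (fun v => - expR (- ((v + g) * x)) / x)
      (expR (- ((v + g) * x))).
    by apply: is_derive_eq; rewrite /GRing.scale/=; field; rewrite gt_eqF.
  rewrite (@continuous_FTC2 _ _ (fun v => - expR (- ((v + g) * x)) / x))//.
  - rewrite -EFinB; congr EFin; rewrite add0r mulrDl opprD expRD [g * x]mulrC.
    by field; rewrite gt_eqF.
  - apply: continuous_subspaceT => v.
    apply: (@continuous_comp _ _ _ (fun v => - ((v + g) * x)) expR).
      apply: cvgN; apply: cvgM; last exact: cvg_cst.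
      by apply: cvgD => //; exact: cvg_cst.
    exact: continuous_expR.
  - split => [v _||].
    + by have [] := dF v.
    + by apply: cvg_at_right_filter; exact: is_derive_continuous (dF 0).
    + by apply: cvg_at_left_filter; exact: is_derive_continuous (dF l).
  - by move=> v _; rewrite derive1E; have [_ ->] := dF v.
transitivity (\int[leb]_(x in `]0%R, +oo[) \int[leb]_(v in `[0%R, l])
    (expR (- ((v + g) * x)))%:E)%E.
  by apply: eq_integral => x; rewrite inE/= in_itv/= andbT => x0; rewrite inner.
rewrite (@tonelli_on _ _ _ _ _ leb leb _ _ (fun x v => (expR (- ((v + g) * x)))%:E))//; last first.
- apply/measurable_EFinP; apply: measurableT_comp => //.
  apply: measurable_funN; apply: measurable_funM => //.
  exact: measurable_funD.
have outer (v : R) : 0 <= v -> (\int[leb]_(x in `]0%R, +oo[) (expR (- ((v + g) * x)))%:E =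
    ((v + g)^-1)%:E)%E.
  move=> v0; have vg0 : 0 < v + g by rewrite ltr_wpDl.
  have := @integral_gamma_kernel R 1 _ ltr01 vg0.
  rewrite Gamma1 mul1r powR_inv1 ?(ltW vg0)// => <-.
  by apply: eq_integral => x _; rewrite /gamma_kernel subrr powRr0 mul1r.
transitivity (\int[leb]_(v in `[0%R, l]) ((v + g)^-1)%:E)%E.
  by apply: eq_integral => v; rewrite inE/= in_itv/= => /andP[v0 _]; rewrite outer.
have dF (v : R) : 0 <= v -> is_derive v (1 : R) (fun v => ln (v + g)) ((v + g)^-1).
  move=> v0; have vg0 : 0 < v + g by rewrite ltr_wpDl.
  have d1 : is_derive v (1 : R) (fun v => v + g) 1.
    by have := is_deriveD (is_derive_id v (1 : R)) (is_derive_cst g v (1 : R)); rewrite addr0.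
  have := @is_derive1_comp _ (@ln R) (fun v => v + g) v _ _ (is_derive1_ln vg0) d1.
  by rewrite mulr1.
rewrite (@continuous_FTC2 _ _ (fun v => ln (v + g)))//.
- rewrite -EFinB add0r -ln_div ?posrE ?ltr_wpDl ?(ltW l0)//.
  by congr (ln _)%:E; field; rewrite gt_eqF.
- apply: continuous_in_subspaceT => v; rewrite inE/= in_itv/= => /andP[v0 _].
  apply: cvgV; first by rewrite gt_eqF// ltr_wpDl.
  by apply: cvgD => //; exact: cvg_cst.
- split => [v||].
  + by rewrite in_itv/= => /andP[/ltW v0 _]; have [] := dF v v0.
  + by apply: cvg_at_right_filter; exact: is_derive_continuous (dF 0 (lexx 0)).
  + by apply: cvg_at_left_filter; exact: is_derive_continuous (dF l (ltW l0)).
- by move=> v; rewrite in_itv/= => /andP[/ltW v0 _]; rewrite derive1E; have [_ ->] := dF v v0.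
Qed.

Lemma levy_exponent_gamma (l : R) : 0 < l ->
  levy_exponent (fun x => expR (- x) / x) l = (ln (1 + l))%:E.
Proof.
move=> l0; have := frullani ltr01 l0; rewrite divr1 => <-.
by apply: eq_integral => x _; rewrite mulr1.
Qed.

(** Tonelli's theorem, for an integrand that is nonnegative at every real x, and
    Frullani's integral for almost every value of G. *)
Lemma psiE d (T : measurableType d) (P : probability T R) (G : T -> R) (l : R) :
  measurable_fun [set: T] G -> {ae P, forall w, 0 < G w} -> 0 < l ->
  (psi P G l = \int[P]_w (ln (1 + l / G w))%:E)%E.
Proof.
move=> mG G0 l0.
pose f x w : \bar R := ((1 - expR (- (l * x))) * (expR (- (x * G w)) / x))%:E.
have f0 x w : (0 <= f x w)%E.
  rewrite lee_fin mulrCA mulr_ge0 ?expR_ge0//.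
  have [x0|x0|->] := ltgtP x 0; last by rewrite invr0 mulr0.
    rewrite mulr_le0// ?invr_le0 ?(ltW x0)// subr_le0 -expR0 ler_expR.
    by rewrite oppr_ge0 pmulr_rle0// ltW.
  rewrite divr_ge0 ?(ltW x0)// subr_ge0 -expR0 ler_expR.
  by rewrite oppr_le0 mulr_ge0// ltW.
have mf : measurable_fun [set: R * T] (fun z => f z.1 z.2).
  apply/measurable_EFinP; apply: measurable_funM.
    apply: measurable_funB => //; apply: measurableT_comp => //.
    by apply: measurable_funN; apply: measurable_funM.
  apply: measurable_funM; last exact: measurableT_comp measurable_invr _.
  apply: measurableT_comp => //; apply: measurable_funN; apply: measurable_funM => //.
  exact: measurableT_comp mG _.
transitivity (\int[leb]_(x in `]0%R, +oo[) \int[P]_w f x w)%E.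
  apply: eq_integral => x; rewrite inE/= in_itv/= andbT => x0.
  have me : measurable_fun [set: T] (fun w => (expR (- (x * G w)))%:E).
    apply/measurable_EFinP; apply: measurableT_comp => //.
    by apply: measurable_funN; exact: measurable_funM.
  have Efin : (\int[P]_w (expR (- (x * G w)))%:E)%E \is a fin_num.
    rewrite ge0_fin_numE; last by apply: integral_ge0 => w _; rewrite lee_fin expR_ge0.
    apply: (@le_lt_trans _ _ (\int[P]_w (cst 1 w))%E); last first.
      by rewrite integral_cst//= probability_setT mule1 ltry.
    apply: ae_ge0_le_integral => //.
    - apply: filterS G0 => w Gw _; rewrite lee_fin -expR0 ler_expR oppr_le0.
      by rewrite mulr_ge0 ?ltW.
  rewrite /ggc_levy_density unlock mulrCA EFinM EFinM fineK// muleC.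
  rewrite -ge0_integralZl//; last first.
    rewrite lee_fin divr_ge0 ?(ltW x0)// subr_ge0 -expR0 ler_expR oppr_le0.
    by rewrite mulr_ge0 ?ltW.
  by apply: eq_integral => w _; rewrite /f -EFinM; congr EFin; ring.
rewrite (@tonelli_on _ _ _ _ _ leb P _ _ f)//.
apply: ae_eq_integral => //.
- exact: (@measurable_integral_on _ _ _ _ _ leb _ f).
- apply/measurable_EFinP; apply: measurableT_comp => //.
  apply: measurable_funD => //; apply: measurable_funM => //.
  exact: measurableT_comp measurable_invr mG.
- by apply: filterS G0 => w Gw _; rewrite /f frullani.
Qed.

End frullani.

Section duality.
Context {R : realType} d (T : measurableType d) (P : probability T R).
Variables (u : R) (G : T -> R).
Hypotheses (u0 : 0 <= u) (mG : measurable_fun [set: T] G).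
Hypothesis G0 : {ae P, forall w, 0 < G w}.
Hypothesis Glog : ('E_P[fun w => Num.max 0%R (ln (1 / G w))] < +oo)%E.
Hypothesis Glog0 : u = 0 -> ('E_P[fun w => Num.max 0%R (ln (G w))] < +oo)%E.

Let mGinv : measurable_fun [set: T] (fun w => (G w)^-1).
Proof. exact: measurableT_comp measurable_invr mG. Qed.

Let ge0_expectation_integrable (f : T -> R) : measurable_fun setT f ->
  (forall w, 0 <= f w) -> ('E_P[f] < +oo)%E -> P.-integrable setT (EFin \o f).
Proof.
move=> mf f0 L; apply/integrableP; split; first exact/measurable_EFinP.
move: L; rewrite unlock; apply: le_lt_trans.
rewrite le_eqVlt; apply/orP; left; apply/eqP/eq_integral => w _.
by rewrite /= ger0_norm.
Qed.

Let int_logV : P.-integrable setT (EFin \o (fun w => Num.max 0%R (ln (1 / G w)))).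
Proof.
apply: ge0_expectation_integrable => //; last by move=> w; rewrite le_max lexx.
apply: measurable_maxr => //; apply: measurableT_comp => //.
exact: measurable_funM.
Qed.

Let ae_bound (h : T -> R) (C : R) (f : T -> R) : measurable_fun setT h ->
  P.-integrable setT (EFin \o f) ->
  {ae P, forall w, `|h w| <= C + f w} -> P.-integrable setT (EFin \o h).
Proof.
move=> mh fi hf.
have gi : P.-integrable setT (EFin \o (fun w => C + f w)).
  apply: (@integrableD _ _ _ P setT _ (cst C%:E) (EFin \o f)) => //.
  by apply: finite_measure_integrable_cst.
have mg := measurable_int P gi.
move/integrableP : gi => [_ goo].
apply/integrableP; split; first exact/measurable_EFinP.
apply: le_lt_trans goo; apply: ae_ge0_le_integral => //.
- by apply: measurableT_comp => //; exact/measurable_EFinP.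
- exact: measurableT_comp.
- apply: filterS hf => w hw _; rewrite /= lee_fin.
  by rewrite (le_trans hw)// ler_norm.
Qed.

Let int_log0 : u = 0 -> P.-integrable setT (EFin \o (fun w => Num.max 0%R (ln (G w)))).
Proof.
move=> /Glog0 L; apply: ge0_expectation_integrable => //.
  by apply: measurable_maxr => //; exact: measurableT_comp.
by move=> w; rewrite le_max lexx.
Qed.

(** 1 + l/g is at most 1 + l if g >= 1, and at most (1 + l)/g otherwise. *)
Lemma integrable_ln1Dx_div (l : R) : 0 < l ->
  P.-integrable setT (EFin \o (fun w => ln (1 + l / G w))).
Proof.
move=> l0; apply: (ae_bound (C := ln (1 + l))) int_logV _.
  apply: measurableT_comp => //; apply: measurable_funD => //.
  exact: measurable_funM.
apply: filterS G0 => w; move: (G w) => g g0.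
have lg : 0 < 1 + l / g by rewrite addr_gt0// divr_gt0.
rewrite ger0_norm ?ln_ge0 ?lerDl ?divr_ge0 ?(ltW l0) ?(ltW g0)//.
have l1 : 0 < 1 + l by rewrite addr_gt0.
have [g1|g1] := leP 1 g.
  rewrite (@le_trans _ _ (ln (1 + l)))//; last by rewrite lerDl le_max lexx.
  by rewrite ler_ln ?posrE// lerD2l ler_pdivrMr// ler_peMr// ltW.
rewrite (@le_trans _ _ (ln (1 + l) + ln (1 / g)))//; last first.
  by rewrite lerD2l le_max lexx orbT.
have ig : 0 < 1 / g by rewrite divr_gt0.
rewrite -lnM ?posrE// ler_ln ?posrE ?mulr_gt0//.
  by rewrite mulrDl mul1r mulrA mulr1 lerD2r div1r invf_ge1// ltW.
by rewrite invr_gt0.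
Qed.

(** For u = 0 the function is log G, and both logarithmic moments are used. For
    u > 0 the quotient is at most 1/sinh u, and it is at least
    1/(sinh u + cosh u) when G >= 1 and at least G/(sinh u + cosh u) when G <
    1. *)
Lemma integrable_kconst :
  P.-integrable setT (EFin \o (fun w => ln (G w / (G w * sinh u + cosh u)))).
Proof.
have mK : measurable_fun setT (fun w => ln (G w / (G w * sinh u + cosh u))).
  apply: measurableT_comp => //; apply: measurable_funM => //.
  apply: measurableT_comp measurable_invr _; apply: measurable_funD => //.
  exact: measurable_funM.
have [u_eq0|u_neq0] := eqVneq u 0.
  apply: (ae_bound (C := 0) (f := (fun w => Num.max 0 (ln (1 / G w)) + Num.max 0 (ln (G w))))) => //.
    apply: (@integrableD _ _ _ P setT _ (EFin \o (fun w => Num.max 0 (ln (1 / G w))))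
      (EFin \o (fun w => Num.max 0 (ln (G w))))) => //; exact: int_log0.
  apply: filterS G0 => w g0.
  rewrite u_eq0 sinh0 cosh0 mulr0 add0r divr1 add0r div1r lnV ?posrE//.
  have [l0|l0] := leP 0 (ln (G w)).
    by rewrite ger0_norm// lerDr le_max lexx.
  by rewrite ltr0_norm// addr0 le_max lexx orbT.
have s0 : 0 < sinh u by rewrite sinh_gt0// lt_neqAle eq_sym u_neq0.
have c0 := cosh_gt0 u; have sc0 : 0 < sinh u + cosh u by rewrite addr_gt0.
apply: (ae_bound (C := `|ln (sinh u)| + `|ln (sinh u + cosh u)|)) mK int_logV _.
apply: filterS G0 => w; move: (G w) => g g0.
have a0 : 0 < g * sinh u + cosh u by rewrite coaffine_gt0// ltW.
rewrite ln_div ?posrE// ler_norml; apply/andP; split; last first.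
  apply: (@le_trans _ _ (`|ln (sinh u)|)); last first.
    by rewrite -addrA lerDl addr_ge0// le_max lexx.
  rewrite lerBlDr -lerBlDl; apply: (@le_trans _ _ (ln g + ln (sinh u))).
    by rewrite lerD2l lerNl -normrN ler_norm.
  have gs : 0 < g * sinh u by rewrite mulr_gt0.
  by rewrite -lnM ?posrE// ler_ln ?posrE// lerDl ltW.
rewrite lerNl opprB lerBlDr.
have [g1|g1] := leP 1 g.
  apply: (@le_trans _ _ (ln (sinh u + cosh u) + ln g)).
    have gsc : 0 < (sinh u + cosh u) * g by rewrite mulr_gt0.
    rewrite -lnM ?posrE// ler_ln ?posrE// mulrDl [sinh u * g]mulrC lerD2l.
    by rewrite ler_peMr// ltW.
  rewrite lerD2r (le_trans (ler_norm _))// addrAC lerDr addr_ge0// le_max lexx //.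
apply: (@le_trans _ _ (ln (sinh u + cosh u))).
  rewrite ler_ln ?posrE// lerD2r ler_piMl// ltW//.
rewrite (le_trans (ler_norm _))// -addrA -addrA.
apply: ler_wpDl => //; rewrite lerDl.
have : ln (1 / g) <= Num.max 0 (ln (1 / g)) by rewrite le_max lexx orbT.
by rewrite div1r lnV ?posrE// => h; rewrite -lerBlDr sub0r.
Qed.

Lemma kconst_fin_num : (kconst P u G \is a fin_num).
Proof. by rewrite /kconst unlock; apply: integrable_fin_num => //; exact: integrable_kconst. Qed.

(** Over their respective denominators, 1 + l/sigma_u(g) and 1 + sigma_u(l)/g
    have the same numerator (l g + 1) cosh u + (l + g) sinh u. *)
Let ln1D_sigma (l g : R) : 0 < l -> 0 < g ->
  ln (1 + l / sigma u g) = ln (1 + sigma u l / g) +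
    (ln (l * cosh u + sinh u) + ln (g / (g * sinh u + cosh u))).
Proof.
move=> l0 g0; have := affine_gt0 u0 l0; have := affine_gt0 u0 g0.
have := coaffine_gt0 u0 (ltW g0); have := sigma_gt0 u0 l0; have := sigma_gt0 u0 g0.
move=> sg0 sl0 d0 b0 a0.
have h1 : 0 < 1 + sigma u l / g by rewrite addr_gt0// divr_gt0.
have h2 : 0 < g / (g * sinh u + cosh u) by rewrite divr_gt0.
have h3 := mulr_gt0 a0 h2.
rewrite -[in RHS]lnM ?posrE// -lnM ?posrE//; congr ln.
by rewrite /sigma; field; rewrite !lt0r_neq0.
Qed.

Lemma psi_duality (l : R) : 0 < l ->
  (- psi P G (sigma u l) + psi P (sigma u \o G) l =
   (ln (l * cosh u + sinh u))%:E + kconst P u G)%E.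
Proof.
move=> l0.
have sl0 := sigma_gt0 u0 l0.
have sG0 : {ae P, forall w, 0 < (sigma u \o G) w}.
  by apply: filterS G0 => w; exact: sigma_gt0.
have msG : measurable_fun [set: T] (sigma u \o G).
  exact: measurableT_comp (measurable_sigma u) mG.
rewrite !psiE// /kconst unlock.
have i1 := integrable_ln1Dx_div sl0.
have i2 := integrable_kconst.
have ic : P.-integrable setT (cst (ln (l * cosh u + sinh u))%:E).
  exact: finite_measure_integrable_cst.
have -> : (\int[P]_w (ln (1 + l / (sigma u \o G) w))%:E =
    \int[P]_w (ln (1 + sigma u l / G w))%:E +
    ((ln (l * cosh u + sinh u))%:E + \int[P]_w (ln (G w / (G w * sinh u + cosh u)))%:E))%E.
  rewrite -[X in (_ + (X + _))%E](_ : (\int[P]_w (cst (ln (l * cosh u + sinh u))%:E w) = _)%E); last first.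
    by rewrite integral_cst//= probability_setT mule1.
  rewrite -(integralD _ ic i2)// -(integralD _ i1 (integrableD _ ic i2))//.
  apply: ae_eq_integral => //.
  - apply/measurable_EFinP; apply: measurableT_comp => //; apply: measurable_funD => //.
    apply: measurable_funM => //; exact: measurableT_comp measurable_invr msG.
  - by do 2?apply: emeasurable_funD; [exact: measurable_int i1|exact: measurable_int ic|exact: measurable_int i2].
  - by apply: filterS G0 => w g0 _ /=; rewrite ln1D_sigma// EFinD EFinD.
rewrite addeA [X in (X + _)%E]addeC subee ?add0e//.
exact: integrable_fin_num i1.
Qed.

Lemma psi_fin_num (l : R) : 0 < l -> (psi P G l \is a fin_num)%E.
Proof.
move=> l0; rewrite psiE//; apply: integrable_fin_num => //.
exact: integrable_ln1Dx_div.
Qed.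

End duality.

(** * Stieltjes integrals against the gamma process *)

Section independence.
Context {R : realType} d (T : measurableType d) (P : probability T R).

Lemma ge0_integral_eq_law d1 (T1 : measurableType d1) d2 (T2 : measurableType d2)
    d3 (E : measurableType d3) (m1 : {measure set T1 -> \bar R})
    (m2 : {measure set T2 -> \bar R}) (X : T1 -> E) (Y : T2 -> E) (f : E -> \bar R) :
  eq_law m1 m2 X Y -> measurable_fun [set: E] f -> (forall x, (0 <= f x)%E) ->
  (\int[m1]_w f (X w) = \int[m2]_w f (Y w))%E.
Proof.
move=> [mX mY XY] mf f0.
have := ge0_integral_pushforward mX m1 measurableT mf (fun x _ => f0 x).
have := ge0_integral_pushforward mY m2 measurableT mf (fun x _ => f0 x).
rewrite !preimage_setT => <- <-.
by apply: eq_measure_integral => A mA _; exact: XY.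
Qed.

Section product_rule.
Variables (n : nat) (D : nat -> T -> R).
Hypothesis mD : forall i, measurable_fun [set: T] (D i).
Hypothesis indep : forall A : nat -> set R, (forall i, measurable (A i)) ->
  (P (\bigcap_(i in `I_n) [set w | A i (D i w)]) =
   \prod_(i < n) P [set w | A i (D i w)])%E.

Let unit_fun (g : nat -> R -> R) := forall i,
  measurable_fun [set: R] (g i) /\ forall x, 0 <= g i x <= 1.

Let prod_rule (g : nat -> R -> R) :=
  (\int[P]_w (\prod_(i < n) g i (D i w))%:E =
   \prod_(i < n) \int[P]_w (g i (D i w))%:E)%E.

Let mset (A : set R) i : measurable A -> measurable [set w | A (D i w)].
Proof. by move=> mA; rewrite -[X in measurable X]setTI; exact: mD. Qed.

Let integral_indicD (A : set R) i : measurable A ->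
  (\int[P]_w (\1_A (D i w))%:E = P [set w | A (D i w)])%E.
Proof.
move=> mA; transitivity (\int[P]_w (\1_[set w | A (D i w)] w)%:E)%E.
  by apply: eq_integral => w _; congr EFin; rewrite !indicE; congr (nat_of_bool _)%:R;
    apply/idP/idP; rewrite !inE.
by rewrite integral_indic ?setIT//; exact: mset.
Qed.

Let prod_rule_indic (A : nat -> set R) : (forall i, measurable (A i)) ->
  prod_rule (fun i => \1_(A i)).
Proof.
move=> mA; rewrite /prod_rule.
transitivity (P (\bigcap_(i in `I_n) [set w | A i (D i w)])).
  rewrite -[in RHS](setIT (\bigcap_(i in `I_n) _)) -integral_indic//; last first.
    by apply: fin_bigcap_measurable => [|i _]; [exact: finite_II|exact: mset].
  apply: eq_integral => w _; congr EFin.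
  rewrite indicE; case: (boolP (w \in _)) => [|/negP wA].
    rewrite inE => wA; apply: big1 => i _.
    by rewrite indicE mem_set//; exact: (wA i (ltn_ord i)).
  have [i iA] : exists i : 'I_n, ~ A i (D i w).
    apply: contrapT => /forallNP h; apply: wA; rewrite inE => i /= ilt.
    by apply: contrapT; exact: (h (Ordinal ilt)).
  by rewrite (bigD1 i)//= indicE memNset ?mul0r.
by rewrite indep//; apply: eq_bigr => i _; rewrite integral_indicD.
Qed.

Let upd (g : nat -> R -> R) (k : nat) (f : R -> R) := fun i => if i == k then f else g i.

(** Under P weighted by the product H of the other factors, the law of D_k is c
    times its law under P, where c is the product of the other expectations:
    this is the product rule for indicators in position k. Integrating g_k
    against both laws gives the rule for g_k. *)
Let prod_rule_step (g : nat -> R -> R) (k : nat) : (k < n)%N -> unit_fun g ->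
  (forall A, measurable A -> prod_rule (upd g k \1_A)) -> prod_rule g.
Proof.
move=> kn ug pg; pose K := Ordinal kn.
pose H w := \prod_(i < n | i != K) g i (D i w).
have gD01 i w : 0 <= g i (D i w) <= 1 by have [_] := ug i; exact.
have H0 w : 0 <= H w by apply: prodr_ge0 => i _; have /andP[] := gD01 i w.
have mgD i : measurable_fun [set: T] (fun w => g i (D i w)).
  by apply: measurableT_comp => //; have [] := ug i.
have mH : measurable_fun [set: T] H.
  have -> : H = fun w => \prod_(i < n) (if i != K then g i (D i w) else 1).
    by apply/funext => w; rewrite /H big_mkcond.
  by apply: measurable_prod => i _; case: (i != K).
have E01 i : (0 <= \int[P]_w (g i (D i w))%:E <= 1)%E.
  apply/andP; split.
    by apply: integral_ge0 => w _; rewrite lee_fin; have /andP[] := gD01 i w.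
  rewrite (@le_trans _ _ (\int[P]_w (cst 1%:E w))%E)//; last first.
    by rewrite integral_cst//= probability_setT mule1.
  apply: ge0_le_integral => //.
  - by move=> w _; rewrite lee_fin; have /andP[] := gD01 i w.
  - exact/measurable_EFinP.
  - by move=> w _; rewrite lee_fin; have /andP[] := gD01 i w.
pose e i := fine (\int[P]_w (g i (D i w))%:E)%E.
have eE i : (e i)%:E = (\int[P]_w (g i (D i w))%:E)%E.
  have /andP[E0 E1] := E01 i; rewrite /e fineK// ge0_fin_numE//.
  by rewrite (le_lt_trans E1)// ltry.
have e0 i : 0 <= e i by rewrite -lee_fin eE; have /andP[] := E01 i.
pose c := \prod_(i < n | i != K) e i.
have c0 : 0 <= c by apply: prodr_ge0.
have law : eq_law (density_measure P mH H0) (mscale (NngNum c0) P) (D k) (D k).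
  split => // A mA; have := pg A mA; rewrite /prod_rule.
  have updK f : upd g k f k = f by rewrite /upd eqxx.
  have updN f (i : 'I_n) : i != K -> upd g k f i = g i by move=> iK; rewrite /upd ifN.
  rewrite (bigD1 K)//= [X in (_ = X * _)%E]( _ : _ = P [set w | A (D k w)]); last first.
    by rewrite updK integral_indicD.
  rewrite [X in (_ * X)%E](_ : _ = c%:E); last first.
    rewrite /c -prodEFin; apply: eq_bigr => i iK.
    by rewrite updN ?eE.
  rewrite /mscale/= muleC => <-.
  rewrite /density_measure integral_mkcond; apply: eq_integral => w _.
  rewrite patchE (bigD1 K)//= updK indicE.
  have -> : \prod_(i < n | i != K) upd g k \1_A i (D i w) = H w.
    by apply: eq_bigr => i iK; rewrite updN.
  have -> : (w \in D k @^-1` A) = (D k w \in A) by apply/idP/idP; rewrite !inE.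
  by case: ifPn => _; rewrite ?mul1r ?mul0r.
have [mgk gk01] := ug k.
have mgkE : measurable_fun [set: R] (EFin \o g k) by exact/measurable_EFinP.
have := ge0_integral_eq_law law mgkE.
rewrite /prod_rule (bigD1 K)//=.
move=> /(_ (fun x => _)) h; have {}h := h (fun x => (andP (gk01 x)).1).
move: h; rewrite ge0_integral_density//=; last 2 first.
- exact/measurable_EFinP.
- by move=> w; rewrite lee_fin; have /andP[] := gD01 k w.
rewrite ge0_integral_mscale//=; last 2 first.
- exact/measurable_EFinP.
- by move=> w _; rewrite lee_fin; have /andP[] := gD01 k w.
have -> : (\prod_(i < n | i != K) \int[P]_w (g i (D i w))%:E)%E = c%:E.
  by rewrite /c -prodEFin; apply: eq_bigr => i _; rewrite eE.
rewrite muleC => <-; apply: eq_integral => w _.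
by rewrite (bigD1 K)//= EFinM.
Qed.

(** The product rule is known for indicators; the factors are replaced one
    position at a time by general ones. *)
Lemma expectation_prod (g : nat -> R -> R) :
  (forall i, measurable_fun [set: R] (g i)) -> (forall i x, 0 <= g i x <= 1) ->
  (\int[P]_w (\prod_(i < n) g i (D i w))%:E =
   \prod_(i < n) \int[P]_w (g i (D i w))%:E)%E.
Proof.
move=> mg g01.
(* Induction on the number k of positions that may carry general factors; from
   position k on, all factors are indicators. *)
have claim k (h : nat -> R -> R) : unit_fun h ->
    (forall i, (k <= i < n)%N -> exists2 A, measurable A & h i = \1_A) -> prod_rule h.
  elim: k h => [|k ih] h uh hA.
    have /choice[A hAA] : forall i, exists A : set R,
        measurable A /\ ((i < n)%N -> h i = \1_A).
      move=> i; have [ilt|_] := ltnP i n; last by exists setT.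
      by have [A mA hi] := hA i ilt; exists A.
    have := prod_rule_indic (fun i => (hAA i).1); rewrite /prod_rule.
    have e (i : 'I_n) : h i = \1_(A i) by exact: ((hAA i).2 (ltn_ord i)).
    under eq_bigr do under eq_integral do rewrite -e.
    move=> <-; apply: eq_integral => w _; congr EFin.
    by apply: eq_bigr => i _; rewrite e.
  have [kn|nk] := ltnP k n; last first.
    by apply: ih => // i /andP[ki ilt]; move: (leq_ltn_trans nk (leq_ltn_trans ki ilt)); rewrite ltnn.
  apply: (prod_rule_step kn uh) => A mA; apply: ih.
    move=> i; rewrite /upd; case: eqP => _; last exact: uh.
    split; first exact: measurable_indic.
    by move=> x; rewrite indicE; case: (_ \in _); rewrite ?lexx ?ler01.
  move=> i /andP[ki ilt]; rewrite /upd; case: eqP => [_|/eqP ik]; first by exists A.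
  by apply: hA; rewrite ilt andbT ltn_neqAle eq_sym ik.
apply: (claim n) => [i|i /andP[ni ilt]]; first by split; [exact: mg|exact: g01].
by move: (leq_ltn_trans ni ilt); rewrite ltnn.
Qed.

End product_rule.
End independence.

Section step_functions.
Context {R : realType}.
Variables (t : R) (N : nat).
Hypotheses (t0 : 0 < t) (N0 : (0 < N)%N).

Definition subdivision (i : nat) : R := t * (i%:R / N%:R).

Definition step_fun (c : nat -> R) (s : R) : R :=
  \sum_(i < N) c i * \1_(`]subdivision i, subdivision i.+1]) s.

Lemma subdivision_nondecreasing : nondecreasing_seq subdivision.
Proof.
by move=> i j ij; rewrite ler_pM2l// ler_pM2r ?invr_gt0 ?ltr0n// ler_nat.
Qed.

Lemma subdivision0 : subdivision 0 = 0.
Proof. by rewrite /subdivision mul0r mulr0. Qed.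

Lemma subdivision_ge0 i : 0 <= subdivision i.
Proof. by rewrite -subdivision0 subdivision_nondecreasing. Qed.

Lemma subdivisionN : subdivision N = t.
Proof. by rewrite /subdivision divff ?mulr1// pnatr_eq0 -lt0n. Qed.

Lemma subdivisionB i : subdivision i.+1 - subdivision i = t / N%:R.
Proof. by rewrite /subdivision -mulrBr -mulrBl -natr1 addrC addKr mul1r. Qed.

(** The interval containing s ends at the first subdivision point that is at
    least s. *)
Lemma step_fun_locate s : 0 < s <= t -> exists i : 'I_N,
  subdivision i < s <= subdivision i.+1 /\ forall c, step_fun c s = c i.
Proof.
move=> /andP[s0 st].
have exj : exists j, s <= subdivision j by exists N; rewrite subdivisionN.
pose j := ex_minn exj.
have [sj jmin] : s <= subdivision j /\ forall k, s <= subdivision k -> (j <= k)%N.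
  by rewrite /j; case: ex_minnP.
have j0 : (0 < j)%N.
  by rewrite lt0n; apply/eqP => j_eq0; move: sj; rewrite j_eq0 subdivision0 leNgt s0.
have jN : (j.-1 < N)%N by rewrite prednK// jmin// subdivisionN.
exists (Ordinal jN) => /=; rewrite prednK//; split.
  rewrite sj andbT ltNge; apply/negP => /jmin.
  by rewrite -[X in (X <= _)%N]prednK// ltnn.
move=> c; rewrite /step_fun (bigD1 (Ordinal jN))//= big1 ?addr0.
  rewrite indicE mem_set ?mulr1//= in_itv/= prednK// sj andbT.
  by rewrite ltNge; apply/negP => /jmin; rewrite -[X in (X <= _)%N]prednK// ltnn.
move=> i ij; rewrite indicE memNset ?mulr0//= in_itv/= => /andP[is_ si].
have := jmin _ si; rewrite leq_eqVlt => /predU1P[ji|ji].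
  by move: ij; rewrite -val_eqE/= ji eqxx.
have : s <= subdivision i.
  by rewrite (le_trans sj)// subdivision_nondecreasing// -ltnS.
by rewrite leNgt is_.
Qed.

Lemma step_fun_outside c s : ~~ (0 < s <= t) -> step_fun c s = 0.
Proof.
move=> st; rewrite /step_fun big1// => i _; rewrite indicE memNset ?mulr0//.
rewrite /= in_itv/= => /andP[is_ si]; move/negP: st; apply; apply/andP; split.
  exact: le_lt_trans (subdivision_ge0 i) is_.
by rewrite (le_trans si)// -subdivisionN subdivision_nondecreasing.
Qed.

Lemma integral_step_fun (m : {measure set (measurableTypeR R) -> \bar R}) (c : nat -> R) :
  (forall i, 0 <= c i) ->
  (\int[m]_(s in `]0%R, t]) (step_fun c s)%:E =
   \sum_(i < N) (c i)%:E * m `]subdivision i, subdivision i.+1]%classic)%E.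
Proof.
move=> c0.
have itvE (i : 'I_N) : `]0%R, t]%classic `&` `]subdivision i, subdivision i.+1]%classic =
    `]subdivision i, subdivision i.+1]%classic.
  apply/setIidr => x; rewrite /= !in_itv/= => /andP[ix xi].
  rewrite (le_lt_trans (subdivision_ge0 i) ix)/= (le_trans xi)//.
  by rewrite -subdivisionN subdivision_nondecreasing.
under eq_integral do rewrite /step_fun -sumEFin.
rewrite ge0_integral_sum//; last 2 first.
- move=> i; apply/measurable_EFinP; apply: measurable_funTS.
  by apply: measurable_funM => //; exact: measurable_indic.
- by move=> i s _; rewrite lee_fin mulr_ge0.
apply: eq_bigr => i _; under eq_integral do rewrite EFinM.
rewrite ge0_integralZl//.
- by rewrite integral_indic// setIC itvE.
- by apply/measurable_EFinP; apply: measurable_funTS; exact: measurable_indic.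
- by rewrite lee_fin.
Qed.

Lemma measurable_step_fun c : measurable_fun [set: R] (step_fun c).
Proof.
by apply: measurable_sum => i; exact: measurable_funM.
Qed.

End step_functions.

Section wiener_gamma.
Context {R : realType} d (T : measurableType d) (P : probability T R).
Variable X : gamma_process P.
Local Notation leb := (@lebesgue_measure R).

Lemma stieltjes_measure_itv w (a b : R) : 0 <= a -> a <= b ->
  lebesgue_stieltjes_measure (sub_path X w) `]a, b]%classic = (X b w - X a w)%:E.
Proof.
move=> a0 ab; rewrite /lebesgue_stieltjes_measure /measure_extension/=.
rewrite measurable_mu_extE/=; last exact: is_ocitv.
by rewrite wlength_itv_bnd// /sub_path !max_r// (le_trans a0).
Qed.

(** The positive part changes nothing on increments and makes the exponential
    bounded by 1 on the whole line, as the product rule requires of its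
    factors. *)
Lemma gamma_increment_laplace (a b l : R) : 0 <= a -> a <= b -> 0 <= l ->
  (\int[P]_w (expR (- (l * Num.max 0 (X b w - X a w))))%:E =
   (expR (- ((b - a) * ln (1 + l))))%:E)%E.
Proof.
move=> a0 ab l0.
have ba0 : 0 <= b - a by rewrite subr_ge0.
pose f (x : R) := (expR (- (l * Num.max 0 x)))%:E.
have mf : measurable_fun [set: R] f.
  apply/measurable_EFinP; apply: measurableT_comp => //; apply: measurable_funN.
  by apply: measurable_funM => //; exact: measurable_maxr.
have f0 x : (0 <= f x)%E by rewrite lee_fin expR_ge0.
rewrite (ge0_integral_eq_law (sub_stationary X a0 ab) mf f0).
have X0 w : 0 <= X (b - a) w by rewrite -(sub_start X w) sub_nondecreasing.
transitivity ('E_P[fun w => expR (- (l * X (b - a)%R w))])%E.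
  by rewrite unlock; apply: eq_integral => w _; rewrite /f max_r.
rewrite sub_laplace//.
move: l0; rewrite le_eqVlt => /predU1P[<-|l0].
  rewrite addr0 ln1 mulr0 /levy_exponent.
  under eq_integral do rewrite mul0r oppr0 expR0 subrr mul0r.
  by rewrite integral0 mule0 oppe0 /= oppr0.
by rewrite levy_exponent_gamma.
Qed.

(** The Laplace functional of the gamma process at h; the exponent may be
    infinite, and then the integral is infinite almost surely. *)
Definition wiener_law (t : R) (h : R -> R) : Prop :=
  measurable_fun [set: T] (stieltjes_integral X h t) /\
  forall l : R, 0 < l ->
    (\int[P]_w expeR (- (l%:E * stieltjes_integral X h t w)) =
     expeR (- \int[leb]_(s in `]0%R, t]) (ln (1 + l * h s))%:E))%E.

(** The integral is a finite sum of independent scaled increments, so its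
    Laplace transform is the product of powers (1 + l c_i)^(-(r_(i+1) -
    r_i)). *)
Lemma wiener_law_step (t : R) (N : nat) (c : nat -> R) :
  0 < t -> (0 < N)%N -> (forall i, 0 <= c i) -> wiener_law t (step_fun t N c).
Proof.
move=> t0 N0 c0.
pose r := subdivision t N.
have rnd : nondecreasing_seq r by exact: subdivision_nondecreasing.
have r0 i : 0 <= r i by exact: subdivision_ge0.
have D0 i w : 0 <= X (r i.+1) w - X (r i) w.
  by rewrite subr_ge0; apply: sub_nondecreasing => //; exact: rnd.
have IE w : stieltjes_integral X (step_fun t N c) t w =
    (\sum_(i < N) c i * (X (r i.+1) w - X (r i) w))%:E.
  rewrite /stieltjes_integral integral_step_fun// -sumEFin.
  apply: eq_bigr => i _; rewrite EFinM; congr (_ * _)%E.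
  exact: stieltjes_measure_itv (r0 i) (rnd _ _ (leqnSn i)).
split.
  rewrite (_ : stieltjes_integral _ _ _ =
      EFin \o (fun w => \sum_(i < N) c i * (X (r i.+1) w - X (r i) w))); last first.
    by apply/funext => w; rewrite IE.
  apply/measurable_EFinP; apply: measurable_sum => i.
  by apply: measurable_funM => //; exact: measurable_funB.
move=> l l0.
have lc i : 0 <= l * c i by rewrite mulr_ge0// ltW.
transitivity (\int[P]_w (\prod_(i < N)
    expR (- (l * c i * Num.max 0 (X (r i.+1) w - X (r i) w))))%:E)%E.
  apply: eq_integral => w _; rewrite IE -EFinM -EFinN/= -expR_sum; congr (expR _)%:E.
  rewrite mulr_sumr -sumrN; apply: eq_bigr => i _.
  by rewrite max_r// mulrA.
rewrite (@expectation_prod _ _ _ P N (fun i w => X (r i.+1) w - X (r i) w) _ _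
  (fun i x => expR (- (l * c i * Num.max 0 x)))); last 4 first.
- by move=> i; exact: measurable_funB.
- move=> A mA; exact: sub_independent.
- move=> i; apply: measurableT_comp => //; apply: measurable_funN.
  by apply: measurable_funM => //; exact: measurable_maxr.
- move=> i x; rewrite expR_ge0/= -expR0 ler_expR oppr_le0 mulr_ge0//.
  by rewrite le_max lexx.
under eq_bigr => i _.
  rewrite gamma_increment_laplace//; last exact: rnd.
  over.
rewrite prodEFin -expR_sum.
transitivity (expeR (- \int[leb]_(s in `]0%R, t])
    (step_fun t N (fun i => ln (1 + l * c i)) s)%:E)%E); last first.
  congr (expeR (- _)); apply: eq_integral => s; rewrite inE/= in_itv/= => st.
  by have [i [_ E]] := step_fun_locate t0 N0 st; rewrite !E.
rewrite integral_step_fun//; last by move=> i; rewrite ln_ge0// lerDl.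
have lebE i : leb `]r i, r i.+1]%classic = (r i.+1 - r i)%:E.
  rewrite lebesgue_measure_itv/= lte_fin ifT// -subr_gt0 subdivisionB.
  by rewrite divr_gt0// ltr0n.
transitivity (expeR (- \sum_(i < N) ((ln (1 + l * c i))%:E * (r i.+1 - r i)%:E))%E).
  rewrite sumEFin/= -sumrN; congr (expR _)%:E.
  by apply: eq_bigr => i _; rewrite mulrC.
congr (expeR (- _)); apply: eq_bigr => i _; congr (_ * _)%E.
exact/esym/lebE.
Qed.

(** Continuity of s |-> e^(-l s) on [0, +oo], the point +oo included. *)
Lemma cvg_expeRN (u : nat -> \bar R) (a : \bar R) (l : R) : 0 < l ->
  (forall n, (0 <= u n)%E) -> u n @[n --> \oo] --> a ->
  expeR (- (l%:E * u n)) @[n --> \oo] --> expeR (- (l%:E * a)).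
Proof.
move=> l0 u0 ua.
have : (0 <= a)%E.
  by apply: (cvge_ge _ ua); exact: nearW.
case: a ua => [a| |//] ua.
  move=> _; have /fine_cvgP[ufin uf] := ua.
  have c : (expR (- (l * fine (u n))))%:E @[n --> \oo] --> (expR (- (l * a)))%:E.
    apply: cvg_EFin; first by near=> n.
    apply: (@continuous_cvg _ _ _ _ _ _ (fun x => expR (- (l * x)))) uf.
    apply: (@continuous_comp _ _ _ (fun x => - (l * x)) expR); last exact: continuous_expR.
    by apply: cvgN; apply: cvgM; [exact: cvg_cst|].
  apply: cvg_trans c; apply: near_eq_cvg; near=> n.
  have /fineK un : u n \is a fin_num by near: n.
  by rewrite /= -[in RHS]un.
move=> _; rewrite gt0_muley ?lte_fin//=.
have c : laplace_kernel l (u n) @[n --> \oo] --> 0.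
  apply/cvgrPdist_lt => e e0.
  have : \forall n \near \oo, (((1 - ln e) / l)%:E <= u n)%E by move/cvgeyPge: ua; exact.
  apply: filterS => n An; rewrite sub0r normrN.
  have /andP[k0 _] := laplace_kernel01 l0 (u0 n); rewrite ger0_norm//.
  rewrite -lte_fin laplace_kernelE//.
  apply: (@le_lt_trans _ _ (expeR (- (l%:E * ((1 - ln e) / l)%:E))%E)).
    by rewrite lee_expeR leeN2 lee_wpmul2l// lee_fin ltW.
  rewrite -EFinM -EFinN/= lte_fin mulrC divfK ?gt_eqF// opprB expRB lnK ?posrE//.
  by rewrite ltr_pdivrMr ?expR_gt0// ltr_pMr// expR_gt1.
have {}c : (laplace_kernel l (u n))%:E @[n --> \oo] --> 0%:E.
  by apply: cvg_EFin => //; near=> n.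
by under eq_fun do rewrite -laplace_kernelE//.
Unshelve. all: by end_near. Qed.

(** Laplace transforms of random variables in [0, +oo] converge along pathwise
    limits, by bounded convergence. *)
Lemma wiener_law_limit (t : R) (h_ : nat -> R -> R) (h : R -> R) :
  (forall n, wiener_law t (h_ n)) -> (forall n s, 0 <= h_ n s) ->
  (forall w, stieltjes_integral X (h_ n) t w @[n --> \oo] --> stieltjes_integral X h t w) ->
  (forall l : R, 0 < l ->
    (\int[leb]_(s in `]0%R, t]) (ln (1 + l * h_ n s))%:E)%E @[n --> \oo] -->
    (\int[leb]_(s in `]0%R, t]) (ln (1 + l * h s))%:E)%E) ->
  wiener_law t h.
Proof.
move=> Wh h0 Ih Jh.
have I0 n w : (0 <= stieltjes_integral X (h_ n) t w)%E.
  by apply: integral_ge0 => s _; rewrite lee_fin.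
have I0' w : (0 <= stieltjes_integral X h t w)%E.
  by apply: (cvge_ge _ (Ih w)); exact: nearW.
have mI : measurable_fun [set: T] (stieltjes_integral X h t).
  apply: (emeasurable_fun_cvg (fun n => stieltjes_integral X (h_ n) t)).
    by move=> n; have [] := Wh n.
  by move=> w _; exact: Ih.
split=> // l l0.
have kE u : (0 <= u)%E -> expeR (- (l%:E * u)) = (laplace_kernel l u)%:E.
  by move=> u0; rewrite laplace_kernelE.
have c1 : (\int[P]_w expeR (- (l%:E * stieltjes_integral X (h_ n) t w)))%E @[n --> \oo]
    --> (\int[P]_w expeR (- (l%:E * stieltjes_integral X h t w)))%E.
  apply: (@dominated_cvg _ _ _ P setT measurableT _ _ (cst 1%E)) => //.
  - move=> n; under eq_fun do rewrite kE//.
    apply/measurable_EFinP; apply: measurableT_comp; first exact: measurable_laplace_kernel.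
    by have [] := Wh n.
  - by move=> w _; apply: cvg_expeRN.
  - exact: finite_measure_integrable_cst.
  - move=> n w _; rewrite kE// gee0_abs ?lee_fin; have /andP[] // := laplace_kernel01 l0 (I0 n w).
have c2 : (\int[P]_w expeR (- (l%:E * stieltjes_integral X (h_ n) t w)))%E @[n --> \oo]
    --> (expeR (- \int[leb]_(s in `]0%R, t]) (ln (1 + l * h s))%:E))%E.
  under eq_fun do rewrite (Wh _).2// -[X in expeR (- X)%E]mul1e.
  rewrite -[X in expeR (- X)%E]mul1e; apply: cvg_expeRN => //; last exact: Jh.
  move=> n; apply: integral_ge0 => s _; rewrite lee_fin ln_ge0// lerDl.
  by rewrite mulr_ge0// ltW.
exact: (cvg_unique _ c1 c2).
Qed.

Lemma stieltjes_finite (t : R) w : 0 <= t ->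
  (lebesgue_stieltjes_measure (sub_path X w) `]0%R, t]%classic < +oo)%E.
Proof. by move=> t0; rewrite stieltjes_measure_itv// ltry. Qed.

(** Along each path the Stieltjes measure of ]0, t] is finite, so bounded
    convergence applies to the paths as well as to the exponents. *)
Lemma wiener_law_bounded_limit (t : R) (h_ : nat -> R -> R) (h : R -> R) (C : R) :
  0 <= t ->
  (forall n, wiener_law t (h_ n)) -> (forall n, measurable_fun [set: R] (h_ n)) ->
  (forall n s, 0 <= h_ n s <= C) ->
  (forall s, 0 < s <= t -> h_ n s @[n --> \oo] --> h s) ->
  wiener_law t h.
Proof.
move=> t0 Wh mh hC hh.
have h0 n s : 0 <= h_ n s by have /andP[] := hC n s.
have bnd (m : {measure set (measurableTypeR R) -> \bar R}) (M : R) :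
    (m `]0%R, t]%classic < +oo)%E -> m.-integrable `]0%R, t]%classic (cst M%:E).
  move=> mfin; apply: (@measurable_bounded_integrable _ _ _ m (cst M)) => //.
  exists `|M|; split; first exact: num_real.
  by move=> x Mx s _ /=; exact: ltW.
apply: (wiener_law_limit Wh) => // [w|l l0].
  apply: (@dominated_cvg _ _ _ _ _ _ _ _ (cst C%:E)) => //.
  - by move=> n; apply/measurable_EFinP; exact: measurable_funTS (mh n).
  - move=> s; rewrite /= in_itv/= => st; apply: cvg_EFin; first by near=> n.
    exact: hh.
  - by apply: bnd; exact: stieltjes_finite.
  - by move=> n s _; rewrite /= lee_fin ger0_norm//; have /andP[] := hC n s.
have lh0 n s : 0 <= l * h_ n s by rewrite mulr_ge0// ltW.
have lebfin : (leb `]0%R, t]%classic < +oo)%E.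
  by rewrite lebesgue_measure_itv/=; case: ifP => _; rewrite ltry.
apply: (@dominated_cvg _ _ _ _ _ _ _ _ (cst (ln (1 + l * C))%:E)) => //.
- move=> n; have mln : measurable_fun [set: R] (fun s => ln (1 + l * h_ n s)).
    apply: measurableT_comp => //; apply: measurable_funD => //.
    exact: measurable_funM.
  by apply/measurable_EFinP; exact: measurable_funTS mln.
- move=> s; rewrite /= in_itv/= => st; apply: cvg_EFin; first by near=> n.
  have hs0 : 0 <= h s.
    rewrite -(cvg_lim _ (hh s st))//; apply: limr_ge; last exact: nearW.
    by apply/cvg_ex; exists (h s); exact: hh.
  apply: (@continuous_cvg _ _ _ _ _ _ (@ln R)).
    by apply: continuous_ln; rewrite ltr_pwDl// mulr_ge0// ltW.
  by apply: cvgD; [exact: cvg_cst|apply: cvgM; [exact: cvg_cst|exact: hh]].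
- exact: (bnd leb _ lebfin).
- move=> n s _; rewrite /= lee_fin ger0_norm ?ln_ge0 ?lerDl//.
  have /andP[_ hCn] := hC n s.
  have lp : 0 < 1 + l * h_ n s by rewrite ltr_pwDl.
  have lhC : l * h_ n s <= l * C by rewrite ler_wpM2l// ltW.
  by rewrite ler_ln ?posrE ?lerD2l//; rewrite (lt_le_trans lp)// lerD2l.
Unshelve. all: by end_near. Qed.

(** Both the pathwise integrals and the exponents are integrals of increasing
    continuous functions of h_n. *)
Lemma wiener_law_monotone_limit (t : R) (h_ : nat -> R -> R) (h : R -> R) :
  (forall n, wiener_law t (h_ n)) -> (forall n, measurable_fun [set: R] (h_ n)) ->
  (forall n s, 0 <= h_ n s) -> (forall s, nondecreasing_seq (h_ ^~ s)) ->
  (forall s, h_ n s @[n --> \oo] --> h s) ->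
  wiener_law t h.
Proof.
move=> Wh mh h0 hnd hh.
have h0' s : 0 <= h s.
  rewrite -(cvg_lim _ (hh s))//; apply: limr_ge; last exact: nearW.
  by apply/cvg_ex; exists (h s); exact: hh.
have mono (m : {measure set (measurableTypeR R) -> \bar R}) (g : R -> R) :
    measurable_fun [set: R] g -> (forall x, 0 <= x -> 0 <= g x) ->
    (forall x y, 0 <= x -> x <= y -> g x <= g y) ->
    (forall x, 0 <= x -> {for x, continuous g}) ->
    (\int[m]_(s in `]0%R, t]) (g (h_ n s))%:E)%E @[n --> \oo] -->
    (\int[m]_(s in `]0%R, t]) (g (h s))%:E)%E.
  move=> mg g0 gnd gc.
  have gh s : (g (h_ n s))%:E @[n --> \oo] --> (g (h s))%:E.
    apply: cvg_EFin; first by near=> n.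
    by apply: (@continuous_cvg _ _ _ _ _ _ g); [exact: gc|exact: hh].
  have -> : (\int[m]_(s in `]0%R, t]) (g (h s))%:E =
      \int[m]_(s in `]0%R, t]) limn (fun n => (g (h_ n s))%:E))%E.
    by apply: eq_integral => s _; apply/esym/cvg_lim => //; exact: gh.
  apply: (@cvg_monotone_convergence _ _ _ m `]0%R, t]%classic _ (fun n s => (g (h_ n s))%:E)) => //.
  - move=> n; have mgh : measurable_fun [set: R] (fun s => g (h_ n s)).
      exact: measurableT_comp.
    by apply/measurable_EFinP; exact: measurable_funTS mgh.
  - by move=> n s _; rewrite lee_fin g0.
  - by move=> s _ i j ij; rewrite lee_fin gnd//; exact: hnd.
apply: (wiener_law_limit Wh) => // [w|l l0].
  apply: (mono _ id) => // x _; exact: cvg_id.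
apply: (mono _ (fun x => ln (1 + l * x))).
- by apply: measurableT_comp => //; apply: measurable_funD.
- by move=> x x0; rewrite ln_ge0// lerDl mulr_ge0// ltW.
- move=> x y x0 xy; have lx : 0 < 1 + l * x by rewrite ltr_pwDl// mulr_ge0// ltW.
  have lxy : 1 + l * x <= 1 + l * y by rewrite lerD2l ler_wpM2l// ltW.
  by rewrite ler_ln ?posrE//; exact: lt_le_trans lxy.
- move=> x x0; apply: (@continuous_comp _ _ _ (fun x => 1 + l * x) (@ln R)).
    by apply: cvgD; [exact: cvg_cst|apply: cvgM; [exact: cvg_cst|exact: cvg_id]].
  by apply: continuous_ln; rewrite ltr_pwDl// mulr_ge0// ltW.
Unshelve. all: by end_near. Qed.

(** Truncation at height k makes the sampled step functions uniformly bounded;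
    the bounded limit in the mesh is followed by the monotone limit in k. *)
Lemma wiener_law_sampling (t : R) (h : R -> R) (p : nat -> nat -> R) : 0 < t ->
  measurable_fun [set: R] h -> (forall s, 0 <= h s) ->
  (forall s, 0 < s <= t -> step_fun t n.+1 (fun i => h (p n i)) s @[n --> \oo] --> h s) ->
  wiener_law t h.
Proof.
move=> t0 mh h0 ph.
pose trunc (k : nat) (x : R) := Num.min x k%:R.
have trunc_ge0 k s : 0 <= trunc k (h s) by rewrite /trunc le_min h0/= ler0n.
apply: (@wiener_law_monotone_limit t (fun k s => trunc k (h s))) => //.
- move=> k; apply: (@wiener_law_bounded_limit t
    (fun n => step_fun t n.+1 (fun i => trunc k (h (p n i)))) _ k%:R).
  + exact: ltW.
  + by move=> n; apply: wiener_law_step.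
  + by move=> n; exact: measurable_step_fun.
  + move=> n s; have [st|st] := boolP (0 < s <= t).
      have [i [_ ->]] := step_fun_locate t0 (ltn0Sn n) st.
      by rewrite trunc_ge0/= /trunc ge_min lexx orbT.
    by rewrite step_fun_outside// lexx ler0n.
  + move=> s st; have c : trunc k (step_fun t n.+1 (fun i => h (p n i)) s) @[n --> \oo]
        --> trunc k (h s).
      apply: (@continuous_cvg _ _ _ _ _ _ (trunc k)); last exact: ph.
      exact: (@continuous_min R R id (cst k%:R) (h s) (@cvg_id _ _) (@cvg_cst _ _ _ _ _)).
    apply: cvg_trans c; apply: near_eq_cvg; near=> n.
    by have [i [_ e]] := step_fun_locate t0 (ltn0Sn n) st; rewrite !e.
- by move=> k; apply: measurable_minr.
- move=> s i j ij; rewrite /trunc le_min !ge_min lexx/= ler_nat ij orbT//.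
- move=> s; apply: (@cvg_trans _ (cst (h s) @ \oo)); last exact: cvg_cst.
  apply: near_eq_cvg; near=> k.
  have hk : h s <= k%:R by near: k; exact: nbhs_infty_ger.
  by rewrite /trunc; apply/esym/min_idPl.
Unshelve. all: by end_near. Qed.

Lemma mesh_lt (t e : R) : 0 < t -> 0 < e -> \forall n \near \oo, t / n.+1%:R < e.
Proof.
move=> t0 e0; have et : 0 < e / t by rewrite divr_gt0.
apply: filterS (near_infty_natSinv_lt (PosNum et)) => n /=.
by rewrite ltr_pdivlMr// mulrC.
Qed.

(** Sampling at left endpoints approaches s from the left. *)
Lemma wiener_law_left_continuous (t : R) (h : R -> R) : 0 < t ->
  measurable_fun [set: R] h -> (forall s, 0 <= h s) ->
  (forall s, 0 < s <= t -> h x @[x --> s^'-] --> h s) ->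
  wiener_law t h.
Proof.
move=> t0 mh h0 hc; apply: (wiener_law_sampling (p := fun n => subdivision t n.+1)) => // s st.
apply/cvgrPdist_lt => e e0.
have /cvgrPdist_lt/(_ e e0)[r /= r0 Hr] := hc s st.
apply: filterS (mesh_lt t0 r0) => n nr.
have [i [/andP[is_ si] ->]] := step_fun_locate t0 (ltn0Sn n) st.
apply: Hr => //=; rewrite gtr0_norm ?subr_gt0//.
apply: le_lt_trans nr; rewrite -(subdivisionB t n.+1 i) lerD2r//.
Qed.

(** Sampling at right endpoints approaches s from the right, except at s = t,
    where the right endpoint of the last interval is t itself. *)
Lemma wiener_law_right_continuous (t : R) (h : R -> R) : 0 < t ->
  measurable_fun [set: R] h -> (forall s, 0 <= h s) ->
  (forall s, 0 < s < t -> h x @[x --> s^'+] --> h s) ->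
  wiener_law t h.
Proof.
move=> t0 mh h0 hc.
apply: (wiener_law_sampling (p := fun n i => subdivision t n.+1 i.+1)) => // s st.
apply/cvgrPdist_lt => e e0.
have [st'|] := boolP (s < t); last first.
  rewrite -leNgt => ts; have {ts} ts : s = t.
    by apply/le_anti; rewrite ts; have /andP[_ ->] := st.
  apply: nearW => n.
  have [i [/andP[is_ si] ->]] := step_fun_locate t0 (ltn0Sn n) st.
  suff -> : subdivision t n.+1 i.+1 = s by rewrite subrr normr0.
  apply/le_anti; rewrite si andbT ts -[leRHS](subdivisionN t (ltn0Sn n)).
  exact: subdivision_nondecreasing.
have s0 : 0 < s by have /andP[] := st.
have /cvgrPdist_lt/(_ e e0)[r /= r0 Hr] := hc s (introT andP (conj s0 st')).
apply: filterS (mesh_lt t0 r0) => n nr.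
have [i [/andP[is_ si] ->]] := step_fun_locate t0 (ltn0Sn n) st.
move: si; rewrite le_eqVlt => /predU1P[<-|si]; first by rewrite subrr normr0.
apply: Hr => //=; rewrite ltr0_norm ?subr_lt0// opprB.
by apply: lt_trans nr; rewrite -(subdivisionB t n.+1 i) ltrD2l ltrN2.
Qed.

End wiener_gamma.

(** * Quantiles *)

Lemma eq_law_tails (R : realType) d1 (T1 : measurableType d1) d2 (T2 : measurableType d2)
    (m1 : {measure set T1 -> \bar R}) (m2 : {measure set T2 -> \bar R})
    (X1 : T1 -> R) (X2 : T2 -> R) :
  measurable_fun setT X1 -> measurable_fun setT X2 ->
  (m1 setT < +oo)%E -> m1 setT = m2 setT ->
  (forall a : R, m1 [set w | a < X1 w] = m2 [set w | a < X2 w]) ->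
  eq_law m1 m2 X1 X2.
Proof.
move=> mX1 mX2 m1fin m12 tails; split => // A mA.
rewrite !preimage_EFin; apply: eq_measure_tails => //.
- exact/measurable_EFinP.
- exact/measurable_EFinP.
- exact: measurable_image_EFin.
Qed.

Lemma lebesgue_measure_between (R : realType) (a b : R) (A : set R) :
  measurable A -> a <= b -> `]a, b[ `<=` A -> A `<=` `[a, b] ->
  lebesgue_measure A = (b - a)%:E.
Proof.
move=> mA; rewrite le_eqVlt => /predU1P[<- _ Aab|ab abA Aab].
  apply/eqP; rewrite subrr eq_le measure_ge0 andbT.
  rewrite [leRHS](_ : _ = lebesgue_measure [set a]); last by rewrite lebesgue_measure_set1.
  apply: le_measure; rewrite ?inE//.
  by move=> x /Aab; rewrite /= in_itv/= => /le_anti.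
have E b1 b2 : @lebesgue_measure R [set` Interval (BSide b1 a) (BSide b2 b)] = (b - a)%:E.
  by rewrite lebesgue_measure_itv/= lte_fin ab.
by apply/eqP; rewrite eq_le -{1}(E true false) -(E false true) !le_measure ?inE.
Qed.

Section quantile.
Context {R : realType} d (T : measurableType d) (P : probability T R).
Variable G : {RV P >-> R}.
Hypothesis G0 : {ae P, forall w, 0 < G w}.
Local Notation leb := (@lebesgue_measure R).
Local Notation q := (cdf_inv G).

Lemma cdf_positive_le0 x : x <= 0 -> cdf G x = 0%E.
Proof.
move=> x0; apply/eqP; rewrite eq_le cdf_ge0 andbT.
apply: (le_trans (cdf_nondecreasing G x0)).
suff -> : cdf G 0 = 0%E by [].
rewrite /cdf /distribution /pushforward; apply/negligibleP.
  by rewrite -[X in measurable X]setTI; exact: measurable_funP.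
move: G0; rewrite /almost_everywhere; apply: negligibleS => w /=.
by rewrite in_itv/= leNgt => /negP.
Qed.

Lemma cdf_fin_num x : cdf G x \is a fin_num.
Proof. by rewrite ge0_fin_numE ?cdf_ge0// (le_lt_trans (cdf_le1 G x))// ltry. Qed.

Lemma lbound_cdf_gt y : 0 <= y -> lbound [set x | (y%:E < cdf G x)%E] 0.
Proof.
move=> y0 x /=; rewrite leNgt; apply: contraTN => x0.
by rewrite -leNgt cdf_positive_le0 ?lee_fin// ltW.
Qed.

Lemma cdf_inv_le y x : 0 <= y -> (y%:E < cdf G x)%E -> q y <= x.
Proof. by move=> y0 yx; apply: ge_inf => //; exists 0; exact: lbound_cdf_gt. Qed.

Lemma cdf_gt_nonempty y : y < 1 -> [set x | (y%:E < cdf G x)%E] !=set0.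
Proof.
move=> y1; apply: contrapT => /nonemptyPn S0.
suff : ((1 : R)%:E <= y%:E)%E by rewrite lee_fin leNgt y1.
apply: (cvge_to_le (cvg_cdfy1 G)); apply: nearW => x.
by rewrite leNgt; apply/negP => yx; have : set0 x by rewrite -S0.
Qed.

Lemma lt_cdf y x : y < 1 -> q y < x -> (y%:E < cdf G x)%E.
Proof.
move=> y1 /(inf_lt (cdf_gt_nonempty y1))[z /= yz zx].
by apply: (lt_le_trans yz); apply: cdf_nondecreasing; exact: ltW.
Qed.

(** Strictly above the quantile this is the definition of an infimum; right
    continuity of the distribution function reaches the quantile itself. *)
Lemma le_cdf y x : y < 1 -> q y <= x -> (y%:E <= cdf G x)%E.
Proof.
move=> y1 qx; apply: (cvge_to_ge (@cdf_right_continuous _ _ _ _ G x)).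
near=> z; apply/ltW/lt_cdf => //; apply: (le_lt_trans qx).
by near: z; exact: nbhs_right_gt.
Unshelve. all: by end_near. Qed.

(** For y < 0 the set is unbounded below and for y >= 1 it is empty; the infimum
    is 0 by convention in both cases. *)
Lemma cdf_inv_out y : ~~ (0 <= y < 1) -> q y = 0.
Proof.
rewrite negb_and -!ltNge => /orP[y0|y1]; apply: inf_out => -[[x xS] [m mS]].
  have : m <= m - 1 by apply: mS => /=; rewrite (lt_le_trans _ (cdf_ge0 G _))// lte_fin.
  by rewrite leNgt ltrBlDr ltrDl ltr01.
by move: xS; rewrite /= ltNge (le_trans (cdf_le1 G x))// lee_fin leNgt.
Qed.

Lemma cdf_inv_ge0 y : 0 <= q y.
Proof.
have [/andP[y0 y1]|/cdf_inv_out->//] := boolP (0 <= y < 1).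
by apply: lb_le_inf; [exact: cdf_gt_nonempty|exact: lbound_cdf_gt].
Qed.

Lemma cdf_inv_gt0 y : 0 < y -> y < 1 -> 0 < q y.
Proof.
move=> y0 y1; rewrite ltNge; apply/negP => /(le_cdf y1).
by rewrite cdf_positive_le0// lee_fin leNgt y0.
Qed.

Lemma cdf_inv_nondecreasing y z : 0 <= y -> y <= z -> z < 1 -> q y <= q z.
Proof.
move=> y0 yz z1; apply: lb_le_inf; first exact: cdf_gt_nonempty.
by move=> x /= zx; apply: cdf_inv_le => //; rewrite (le_lt_trans _ zx)// lee_fin.
Qed.

(** Superlevel sets above a positive height are intervals, since the quantile is
    monotone on [0, 1[ and 0 outside. *)
Lemma measurable_cdf_inv : measurable_fun [set: R] q.
Proof.
apply: (measurability (@RGenCInfty.G R)) => [|/= _ [_] [r] -> <-].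
  exact: RGenCInfty.measurableE.
rewrite setTI; have [r0|r0] := leP r 0.
  rewrite (_ : _ @^-1` _ = setT)//; apply/seteqP; split=> // y _ /=.
  by rewrite in_itv/= andbT (le_trans r0)// cdf_inv_ge0.
apply: is_interval_measurable => s t /=; rewrite !in_itv/= !andbT => rs rt u /andP[su ut].
have inI y : r <= q y -> 0 <= y < 1.
  move=> ry; apply: contraTT (lt_le_trans r0 ry) => /cdf_inv_out ->.
  by rewrite ltxx.
have /andP[s0 _] := inI s rs; have /andP[_ t1] := inI t rt.
rewrite in_itv/= andbT (le_trans rs)// cdf_inv_nondecreasing//.
exact: le_lt_trans t1.
Qed.

Lemma cdf_inv_right_continuous y : 0 <= y -> y < 1 -> q x @[x --> y^'+] --> q y.
Proof.
move=> y0 y1; apply/cvgrPdist_le => e e0.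
have := lt_cdf y1 (ltr_pwDr e0 (lexx (q y))).
have := cdf_fin_num (q y + e) => /fineK <-; rewrite lte_fin => yr.
near=> x; have yx : y < x by near: x; exact: nbhs_right_gt.
have x1 : x < 1 by near: x; exact: nbhs_right_lt.
have xr : x < fine (cdf G (q y + e)) by near: x; exact: nbhs_right_lt.
have qyx : q y <= q x by rewrite cdf_inv_nondecreasing// ltW.
rewrite distrC ger0_norm ?subr_ge0// lerBlDl; apply: cdf_inv_le.
  by rewrite (le_trans y0)// ltW.
by rewrite -(fineK (cdf_fin_num _)) lte_fin.
Unshelve. all: by end_near. Qed.

(** Let p = 1 - y and a = q(p). If z < f(a), then z < f(x) for some x > a, so
    H <= z forces G > x, and this has probability less than y as F(x) > p. If
    f(a) < z, then f(x) < z for some x < a, so G > x forces H <= z; this has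
    probability more than y as soon as F(x) < p. *)
Lemma cdf_inv_antitone (H : {RV P >-> R}) (f : R -> R) (y : R) :
  (forall w, H w = f (G w)) ->
  (forall x z, 0 < x -> x <= z -> f z <= f x) ->
  (forall x, 0 < x -> {for x, continuous f}) ->
  0 < y -> y < 1 -> (forall r : rat, cdf G (ratr r) != (1 - y)%:E) ->
  cdf_inv H y = f (q (1 - y)).
Proof.
move=> HG fni fc y0 y1 yQ; set p := 1 - y; set a := q p.
have p0 : 0 < p by rewrite subr_gt0.
have p1 : p < 1 by rewrite ltrBlDr ltrDl.
have a0 : 0 < a by exact: cdf_inv_gt0.
have mle (X : {RV P >-> R}) z : measurable [set w | X w <= z].
  rewrite (_ : [set _ | _] = X @^-1` `]-oo, z]%classic); last first.
    by apply/seteqP; split => w /=; rewrite in_itv.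
  by rewrite -[X in measurable X]setTI; exact: measurable_funP.
have cdfE (X : {RV P >-> R}) z : cdf X z = P [set w | X w <= z].
  by rewrite /cdf /distribution /pushforward; congr (P _);
    apply/seteqP; split => w /=; rewrite in_itv.
have tail x : P (~` [set w | (G w <= x)%R]) = (1 - fine (cdf G x))%:E.
  rewrite probability_setC// EFinB fineK ?cdf_fin_num// cdfE//.
(* The event G <= 0, where f need not be monotone, is null. *)
have lb z : z < f a -> (cdf H z < y%:E)%E.
  move=> zfa; have : \forall x \near a^'+, z < f x.
    have c : f x @[x --> a^'+] --> f a by apply: cvg_at_right_filter; exact: fc.
    by apply: (cvgr_gt _ c).
  move=> near_z; near a^'+ => x.
  have ax : a < x by near: x; exact: nbhs_right_gt.
  have zfx : z < f x by near: x.
  have : (cdf H z <= P (~` [set w | (G w <= x)%R]))%E.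
    apply: (@le_trans _ _ (P (~` [set w | (G w <= x)%R] `|` [set w | (G w <= 0)%R]))).
      rewrite cdfE; apply: le_measure; rewrite ?inE//.
        by apply: measurableU => //; exact: measurableC.
      move=> w /=; rewrite HG => fz; have [Gw|Gw] := leP (G w) 0; [by right|left].
      apply/negP; rewrite -ltNge; have [//|xG] := ltP x (G w).
      by have := fni _ _ Gw xG; rewrite leNgt (le_lt_trans fz).
    rewrite -[leRHS]adde0 -(cdf_positive_le0 (lexx 0)) cdfE.
    by apply: measureU2 => //; exact: measurableC.
  move/le_lt_trans; apply; rewrite tail lte_fin ltrBlDr -ltrBlDl -/p.
  by rewrite -lte_fin fineK ?cdf_fin_num//; exact: lt_cdf.
have ub z : f a < z -> (y%:E < cdf H z)%E.
  move=> faz; have : \forall x \near a^'-, f x < z.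
    have c : f x @[x --> a^'-] --> f a by apply: cvg_at_left_filter; exact: fc.
    by apply: (cvgr_lt _ c).
  move=> near_z; near a^'- => x.
  have xa : x < a by near: x; exact: nbhs_left_lt.
  have x0 : 0 < x by near: x; exact: nbhs_left_gt.
  have zfx : f x < z by near: x.
  apply: (@lt_le_trans _ _ (P (~` [set w | (G w <= x)%R]))); last first.
    rewrite cdfE; apply: le_measure; rewrite ?inE//; first exact: measurableC.
    move=> w /= /negP; rewrite -ltNge HG => xG.
    by rewrite (le_trans _ (ltW zfx))// fni// ltW.
  rewrite tail lte_fin ltrBrDr -ltrBrDl -/p.
  (* A rational r between x and a has F(r) <= p, and F(r) is not p. *)
  have [r] := rat_in_itvoo xa; rewrite in_itv/= => /andP[xr ra].
  rewrite -lte_fin fineK ?cdf_fin_num//.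
  apply: (le_lt_trans (cdf_nondecreasing G (ltW xr))).
  rewrite lt_neqAle yQ/= leNgt; apply/negP => /(cdf_inv_le (ltW p0)).
  by rewrite leNgt ra.
have lbS : lbound [set x | (y%:E < cdf H x)%E] (f a).
  move=> z /= yz; rewrite leNgt; apply/negP => /lb h.
  by have := lt_trans h yz; rewrite ltxx.
apply/le_anti/andP; split; last first.
  by apply: lb_le_inf => //; exists (f a + 1) => /=; apply: ub; rewrite ltrDl.
apply/ler_addgt0Pr => e e0; apply: ge_inf; first by exists (f a).
by rewrite /= ub// ltrDl.
Unshelve. all: by end_near. Qed.

(** The excluded values are 0 and the countably many numbers 1 - F(r); the value
    y = 1 is the one given by r = 0, where F vanishes. *)
Lemma ae_not_cdf_rat :
  {ae leb, forall y, y \in `[0, 1] ->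
    [/\ 0 < y, y < 1 & forall r : rat, cdf G (ratr r) != (1 - y)%:E]}.
Proof.
pose B := [set 0 : R] `|` range (fun r : rat => 1 - fine (cdf G (ratr r))).
have cB : countable (range (fun r : rat => 1 - fine (cdf G (ratr r)))).
  exact: card_le_trans (card_image_le _ _) (countableP _).
have BN : leb.-negligible B.
  apply: negligibleU; apply/negligibleP => //.
  - exact: lebesgue_measure_set1.
  - apply: countable_measurable; first by move=> t; exact: measurable_set1.
    exact: cB.
  - exact: countable_lebesgue_measure0.
apply: negligibleS BN => y /= ynot.
apply: contrapT => /not_orP[y0 yr]; apply: ynot; rewrite in_itv/= => /andP[y0' y1].
have {}y0 : y != 0 by apply/eqP.
have yr' (r : rat) : y != 1 - fine (cdf G (ratr r)).
  by apply/eqP => e; apply: yr; exists r.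
split.
- by rewrite lt_neqAle eq_sym y0.
- by have := yr' 0; rewrite raddf0 cdf_positive_le0//= subr0 lt_neqAle => ->.
- move=> r; apply: contra (yr' r) => /eqP ->/=.
  by rewrite opprB addrC subrK.
Qed.

(** The tail hypothesis says that the image of Lebesgue measure on ]0, t] under
    q o v is t times the law of G. *)
Lemma integral_quantile (t : R) (v : R -> R) (k : R -> \bar R) : 0 < t ->
  measurable_fun [set: R] v ->
  (forall a, leb (`]0, t] `&` [set s | a < q (v s)]) = (t * (1 - fine (cdf G a)))%:E) ->
  measurable_fun [set: R] k -> (forall x, (0 <= k x)%E) ->
  (\int[leb]_(s in `]0%R, t]) k (q (v s)) = t%:E * \int[P]_w k (G w))%E.
Proof.
move=> t0 mv tl mk k0.
have mqv : measurable_fun [set: R] (q \o v).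
  by apply: measurableT_comp => //; exact: measurable_cdf_inv.
pose D : set R := `]0, t]%classic.
have mD : measurable D by exact: measurable_itv.
have m1 : measurable_fun [set: R] (\1_D : R -> R) by exact: measurable_indic.
have i0 x : 0 <= (\1_D x : R) by rewrite indicE.
pose m := density_measure leb m1 i0.
have t0' : 0 <= t by exact: ltW.
have mE A : measurable A -> m A = leb (D `&` A).
  by move=> mA; rewrite /m /density_measure integral_indic//= setIC.
have lebD : leb D = t%:E by rewrite /D lebesgue_measure_itv/= lte_fin t0 sube0.
have mT : m setT = t%:E by rewrite mE// setIT.
have sT : mscale (NngNum t0') P setT = t%:E by rewrite /mscale/= probability_setT mule1.
have mtl a : measurable [set s | a < q (v s)].
  rewrite (_ : [set _ | _] = (q \o v) @^-1` `]a, +oo[%classic); last first.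
    by apply/seteqP; split => s /=; rewrite in_itv/= andbT.
  by rewrite -[X in measurable X]setTI; apply: mqv.
have st a : mscale (NngNum t0') P [set w | a < G w] = (t * (1 - fine (cdf G a)))%:E.
  rewrite /mscale/= EFinM; congr (_ * _)%E.
  rewrite (_ : [set w | a < G w] = ~` (G @^-1` `]-oo, a]%classic)); last first.
    by apply/seteqP; split => w /=; rewrite in_itv/= ltNge => /negP.
  rewrite probability_setC; last by rewrite -[X in measurable X]setTI; exact: measurable_funP.
  by rewrite EFinB fineK ?cdf_fin_num.
have law : eq_law m (mscale (NngNum t0') P) (q \o v) G.
  apply: eq_law_tails => //.
  - by have := ltry t; rewrite -mT.
  - exact: (etrans mT (esym sT)).
  - by move=> a; exact: (etrans (mE _ (mtl a)) (etrans (tl a) (esym (st a)))).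
have := ge0_integral_eq_law law mk k0.
rewrite ge0_integral_mscale//=; last exact: measurableT_comp.
move=> <-; rewrite ge0_integral_density//=; last exact: measurableT_comp.
rewrite integral_mkcond; apply: eq_integral => s _.
rewrite patchE indicE -/D; case: ifPn => _; rewrite ?mule1 ?mule0//.
Qed.

Let fcdf01 a : 0 <= fine (cdf G a) <= 1.
Proof. by rewrite -!lee_fin fineK ?cdf_fin_num// cdf_ge0 cdf_le1. Qed.

Let measurable_tail (t a : R) (v : R -> R) : measurable_fun [set: R] v ->
  measurable (`]0, t] `&` [set s | a < q (v s)]).
Proof.
move=> mv; apply: measurableI => //.
rewrite (_ : [set _ | _] = (q \o v) @^-1` `]a, +oo[%classic); last first.
  by apply/seteqP; split => s /=; rewrite in_itv/= andbT.
rewrite -[X in measurable X]setTI; apply: (measurableT_comp measurable_cdf_inv mv) => //.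
Qed.

Lemma lt_cdf_inv a y : 0 <= y < 1 -> fine (cdf G a) < y -> a < q y.
Proof.
move=> /andP[y0 y1]; apply: contraTT; rewrite -!leNgt => /(le_cdf y1).
by rewrite -[X in (_ <= X)%E]fineK ?cdf_fin_num.
Qed.

Lemma cdf_le_of_lt_inv a y : 0 <= y -> a < q y -> fine (cdf G a) <= y.
Proof.
move=> y0; apply: contraTT; rewrite -!leNgt -ltNge => h; apply: cdf_inv_le => //.
by rewrite -[X in (_ < X)%E]fineK ?cdf_fin_num.
Qed.

(** Up to its endpoints, the set where q(s/t) > a is the interval from t F(a)
    to t. *)
Lemma integral_cdf_inv (t : R) (k : R -> \bar R) : 0 < t ->
  measurable_fun [set: R] k -> (forall x, (0 <= k x)%E) ->
  (\int[leb]_(s in `]0%R, t]) k (q (s / t)) = t%:E * \int[P]_w k (G w))%E.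
Proof.
move=> t0 mk k0; have mv : measurable_fun [set: R] (fun s => s / t).
  exact: measurable_funM.
apply: (integral_quantile (v := fun s => s / t)) => // a.
have /andP[f0 f1] := fcdf01 a; set f := fine _ in f0 f1 *.
have -> : t * (1 - f) = t - f * t by ring.
apply: lebesgue_measure_between => //.
- exact: measurable_tail.
- by rewrite -ler_pdivlMr// divff// gt_eqF.
- move=> s /=; rewrite !in_itv/= => /andP[fs st].
  have s0 : 0 < s by rewrite (le_lt_trans _ fs)// mulr_ge0// ltW.
  rewrite s0 (ltW st)//; split => //; apply: lt_cdf_inv; last by rewrite ltr_pdivlMr.
  by rewrite divr_ge0 ?(ltW s0) ?(ltW t0)//= ltr_pdivrMr// mul1r.
- move=> s /=; rewrite !in_itv/= => -[/andP[s0 st] qs]; rewrite st andbT.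
  rewrite -ler_pdivlMr//; apply: cdf_le_of_lt_inv => //.
  by rewrite divr_ge0// ltW.
Qed.

(** Up to its endpoints, the set where q(1 - s/t) > a is the interval from 0 to
    t (1 - F(a)). *)
Lemma integral_cdf_inv_rev (t : R) (k : R -> \bar R) : 0 < t ->
  measurable_fun [set: R] k -> (forall x, (0 <= k x)%E) ->
  (\int[leb]_(s in `]0%R, t]) k (q (1 - s / t)) = t%:E * \int[P]_w k (G w))%E.
Proof.
move=> t0 mk k0; have mv : measurable_fun [set: R] (fun s => 1 - s / t).
  by apply: measurable_funB => //; exact: measurable_funM.
apply: (integral_quantile (v := fun s => 1 - s / t)) => // a.
have /andP[f0 f1] := fcdf01 a; set f := fine _ in f0 f1 *.
have -> : t * (1 - f) = (1 - f) * t - 0 by ring.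
apply: lebesgue_measure_between => //.
- exact: measurable_tail.
- by rewrite mulr_ge0 ?subr_ge0// ltW.
- move=> s /=; rewrite !in_itv/= => /andP[s0 sf].
  have st : s < t by rewrite (lt_le_trans sf)// ger_pMl// gerBl.
  rewrite s0 (ltW st)//; split => //; apply: lt_cdf_inv; last first.
    by rewrite -/f ltrBrDr -ltrBrDl ltr_pdivrMr.
  by rewrite subr_ge0 ler_pdivrMr// mul1r (ltW st)/= ltrBlDr ltrDl divr_gt0.
- move=> s /=; rewrite !in_itv/= => -[/andP[s0 st] qs]; rewrite (ltW s0)/=.
  rewrite -ler_pdivrMr// lerBrDr -lerBrDl; apply: cdf_le_of_lt_inv => //.
  by rewrite subr_ge0 ler_pdivrMr// mul1r.
Qed.

End quantile.

Section quantile_representation.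
Context {R : realType} d (T : measurableType d) (P : probability T R).
Variables (u : R) (G : {RV P >-> R}).
Hypotheses (u_ge0 : 0 <= u) (G0 : {ae P, forall w, 0 < G w}).
Local Notation leb := (@lebesgue_measure R).
Local Notation q := (cdf_inv G).

(** The difference of cross products is (z - x) (cosh^2 u - sinh^2 u) = z -
    x. *)
Lemma sigma_nonincreasing (x z : R) : 0 < x -> x <= z -> sigma u z <= sigma u x.
Proof.
move=> x0 xz; have z0 := lt_le_trans x0 xz.
rewrite /sigma ler_pdivrMr ?affine_gt0// mulrAC ler_pdivlMr ?affine_gt0//.
rewrite -subr_ge0.
have -> : (x * sinh u + cosh u) * (z * cosh u + sinh u) -
    (z * sinh u + cosh u) * (x * cosh u + sinh u) =
    (z - x) * (cosh u ^+ 2 - sinh u ^+ 2) by ring.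
by rewrite cosh2_sinh2 addrK mulr1 subr_ge0.
Qed.

Lemma continuous_sigma (x : R) : 0 < x -> {for x, continuous (sigma u)}.
Proof.
move=> x0; apply: cvgM; first by apply: cvgD; [apply: cvgM; [exact: cvg_id|]|];
  exact: cvg_cst.
apply: cvgV; first by rewrite gt_eqF// affine_gt0.
by apply: cvgD; [apply: cvgM; [exact: cvg_id|]|]; exact: cvg_cst.
Qed.

Lemma cdf_inv_sigma : {ae leb, forall y, y \in `[0, 1] ->
  cdf_inv (sigma u \o G : {RV P >-> R}) y = sigma u (q (1 - y))}.
Proof.
apply: negligibleS (ae_not_cdf_rat G0) => y /= + h; apply => /h[y0 y1 yQ].
apply: (@cdf_inv_antitone _ _ _ _ _ G0 _ (sigma u)) => //.
- exact: sigma_nonincreasing.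
- exact: continuous_sigma.
Qed.

Local Notation tau := (fun x => 1 / sigma u x).

Lemma inv_sigma_ge0 (x : R) : 0 <= x -> 0 <= tau x.
Proof.
move=> x0; have ch0 := ltW (@cosh_gt0 R u); have sh0 := sinh_ge0 u_ge0.
rewrite /= mul1r invr_ge0 /sigma.
by apply: divr_ge0; apply: addr_ge0 => //; exact: mulr_ge0.
Qed.

(** The reciprocal x |-> (x cosh u + sinh u)/(x sinh u + cosh u) is continuous
    at 0 even for u = 0, where sigma itself has a pole; this matters because the
    quantile may vanish at 0. *)
Lemma continuous_inv_sigma (x : R) : 0 <= x -> {for x, continuous tau}.
Proof.
move=> x0; have -> : tau = fun x => (x * cosh u + sinh u) / (x * sinh u + cosh u).
  by apply/funext => z; rewrite /sigma mul1r invf_div.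
apply: cvgM; first by apply: cvgD; [apply: cvgM; [exact: cvg_id|]|]; exact: cvg_cst.
apply: cvgV; first by rewrite gt_eqF// coaffine_gt0.
by apply: cvgD; [apply: cvgM; [exact: cvg_id|]|]; exact: cvg_cst.
Qed.

Lemma measurable_inv_sigma : measurable_fun [set: R] tau.
Proof.
apply: measurable_funM => //; apply: (measurableT_comp measurable_invr).
exact: measurable_sigma.
Qed.

(** The positive part makes the kernel nonnegative on the whole line, as the
    change of variables requires; on the half-line it is the logarithm
    itself. *)
Definition exponent_kernel (l x : R) : \bar R := (Num.max 0 (ln (1 + l * tau x)))%:E.

Lemma exponent_kernelE l x : 0 < l -> 0 <= x ->
  exponent_kernel l x = (ln (1 + l * tau x))%:E.
Proof.
move=> l0 x0; rewrite /exponent_kernel max_r// ln_ge0// lerDl mulr_ge0//.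
  exact: ltW.
exact: inv_sigma_ge0.
Qed.

Lemma measurable_exponent_kernel l : measurable_fun [set: R] (exponent_kernel l).
Proof.
apply/measurable_EFinP; apply: measurable_maxr => //.
apply: measurableT_comp => //; apply: measurable_funD => //.
by apply: measurable_funM => //; exact: measurable_inv_sigma.
Qed.

Lemma psi_sigmaE l : 0 < l ->
  psi P (sigma u \o G) l = (\int[P]_w exponent_kernel l (G w))%E.
Proof.
move=> l0; rewrite psiE//; last first.
  by apply: filterS G0 => w Gw /=; exact: sigma_gt0.
apply: ae_eq_integral => //.
- apply/measurable_EFinP; apply: measurableT_comp => //; apply: measurable_funD => //.
  apply: measurable_funM => //; apply: measurableT_comp measurable_invr _.
  by apply: measurableT_comp => //; exact: measurable_sigma.
- by apply: measurableT_comp => //; exact: measurable_exponent_kernel.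
- apply: filterS G0 => w Gw _; rewrite /= exponent_kernelE ?mul1r//.
  exact: ltW.
Qed.

Section laws.
Variables (t : R).
Hypothesis t0 : 0 < t.
Context d1 (T1 : measurableType d1) (P1 : probability T1 R).
Variable Y : ggc_subordinator P (sigma u \o G) P1.
Context d2 (T2 : measurableType d2) (P2 : probability T2 R) (gam : gamma_process P2).
Local Notation h1 := (fun s => tau (q (1 - s / t))).
Local Notation h2 := (fun s => tau (q (s / t))).

Let mqt : measurable_fun [set: R] h2.
Proof.
apply: measurableT_comp; first exact: measurable_inv_sigma.
apply: measurableT_comp; first exact: measurable_cdf_inv.
exact: measurable_funM.
Qed.

Let mqt1 : measurable_fun [set: R] h1.
Proof.
apply: measurableT_comp; first exact: measurable_inv_sigma.
apply: measurableT_comp; first exact: measurable_cdf_inv.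
by apply: measurable_funB => //; exact: measurable_funM.
Qed.

(** The quantile is right-continuous, and so is s |-> q(s/t). *)
Lemma wiener_law_rising : wiener_law gam t h2.
Proof.
apply: wiener_law_right_continuous => // [s|s /andP[s0 st]].
  by apply: inv_sigma_ge0; exact: cdf_inv_ge0.
apply: (@continuous_cvg _ _ _ _ _ _ (fun x => tau x)).
  by apply: continuous_inv_sigma; exact: cdf_inv_ge0.
have st0 : 0 <= s / t by rewrite divr_ge0// ltW.
have st1 : s / t < 1 by rewrite ltr_pdivrMr// mul1r.
apply: (@increasing_cvg_at_right_comp _ (fun s => s / t) q s +oo%O) => //.
- by move=> a b _ _ ab; rewrite ltr_pM2r ?invr_gt0.
- by apply: cvg_at_right_filter; apply: cvgM; [exact: cvg_id|exact: cvg_cst].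
- exact: cdf_inv_right_continuous.
Qed.

(** The reversal turns right continuity of the quantile into left continuity. *)
Lemma wiener_law_falling : wiener_law gam t h1.
Proof.
apply: wiener_law_left_continuous => // [s|s /andP[s0 st]].
  by apply: inv_sigma_ge0; exact: cdf_inv_ge0.
apply: (@continuous_cvg _ _ _ _ _ _ (fun x => tau x)).
  by apply: continuous_inv_sigma; exact: cdf_inv_ge0.
apply: (@decreasing_cvg_at_left_comp _ (fun s => 1 - s / t) q -oo%O) => //.
- by move=> a b _ _ ab; rewrite ltrD2l ltrN2 ltr_pM2r ?invr_gt0.
- apply: cvg_at_left_filter; apply: cvgB; first exact: cvg_cst.
  by apply: cvgM; [exact: cvg_id|exact: cvg_cst].
- apply: cdf_inv_right_continuous => //.
  + by rewrite subr_ge0 ler_pdivrMr// mul1r.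
  + by rewrite ltrBlDr ltrDl divr_gt0.
Qed.

Let exponent (v : R -> R) (l : R) : 0 < l -> (forall s, 0 <= v s) ->
  (\int[leb]_(s in `]0%R, t]) exponent_kernel l (v s) = t%:E * psi P (sigma u \o G) l)%E ->
  (\int[leb]_(s in `]0%R, t]) (ln (1 + l * tau (v s)))%:E =
   t%:E * psi P (sigma u \o G) l)%E.
Proof.
move=> l0 v0 <-; apply: eq_integral => s _.
by rewrite exponent_kernelE.
Qed.

Lemma exponent_rising l : 0 < l -> (\int[leb]_(s in `]0%R, t]) (ln (1 + l * h2 s))%:E =
  t%:E * psi P (sigma u \o G) l)%E.
Proof.
move=> l0; apply: (exponent l0) => [s|]; first exact: cdf_inv_ge0.
rewrite psi_sigmaE//; apply: integral_cdf_inv => //.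
- exact: measurable_exponent_kernel.
- by move=> x; rewrite lee_fin le_max lexx.
Qed.

Lemma exponent_falling l : 0 < l -> (\int[leb]_(s in `]0%R, t]) (ln (1 + l * h1 s))%:E =
  t%:E * psi P (sigma u \o G) l)%E.
Proof.
move=> l0; apply: (exponent l0) => [s|]; first exact: cdf_inv_ge0.
rewrite psi_sigmaE//; apply: integral_cdf_inv_rev => //.
- exact: measurable_exponent_kernel.
- by move=> x; rewrite lee_fin le_max lexx.
Qed.

(** All three variables have Laplace exponent t psi. *)
Lemma eq_law_quantile_representation :
  eq_law P1 P2 (fun w => (Y t w)%:E) (stieltjes_integral gam h1 t) /\
  eq_law P2 P2 (stieltjes_integral gam h1 t) (stieltjes_integral gam h2 t).
Proof.
have [m1 L1] := wiener_law_falling; have [m2 L2] := wiener_law_rising.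
have h10 s : 0 <= h1 s by apply: inv_sigma_ge0; exact: cdf_inv_ge0.
have h20 s : 0 <= h2 s by apply: inv_sigma_ge0; exact: cdf_inv_ge0.
have I1 w : (0 <= stieltjes_integral gam h1 t w)%E.
  by apply: integral_ge0 => s _; rewrite lee_fin.
have I2 w : (0 <= stieltjes_integral gam h2 t w)%E.
  by apply: integral_ge0 => s _; rewrite lee_fin.
have mY : measurable_fun [set: T1] (fun w => (Y t w)%:E) by exact/measurable_EFinP.
have Y0 w : (0 <= (Y t w)%:E)%E.
  by rewrite lee_fin -(sub_start Y w) sub_nondecreasing// ltW.
have mass d' (T' : measurableType d') (Q : probability T' R) : (Q setT < +oo)%E.
  by rewrite probability_setT ltry.
have Lap (d' : measure_display) (T' : measurableType d') (Q : probability T' R)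
    (S : T' -> \bar R) (S' : T2 -> \bar R) :
    measurable_fun [set: T'] S -> measurable_fun [set: T2] S' ->
    (forall w, (0 <= S w)%E) -> (forall w, (0 <= S' w)%E) ->
    (forall l : R, 0 < l -> (\int[Q]_w expeR (- (l%:E * S w)) =
      \int[P2]_w expeR (- (l%:E * S' w)))%E) -> eq_law Q P2 S S'.
  move=> mS mS' S0 S0' e; split => // A mA.
  apply: laplace_uniqueness => //; first exact: mass.
  exact: etrans (probability_setT Q) (esym (probability_setT P2)).
split.
  apply: (Lap _ _ _ _ _ mY m1 Y0 I1) => l l0.
  rewrite (L1 l l0) (exponent_falling l0).
  have := sub_laplace Y (ltW t0) (ltW l0); rewrite /psi => <-.
  by rewrite unlock; apply: eq_integral => w _; rewrite -EFinM.
apply: (Lap _ _ _ _ _ m1 m2 I1 I2) => l l0.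
transitivity (expeR (- (t%:E * psi P (sigma u \o G) l)))%E.
  by rewrite (L1 l l0) (exponent_falling l0).
by rewrite (L2 l l0) (exponent_rising l0).
Qed.

End laws.
End quantile_representation.

(** * Bessel series *)

Section bessel_series.
Context {R : realType}.
Local Notation leb := (@lebesgue_measure R).

Local Opaque Gamma.

Definition bessel_coef (t : R) (k : nat) : R := (-1) ^+ k / (k`!%:R * Gamma (k%:R + t)).

(** The entire function j_t(y) = sum_k (-y)^k/(k! Gamma(k+t)), that is, the
    Bessel function without its power factor: J_(t-1)(2 z) = z^(t-1)
    j_t(z^2). *)
Definition bessel_series (t y : R) : R := limn (pseries (bessel_coef t) y).

Lemma natrD_gt0 (k : nat) (t : R) : 0 < t -> 0 < k%:R + t.
Proof. by move=> t0; rewrite ltr_wpDl. Qed.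

Lemma norm_bessel_coef t k : 0 < t ->
  `|bessel_coef t k| = (k`!%:R * Gamma (k%:R + t))^-1.
Proof.
move=> t0; rewrite /bessel_coef normrM normrX normrN normr1 expr1n mul1r.
have f0 : 0 < k`!%:R :> R by rewrite ltr0n fact_gt0.
by rewrite ger0_norm// invr_ge0 mulr_ge0// ltW// Gamma_gt0// natrD_gt0.
Qed.

(** The first value is treated apart: Gamma(k+t) is nondecreasing in k only from
    k = 1 on when t < 1. *)
Lemma bounded_invr (g : nat -> R) : (forall k, 0 < g k) ->
  (forall k, g k.+1 <= g k.+2) -> exists2 M : R, 0 < M & forall k, (g k)^-1 <= M.
Proof.
move=> g0 gS; have V k : 0 < (g k)^-1 by rewrite invr_gt0.
exists ((g 0)^-1 + (g 1)^-1) => [|k]; first exact: addr_gt0.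
case: k => [|k]; first by rewrite lerDl ltW.
have g1 : g 1%N <= g k.+1 by elim: k => // k ih; exact: le_trans (gS k).
by apply: ler_wpDl; [exact: ltW|rewrite lef_pV2 ?posrE].
Qed.

Lemma norm_bessel_coef_le t : 0 < t ->
  exists2 M : R, 0 < M & forall k, `|bessel_coef t k| <= M * (k`!%:R)^-1.
Proof.
move=> t0; have [M M0 HM] : exists2 M : R, 0 < M & forall k, (Gamma (k%:R + t))^-1 <= M.
  apply: (@bounded_invr (fun k => Gamma (k%:R + t))) => k.
    by rewrite Gamma_gt0// natrD_gt0.
  have -> : k.+2%:R + t = (k.+1%:R + t) + 1 by rewrite -[k.+2%:R]natr1 addrAC.
  rewrite GammaS ?natrD_gt0// ler_peMl ?(ltW (Gamma_gt0 _)) ?natrD_gt0//.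
  by rewrite -[leLHS]addr0 lerD ?ler1n// ltW.
by exists M => // k; rewrite norm_bessel_coef// invfM mulrC ler_wpM2r.
Qed.

Lemma is_cvg_bessel_norm t (y : R) : 0 < t ->
  cvgn (pseries (fun k => `|bessel_coef t k|) `|y|).
Proof.
move=> t0; have [M M0 HM] := norm_bessel_coef_le t0.
apply: (@series_le_cvg _ _ (fun k => M * exp_coeff `|y| k)).
- by move=> k; rewrite mulr_ge0// exprn_ge0.
- by move=> k; rewrite mulr_ge0// ?(ltW M0)// divr_ge0// exprn_ge0.
- by move=> k; rewrite /exp_coeff/= mulrCA [leLHS]mulrC ler_wpM2l ?exprn_ge0.
- have -> : series (fun k => M * exp_coeff `|y| k) = fun n => M * series (exp_coeff `|y|) n.
    by apply/funext => n; rewrite /series/= mulr_sumr.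
  by apply: is_cvgMr; exact: is_cvg_series_exp_coeff.
Qed.

Lemma is_cvg_bessel t (y : R) : 0 < t -> cvgn (pseries (bessel_coef t) y).
Proof.
move=> t0; apply: normed_cvg.
suff <- : pseries (fun k => `|bessel_coef t k|) `|y| =
    [normed series (fun i => bessel_coef t i * y ^+ i)].
  exact: is_cvg_bessel_norm.
by apply/funext => n; apply: eq_bigr => k _; rewrite /= [RHS]normrM normrX.
Qed.

Lemma bessel_coef_diffs t : 0 < t ->
  pseries_diffs (bessel_coef t) = fun k => - bessel_coef (t + 1) k.
Proof.
move=> t0; apply/funext => k; rewrite /pseries_diffs /bessel_coef factS natrM exprS.
have -> : k.+1%:R + t = k%:R + (t + 1) :> R by rewrite -natr1; ring.
have f0 : k`!%:R != 0 :> R by rewrite pnatr_eq0 -lt0n fact_gt0.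
have G0 : Gamma (k%:R + (t + 1)) != 0.
  by rewrite gt_eqF// Gamma_gt0// natrD_gt0// addr_gt0.
have k0 : k.+1%:R != 0 :> R by rewrite pnatr_eq0.
move: (Gamma _) ((-1) ^+ k) (k.+1%:R : R) (k`!%:R : R) f0 G0 k0 => g s a b b0 g0 a0.
by field; rewrite b0 g0 a0.
Qed.

Lemma pseriesN (c : nat -> R) y : pseries (fun k => - c k) y = fun n => - pseries c y n.
Proof. by apply/funext => n; rewrite /pseries/series/= -sumrN; apply: eq_bigr => k _; rewrite mulNr. Qed.

(** Differentiation of the power series shifts the index: j_t' = - j_(t+1). *)
Lemma is_derive_bessel t (y : R) : 0 < t ->
  is_derive y (1 : R) (bessel_series t) (- bessel_series (t + 1) y).
Proof.
move=> t0; have t1 : 0 < t + 1 by rewrite addr_gt0.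
have t2 : 0 < t + 1 + 1 by rewrite addr_gt0.
have cN s z : 0 < s -> cvgn (pseries (fun k => - bessel_coef s k) z).
  by move=> s0; rewrite pseriesN; apply: is_cvgN; exact: is_cvg_bessel.
have := @pseries_snd_diffs R (bessel_coef t) (`|y| + 1) y.
rewrite bessel_coef_diffs//.
have -> : limn (pseries (fun k => - bessel_coef (t + 1) k) y) = - bessel_series (t + 1) y.
  by rewrite pseriesN; apply: limN; exact: is_cvg_bessel.
apply.
- exact: is_cvg_bessel.
- exact: cN.
- rewrite (_ : pseries_diffs _ = fun k => - - bessel_coef (t + 1 + 1) k); last first.
    apply/funext => k; have := congr1 (@^~ k) (bessel_coef_diffs t1).
    by rewrite /pseries_diffs/= => <-; rewrite mulrN.
  by rewrite pseriesN; apply: is_cvgN; exact: cN.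
- by rewrite [ltRHS]ger0_norm ?addr_ge0// ltrDl.
Qed.

(** The three-term recurrence of Bessel functions, coefficient by coefficient,
    from Gamma(k+t+1) = (k+t) Gamma(k+t). *)
Lemma bessel_series_recurrence t y : 0 < t ->
  bessel_series t y = t * bessel_series (t + 1) y - y * bessel_series (t + 1 + 1) y.
Proof.
move=> t0; have t1 : 0 < t + 1 by rewrite addr_gt0.
have t2 : 0 < t + 1 + 1 by rewrite addr_gt0.
have E n : pseries (bessel_coef t) y n.+1 = t * pseries (bessel_coef (t + 1)) y n.+1 -
    y * pseries (bessel_coef (t + 1 + 1)) y n.
  rewrite /pseries/series/= !mulr_sumr big_nat_recl// [in RHS]big_nat_recl//.
  rewrite -addrA -sumrB; congr (_ + _).
    rewrite /bessel_coef !expr0 !add0r GammaS// !mulr1 !mul1r.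
    by have := Gamma_gt0 t0; move: (Gamma t) => g g0; field; rewrite !gt_eqF.
  apply: eq_bigr => k _; rewrite /bessel_coef.
  have -> : k%:R + (t + 1 + 1) = (k.+1%:R + t) + 1 by rewrite -[k.+1%:R]natr1; ring.
  rewrite addrA GammaS ?natrD_gt0//.
  have kt : k.+1%:R + t != 0 by rewrite gt_eqF// natrD_gt0.
  have g0 : Gamma (k.+1%:R + t) != 0 by rewrite gt_eqF// Gamma_gt0// natrD_gt0.
  have f0 : k`!%:R != 0 :> R by rewrite pnatr_eq0 -lt0n fact_gt0.
  have k0 : k.+1%:R != 0 :> R by rewrite pnatr_eq0.
  rewrite factS natrM !exprS.
  move: kt g0 f0 k0; move: (Gamma (k.+1%:R + t)) ((-1) ^+ k) (k.+1%:R : R) (k`!%:R : R) (y ^+ k).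
  by move=> g s a b z kt g0 b0 a0; field; rewrite kt g0 b0 a0.
have c1 : pseries (bessel_coef t) y n.+1 @[n --> \oo] --> bessel_series t y.
  by rewrite (cvg_shiftS (pseries (bessel_coef t) y)); exact: is_cvg_bessel.
have c2 : pseries (bessel_coef t) y n.+1 @[n --> \oo] -->
    t * bessel_series (t + 1) y - y * bessel_series (t + 1 + 1) y.
  under eq_fun do rewrite E.
  apply: cvgB; (apply: cvgM; first exact: cvg_cst).
    by rewrite (cvg_shiftS (pseries (bessel_coef (t + 1)) y)); exact: is_cvg_bessel.
  exact: is_cvg_bessel.
exact: cvg_unique c1 c2.
Qed.

Lemma continuous_bessel_series t : 0 < t -> continuous (bessel_series t).
Proof. by move=> t0 y; exact: is_derive_continuous (is_derive_bessel y t0). Qed.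

Lemma measurable_bessel_series t : 0 < t -> measurable_fun [set: R] (bessel_series t).
Proof. by move=> t0; apply: continuous_measurable_fun; exact: continuous_bessel_series. Qed.

Lemma bessel_series0 t : 0 < t -> bessel_series t 0 = (Gamma t)^-1.
Proof.
move=> t0; apply/cvg_lim => //; rewrite -(cvg_shiftS (pseries (bessel_coef t) 0)).
apply: (@cvg_trans _ (cst (Gamma t)^-1 @ \oo)); last exact: cvg_cst.
apply: near_eq_cvg; apply: nearW => n /=.
rewrite /pseries/series/= big_nat_recl// big1 ?addr0.
  by rewrite /bessel_coef !expr0 add0r mulr1 !mul1r.
by move=> k _; rewrite exprS mul0r mulr0.
Qed.

Local Opaque bessel_series.

Lemma powR_addr (x a b : R) : 0 < x -> x `^ (a + b) = x `^ a * x `^ b.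
Proof. by move=> x0; rewrite powRD// (gt_eqF x0) implybT. Qed.

Lemma powR_mulr (x a : R) : 0 < x -> x `^ a * x = x `^ (a + 1).
Proof. by move=> x0; rewrite powR_addr// powRr1// ltW. Qed.

Lemma is_derive_mul (f g : R -> R) (df dg y : R) :
  is_derive y (1 : R) f df -> is_derive y (1 : R) g dg ->
  is_derive y (1 : R) (fun z => f z * g z) (df * g y + f y * dg).
Proof.
move=> hf hg; apply: (is_derive_eq (is_deriveM hf hg)).
by rewrite /GRing.scale/= addrC mulrC.
Qed.

Lemma is_derive_energy (f g : R -> R) (df dg y : R) :
  is_derive y (1 : R) f df -> is_derive y (1 : R) g dg ->
  is_derive y (1 : R) (fun z => f z ^+ 2 + z * g z ^+ 2)
    (2 * (f y * df) + g y ^+ 2 + 2 * (y * (g y * dg))).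
Proof.
move=> hf hg.
have -> : (fun z => f z ^+ 2 + z * g z ^+ 2) =
    (fun z => f z * f z) + (fun z => z * (g z * g z)) by [].
apply: (is_derive_eq (is_deriveD (is_derive_mul hf hf)
  (is_derive_mul (is_derive_id y (1 : R)) (is_derive_mul hg hg)))).
by ring.
Qed.

(** Its derivative is (1 - 2 t) j_(t+1)^2: by the recurrence,
    j_t = t j_(t+1) + y j_(t+1)', which cancels all mixed terms. *)
Definition bessel_energy t y : R :=
  bessel_series t y ^+ 2 + y * bessel_series (t + 1) y ^+ 2.

Lemma is_derive_bessel_energy t y : 0 < t ->
  is_derive y (1 : R) (bessel_energy t) ((1 - 2 * t) * bessel_series (t + 1) y ^+ 2).
Proof.
move=> t0; have t1 : 0 < t + 1 by rewrite addr_gt0.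
have d0 := is_derive_bessel y t0; have d1 := is_derive_bessel y t1.
have rec := bessel_series_recurrence y t0.
apply: (is_derive_eq (is_derive_energy d0 d1)); rewrite rec.
by move: (bessel_series (t + 1) y) (bessel_series (t + 1 + 1) y) => a b; ring.
Qed.

(** For t >= 1/2 the energy is nonincreasing, so j_t^2 is at most its value
    at 0. *)
Lemma bessel_series_bounded t y : 1 / 2 <= t -> 0 <= y ->
  `|bessel_series t y| <= (Gamma t)^-1.
Proof.
move=> t12 y0; have t0 : 0 < t by rewrite (lt_le_trans _ t12).
have mono : bessel_energy t y <= bessel_energy t 0.
  apply: (@ler0_derive1_nincry _ (bessel_energy t) 0) => // [x _|x _|].
  - by have [] := is_derive_bessel_energy x t0.
  - rewrite derive1E; have [_ ->] := is_derive_bessel_energy x t0.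
    by rewrite mulr_le0_ge0 ?sqr_ge0//; lra.
  - by apply: continuous_subspaceT => x; exact: is_derive_continuous (is_derive_bessel_energy x t0).
have Gt := Gamma_gt0 t0; have iGt : 0 <= (Gamma t)^-1 by rewrite invr_ge0 (ltW Gt).
rewrite -(ler_sqr (normr_ge0 _) iGt) real_normK ?num_real//.
rewrite -bessel_series0//; move: mono; rewrite /bessel_energy mul0r addr0.
by apply: le_trans; rewrite lerDl mulr_ge0// sqr_ge0.
Qed.

(** The mean value theorem, as the derivative - j_(t+1) is bounded for every
    t > 0. *)
Lemma bessel_series_le_affine t : 0 < t ->
  exists2 C : R, 0 <= C & forall y, 0 <= y -> `|bessel_series t y| <= C * (1 + y).
Proof.
move=> t0; have t1 : 0 < t + 1 by rewrite addr_gt0.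
have [a a0 ja] : exists2 a : R, 0 <= a & bessel_series t 0 = a.
  by exists (Gamma t)^-1; [rewrite invr_ge0 (ltW (Gamma_gt0 t0))|exact: bessel_series0].
have [b b0 jb] : exists2 b : R, 0 <= b & forall z, 0 <= z -> `|bessel_series (t + 1) z| <= b.
  exists (Gamma (t + 1))^-1; first by rewrite invr_ge0 (ltW (Gamma_gt0 t1)).
  by move=> z z0; apply: bessel_series_bounded; [lra|exact: z0].
exists (a + b) => [|y y0]; first exact: addr_ge0.
have [z zy e] : exists2 z, z \in `[0, y] & bessel_series t y - bessel_series t 0 =
    - bessel_series (t + 1) z * (y - 0).
  apply: MVT_segment => // [x _|]; first exact: is_derive_bessel.
  exact/continuous_subspaceT/continuous_bessel_series.
have z0 : 0 <= z by move: zy; rewrite in_itv/= => /andP[].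
have -> : bessel_series t y = a - bessel_series (t + 1) z * y.
  by rewrite -ja -[LHS](subrK (bessel_series t 0)) e subr0 mulNr addrC.
apply: (le_trans (ler_normB _ _)); rewrite normrM (ger0_norm a0) (ger0_norm y0).
have : `|bessel_series (t + 1) z| * y <= b * y by rewrite ler_wpM2r// jb.
by move: (_ * y) => w; nra.
Qed.

(** For t < 1/2 the energy increases, but W(y) = y^(2t-1) (j_t^2 + y j_(t+1)^2)
    has derivative (2t-1) y^(2t-2) j_t^2 <= 0, and W dominates (y^t j_(t+1))^2.
    The weight is singular at 0, so W is compared with W(1) on [1, +oo[ while on
    ]0, 1] both factors are bounded. *)
Lemma bessel_primitive_bounded t : 0 < t -> t < 1 / 2 ->
  exists2 C : R, 0 <= C & forall y, 0 < y -> `|y `^ t * bessel_series (t + 1) y| <= C.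
Proof.
move=> t0 t12; have t1 : 0 < t + 1 by rewrite addr_gt0.
have iGt1 : 0 <= (Gamma (t + 1))^-1 by rewrite invr_ge0 ltW// Gamma_gt0.
pose W y := y `^ (2 * t - 1) * bessel_energy t y.
have dW (y : R) : 0 < y -> is_derive y (1 : R) W
    ((2 * t - 1) * y `^ (2 * t - 2) * bessel_series t y ^+ 2).
  move=> y0; apply: (is_derive_eq (is_derive_mul (is_derive1_powR (2 * t - 1) y0)
    (is_derive_bessel_energy y t0))); rewrite /bessel_energy.
  have -> : 2 * t - 1 - 1 = 2 * t - 2 by ring.
  have -> : y `^ (2 * t - 1) = y `^ (2 * t - 2) * y.
    by rewrite powR_mulr//; congr (_ `^ _); ring.
  by move: (_ `^ _) (bessel_series t y) (bessel_series (t + 1) y) => p a b; ring.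
have mono y : 1 <= y -> W y <= W 1.
  move=> y1; apply: (@ler0_derive1_nincry _ W 1) => // [x|x|].
  - by rewrite in_itv/= andbT => x1; have [] := dW x (lt_trans ltr01 x1).
  - rewrite in_itv/= andbT => x1; rewrite derive1E; have [_ ->] := dW x (lt_trans ltr01 x1).
    by rewrite mulr_le0_ge0 ?sqr_ge0// mulr_le0_ge0 ?powR_ge0//; lra.
  - apply: continuous_in_subspaceT => x; rewrite inE/= in_itv/= andbT => x1.
    exact: is_derive_continuous (dW x (lt_le_trans ltr01 x1)).
exists (Num.sqrt (W 1) + (Gamma (t + 1))^-1) => [|y y0]; first by rewrite addr_ge0 ?sqrtr_ge0.
have [y1|y1] := leP y 1.
  apply: (@le_trans _ _ (Gamma (t + 1))^-1); last by rewrite lerDr sqrtr_ge0.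
  rewrite normrM ger0_norm ?powR_ge0// -[leRHS]mul1r ler_pM ?powR_ge0//.
    have <- : 1 `^ t = 1 :> R by rewrite powR1.
    by rewrite ge0_ler_powR ?nnegrE ?(ltW t0) ?(ltW y0).
  by apply: bessel_series_bounded; [lra|exact: ltW].
apply: (@le_trans _ _ (Num.sqrt (W 1))); last by rewrite lerDl.
rewrite -sqrtr_sqr; apply: ler_wsqrtr.
apply: (le_trans _ (mono _ (ltW y1))); rewrite /W /bessel_energy mulrDr.
apply: ler_wpDl; first by rewrite mulr_ge0 ?powR_ge0 ?sqr_ge0.
rewrite exprMn mulrA ler_wpM2r ?sqr_ge0//.
rewrite powR_mulr//.
have -> : 2 * t - 1 + 1 = t + t by ring.
by rewrite powR_addr// expr2.
Qed.

Section laplace_transform.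
Variables t b y : R.
Hypotheses (t0 : 0 < t) (b0 : 0 < b) (y0 : 0 <= y).

Let pos : set R := `]0, +oo[%classic.
Let mpos : measurable pos. Proof. exact: measurable_itv. Qed.

Let posE g : pos g -> 0 < g. Proof. by rewrite /pos/= in_itv/= andbT. Qed.

(** The coefficient is a parameter because the series is integrated both with
    its signs and in absolute value. *)
Let term (a : R) (k : nat) (g : R) : R := gamma_kernel t b g * (a * (y * g) ^+ k).

Let termE a k g : 0 < g -> term a k g = a * y ^+ k * gamma_kernel (k%:R + t) b g.
Proof.
move=> g0; rewrite /term /gamma_kernel exprMn -(powR_mulrn k (ltW g0)).
rewrite [in RHS](_ : k%:R + t - 1 = (t - 1) + k%:R); last by ring.
rewrite (powR_addr (t - 1))//.
by move: (_ `^ (t - 1)) (_ `^ k%:R) (expR _) => p q e; ring.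
Qed.

Let integrable_term a k : leb.-integrable pos (EFin \o term a k).
Proof.
apply: (@eq_integrable _ _ _ leb pos mpos
    (fun g => (a * y ^+ k)%:E * (gamma_kernel (k%:R + t) b g)%:E)%E).
  by move=> g /set_mem/posE g0; rewrite /= termE.
by apply: integrableZl => //; apply: integrable_gamma_kernel => //; exact: natrD_gt0.
Qed.

Let integral_term a k : (\int[leb]_(g in pos) (term a k g)%:E =
  (a * y ^+ k * (Gamma (k%:R + t) * b `^ (- (k%:R + t))))%:E)%E.
Proof.
have -> : (\int[leb]_(g in pos) (term a k g)%:E =
    \int[leb]_(g in pos) ((a * y ^+ k)%:E * (gamma_kernel (k%:R + t) b g)%:E))%E.
  by apply: eq_integral => g /set_mem/posE g0; rewrite /= termE.
have kt : 0 < k%:R + t by exact: natrD_gt0.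
by rewrite integralZl ?integral_gamma_kernel//; exact: integrable_gamma_kernel.
Qed.

Let powRN_nat k : b `^ (- (k%:R + t)) = b `^ (- t) * (b ^+ k)^-1.
Proof. by rewrite opprD addrC powR_addr// [X in _ * X]powRN powR_mulrn// ltW. Qed.

Let integral_coef k : (\int[leb]_(g in pos) (term (bessel_coef t k) k g)%:E =
  (b `^ (- t) * exp_coeff (- (y / b)) k)%:E)%E.
Proof.
rewrite integral_term powRN_nat /bessel_coef /exp_coeff/=; congr EFin.
have -> : (- (y / b)) ^+ k = (-1) ^+ k * y ^+ k * (b ^+ k)^-1.
  by rewrite (exprNn (y / b)) (exprMn k y) exprVn mulrA.
have G0 : Gamma (k%:R + t) != 0 by rewrite gt_eqF// Gamma_gt0// natrD_gt0.
have f0 : k`!%:R != 0 :> R by rewrite pnatr_eq0 -lt0n fact_gt0.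
move: G0 f0; move: (Gamma _) (k`!%:R : R) ((-1) ^+ k) (y ^+ k) (b ^+ k)^-1 (b `^ _).
by move=> g f s z v p g0 f0; field; rewrite g0 f0.
Qed.

Let integral_norm_coef k : (\int[leb]_(g in pos) (term `|bessel_coef t k| k g)%:E =
  (b `^ (- t) * exp_coeff (y / b) k)%:E)%E.
Proof.
rewrite integral_term powRN_nat norm_bessel_coef// /exp_coeff/=; congr EFin.
rewrite [(y / b) ^+ k]exprMn exprVn.
have G0 : Gamma (k%:R + t) != 0 by rewrite gt_eqF// Gamma_gt0// natrD_gt0.
have f0 : k`!%:R != 0 :> R by rewrite pnatr_eq0 -lt0n fact_gt0.
move: G0 f0; move: (Gamma _) (k`!%:R : R) (y ^+ k) (b ^+ k)^-1 (b `^ _).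
by move=> g f z v p g0 f0; field; rewrite g0 f0.
Qed.

Let majorant g := gamma_kernel t b g * limn (pseries (fun k => `|bessel_coef t k|) (y * g)).

Let term_ge0 k g : pos g -> 0 <= term `|bessel_coef t k| k g.
Proof.
move=> /posE g0; rewrite mulr_ge0 ?gamma_kernel_ge0// mulr_ge0//.
by rewrite exprn_ge0// mulr_ge0// ltW.
Qed.

Let termE_ge0 k g : pos g -> (0 <= (term `|bessel_coef t k| k g)%:E)%E.
Proof. by move=> gp; rewrite lee_fin; exact: term_ge0. Qed.

Let cvg_norm_partial g : pos g ->
  gamma_kernel t b g * pseries (fun k => `|bessel_coef t k|) (y * g) n @[n --> \oo] --> majorant g.
Proof.
move=> /posE g0; apply: cvgM; first exact: cvg_cst.
have yg : 0 <= y * g by rewrite mulr_ge0// ltW.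
by have := is_cvg_bessel_norm (y := y * g) t0; rewrite (ger0_norm yg).
Qed.

Let majorantE g : pos g ->
  (majorant g)%:E = (\sum_(k <oo) (term `|bessel_coef t k| k g)%:E)%E.
Proof.
move=> gp; apply/esym/cvg_lim => //.
have c : (gamma_kernel t b g * pseries (fun k => `|bessel_coef t k|) (y * g) n)%:E
    @[n --> \oo] --> (majorant g)%:E.
  by apply: cvg_EFin; [near=> n|exact: cvg_norm_partial].
apply: cvg_trans c; apply: near_eq_cvg; apply: nearW => n.
by rewrite sumEFin /pseries/series/= mulr_sumr.
Unshelve. all: by end_near. Qed.

Let mterm a k : measurable_fun pos (fun g => (term a k g)%:E).
Proof. by have /integrableP[] := integrable_term a k. Qed.

(** Termwise integration of the series of absolute values gives b^(-t)
    e^(y/b). *)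
Let integrable_majorant : leb.-integrable pos (EFin \o majorant).
Proof.
apply: (@eq_integrable _ _ _ leb pos mpos
    (fun g => (\sum_(k <oo) (term `|bessel_coef t k| k g)%:E)%E)).
  by move=> g /set_mem gp; rewrite /= majorantE.
apply/integrableP; split.
  apply: ge0_emeasurable_sum => [k g|k].
    by move=> gp _; exact: termE_ge0.
  by move=> _; exact: mterm.
have -> : (\int[leb]_(g in pos) `|\sum_(k <oo) (term `|bessel_coef t k|%R k g)%:E| =
    \int[leb]_(g in pos) \sum_(k <oo) (term `|bessel_coef t k|%R k g)%:E)%E.
  apply: eq_integral => g /set_mem gp; rewrite gee0_abs//.
  by apply: nneseries_ge0 => k _ _; exact: termE_ge0.
have nn := @integral_nneseries _ _ _ leb pos mpos
  (fun k g => (term `|bessel_coef t k| k g)%:E) (fun k => @mterm _ k) termE_ge0.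
rewrite nn.
have -> : (\sum_(k <oo) \int[leb]_(g in pos) (term `|bessel_coef t k|%R k g)%:E =
    (b `^ (- t) * expR (y / b))%:E)%E.
  apply/cvg_lim => //.
  have c : (b `^ (- t) * series (exp_coeff (y / b)) n)%:E @[n --> \oo] -->
      (b `^ (- t) * expR (y / b))%:E.
    apply: cvg_EFin; first by near=> n.
    by apply: cvgM; [exact: cvg_cst|exact: is_cvg_series_exp_coeff].
  apply: cvg_trans c; apply: near_eq_cvg; apply: nearW => n.
  under [RHS]eq_bigr do rewrite integral_norm_coef.
  by rewrite sumEFin /series/= mulr_sumr.
by rewrite ltry.
Unshelve. all: by end_near. Qed.

Let partial n g := gamma_kernel t b g * pseries (bessel_coef t) (y * g) n.

Let partialE n g : (partial n g)%:E = (\sum_(0 <= k < n) (term (bessel_coef t k) k g)%:E)%E.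
Proof. by rewrite sumEFin /partial /pseries/series/= mulr_sumr. Qed.

Let partial_le n g : pos g -> `|partial n g| <= majorant g.
Proof.
move=> gp; have g0 := posE gp.
rewrite normrM (ger0_norm (gamma_kernel_ge0 _ _ _)) ler_wpM2l ?gamma_kernel_ge0//.
apply: (@le_trans _ _ (pseries (fun k => `|bessel_coef t k|) (y * g) n)).
  rewrite /pseries/series/=; apply: (le_trans (ler_norm_sum _ _ _)).
  apply: ler_sum => k _; rewrite normrM normrX (@ger0_norm _ (y * g))//.
  by rewrite mulr_ge0// ltW.
have yg : 0 <= y * g by rewrite mulr_ge0// ltW.
apply: nondecreasing_cvgn_le.
  apply/nondecreasing_seqP => k; rewrite /pseries/series/= big_nat_recr//= lerDl.
  by rewrite mulr_ge0// exprn_ge0.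
by have := is_cvg_bessel_norm (y := y * g) t0; rewrite (ger0_norm yg).
Qed.

Lemma integrable_gamma_bessel :
  leb.-integrable pos (EFin \o (fun g => gamma_kernel t b g * bessel_series t (y * g))).
Proof.
apply: (@le_integrable _ _ _ leb pos mpos _ (EFin \o majorant) _ _ integrable_majorant).
  have mj : measurable_fun [set: R] (fun g => gamma_kernel t b g * bessel_series t (y * g)).
    apply: measurable_funM; first exact: measurable_gamma_kernel.
    apply: measurableT_comp; last exact: measurable_funM.
    exact: measurable_bessel_series.
  by apply/measurable_EFinP; exact: measurable_funTS mj.
move=> g gp; rewrite lee_fin.
have m0 : 0 <= majorant g by exact: le_trans (normr_ge0 _) (partial_le 0 gp).
rewrite (ger0_norm m0).
have c : `|partial n g| @[n --> \oo] --> `|gamma_kernel t b g * bessel_series t (y * g)|.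
  apply: cvg_norm; apply: cvgM; first exact: cvg_cst.
  exact: is_cvg_bessel.
by apply: (cvgr_to_le c); apply: nearW => n; exact: partial_le.
Qed.

(** Integrating g^(k+t-1) e^(-b g) produces Gamma(k+t) b^(-k-t), which cancels
    the gamma factor of the coefficient and leaves the exponential series
    of - y/b. *)
Lemma integral_gamma_bessel :
  (\int[leb]_(g in `]0%R, +oo[) (gamma_kernel t b g * bessel_series t (y * g))%:E =
   (b `^ (- t) * expR (- (y / b)))%:E)%E.
Proof.
have c1 : (\int[leb]_(g in pos) (partial n g)%:E)%E @[n --> \oo] -->
    (\int[leb]_(g in pos) (gamma_kernel t b g * bessel_series t (y * g))%:E)%E.
  apply: (@dominated_cvg _ _ _ leb pos mpos _ _ (EFin \o majorant)) => //.
  - move=> n; under eq_fun do rewrite partialE.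
    by apply: emeasurable_sum => k; exact: mterm.
  - move=> g gp; apply: cvg_EFin; first by near=> n.
    apply: cvgM; first exact: cvg_cst.
    exact: is_cvg_bessel.
have c2 : (\int[leb]_(g in pos) (partial n g)%:E)%E @[n --> \oo] -->
    (b `^ (- t) * expR (- (y / b)))%:E.
  have c : (b `^ (- t) * series (exp_coeff (- (y / b))) n)%:E @[n --> \oo] -->
      (b `^ (- t) * expR (- (y / b)))%:E.
    apply: cvg_EFin; first by near=> n.
    by apply: cvgM; [exact: cvg_cst|exact: is_cvg_series_exp_coeff].
  apply: cvg_trans c; apply: near_eq_cvg; apply: nearW => n.
  have -> : (\int[leb]_(g in pos) (partial n g)%:E =
      \int[leb]_(g in pos) \sum_(0 <= k < n) (term (bessel_coef t k) k g)%:E)%E.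
    by apply: eq_integral => g _; rewrite partialE.
  rewrite integral_sum//; last by move=> k; exact: integrable_term.
  under [RHS]eq_bigr do rewrite integral_coef.
  by rewrite sumEFin /series/= mulr_sumr.
exact: cvg_unique c1 c2.
Unshelve. all: by end_near. Qed.

End laplace_transform.

Lemma le_integral_ray (f : R -> R) (h : R -> R) (M : R) :
  measurable_fun [set: R] f -> measurable_fun [set: R] h ->
  (forall g, 0 < g -> `|f g| <= h g) ->
  (`|\int[leb]_(g in `]0%R, M]) (f g)%:E| <= \int[leb]_(g in `]0%R, +oo[) (h g)%:E)%E.
Proof.
move=> mf mh fh.
have mfE : measurable_fun [set: R] (EFin \o f) by exact/measurable_EFinP.
have mhE : measurable_fun [set: R] (EFin \o h) by exact/measurable_EFinP.
have pos (g : R) : (`]0, M]%classic : set R) g -> 0 < g by rewrite /= in_itv/= => /andP[].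
apply: (le_trans (le_abse_integral _ _ _)) => //; first exact: measurable_funTS mfE.
apply: (@le_trans _ _ (\int[leb]_(g in `]0%R, M]) (h g)%:E)%E).
  apply: ge0_le_integral => //.
  - by apply: measurableT_comp => //; exact: measurable_funTS mfE.
  - exact: measurable_funTS mhE.
  - by move=> g /pos g0; rewrite lee_fin fh.
apply: ge0_subset_integral => //; first exact: measurable_funTS mhE.
- move=> g; rewrite /= in_itv/= andbT => g0.
  by rewrite lee_fin (le_trans (normr_ge0 _) (fh g g0)).
- by move=> g /pos; rewrite /= in_itv/= andbT.
Qed.

Lemma gamma_kernel_decr (t b g : R) : 1 <= b -> 0 < g -> gamma_kernel t b g <= gamma_kernel t 1 g.
Proof.
move=> b1 g0; rewrite ler_wpM2l ?powR_ge0// ler_expR lerN2 ler_wpM2r//.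
exact: ltW.
Qed.

Lemma measurable_gamma_bessel t s b y : 0 < s ->
  measurable_fun [set: R] (fun g => gamma_kernel t b g * bessel_series s (y * g)).
Proof.
move=> s0; apply: measurable_funM; first exact: measurable_gamma_kernel.
by apply: measurableT_comp; [exact: measurable_bessel_series|exact: measurable_funM].
Qed.

Lemma integral_scaled_gamma (c a b : R) : 0 < a -> 0 < b ->
  (\int[leb]_(g in `]0%R, +oo[) (c * gamma_kernel a b g)%:E = (c * (Gamma a * b `^ (- a)))%:E)%E.
Proof.
move=> a0 b0; have i := integrable_gamma_kernel a0 b0.
rewrite EFinM -integral_gamma_kernel// -integralZl//.
Qed.

Lemma gamma_bessel_bound_high t b y M : 1 / 2 <= t -> 1 <= b -> 0 <= y ->
  (`|\int[leb]_(g in `]0%R, M]) (gamma_kernel t b g * bessel_series t (y * g))%:E| <= 1%:E)%E.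
Proof.
move=> t12 b1 y0; have t0 : 0 < t by lra.
apply: (le_trans (@le_integral_ray _ (fun g => (Gamma t)^-1 * gamma_kernel t 1 g) _ _ _ _)).
- exact: measurable_gamma_bessel.
- by apply: measurable_funM => //; exact: measurable_gamma_kernel.
- move=> g g0; rewrite normrM (ger0_norm (gamma_kernel_ge0 _ _ _)) mulrC.
  apply: ler_pM; rewrite ?gamma_kernel_ge0//; last exact: gamma_kernel_decr.
  by apply: bessel_series_bounded => //; rewrite mulr_ge0// ltW.
rewrite integral_scaled_gamma// powR1 mulr1 mulVf// gt_eqF//; exact: Gamma_gt0.
Qed.

(** For y <= 1 the affine bound on j_t is integrable against the kernel,
    uniformly in y. *)
Lemma gamma_bessel_bound_small t : 0 < t -> exists2 C : R, 0 <= C &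
  forall b y M, 1 <= b -> 0 <= y -> y <= 1 ->
  (`|\int[leb]_(g in `]0%R, M]) (gamma_kernel t b g * bessel_series t (y * g))%:E| <= C%:E)%E.
Proof.
move=> t0; have [C C0 HC] := bessel_series_le_affine t0.
have t1 : 0 < t + 1 by rewrite addr_gt0.
exists (C * (Gamma t * 1 `^ (- t)) + C * (Gamma (t + 1) * 1 `^ (- (t + 1)))).
  by rewrite addr_ge0// mulr_ge0// mulr_ge0 ?powR_ge0//; apply/ltW/Gamma_gt0.
move=> b y M b1 y0 y1.
pose h g := C * gamma_kernel t 1 g + C * gamma_kernel (t + 1) 1 g.
have mk a : measurable_fun [set: R] (fun g => C * gamma_kernel a 1 g).
  by apply: measurable_funM => //; exact: measurable_gamma_kernel.
have mkE a : measurable_fun [set: R] (EFin \o (fun g => C * gamma_kernel a 1 g)).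
  exact/measurable_EFinP.
apply: (le_trans (@le_integral_ray _ h _ _ _ _)).
- exact: measurable_gamma_bessel.
- exact: measurable_funD.
- move=> g g0; rewrite normrM (ger0_norm (gamma_kernel_ge0 _ _ _)).
  have yg : 0 <= y * g by rewrite mulr_ge0// ltW.
  apply: (@le_trans _ _ (gamma_kernel t 1 g * (C * (1 + g)))).
    apply: ler_pM; rewrite ?gamma_kernel_ge0//; first exact: gamma_kernel_decr.
    by apply: (le_trans (HC _ yg)); rewrite ler_wpM2l// lerD2l ler_piMl// ltW.
  rewrite /h {3}/gamma_kernel.
  have -> : t + 1 - 1 = (t - 1) + 1 by ring.
  rewrite -(powR_mulr _ g0) /gamma_kernel le_eqVlt; apply/orP; left; apply/eqP.
  by move: (_ `^ _) (expR _) => p e; ring.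
have -> : (\int[leb]_(g in `]0%R, +oo[) (h g)%:E =
    \int[leb]_(g in `]0%R, +oo[) ((C * gamma_kernel t 1 g)%:E + (C * gamma_kernel (t + 1) 1 g)%:E))%E.
  by apply: eq_integral => g _; rewrite -EFinD.
rewrite ge0_integralD//=.
- by rewrite !integral_scaled_gamma// -EFinD.
- by move=> g _; rewrite lee_fin mulr_ge0// gamma_kernel_ge0.
- exact: measurable_funTS (mkE t).
- by move=> g _; rewrite lee_fin mulr_ge0// gamma_kernel_ge0.
- exact: measurable_funTS (mkE (t + 1)).
Qed.

(** Integration by parts with K(g) = g^t j_(t+1)(y g), a primitive of
    g^(t-1) j_t(y g). As y >= 1, the bound on y^t g^t j_(t+1)(y g) passes to K,
    and both the boundary term and b times the integral of e^(-b g) K are at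
    most that bound. *)
Lemma gamma_bessel_bound_large t : 0 < t -> t < 1 / 2 -> exists2 C : R, 0 <= C &
  forall b y M, 1 <= b -> 1 <= y -> 0 < M ->
  (`|\int[leb]_(g in `]0%R, M]) (gamma_kernel t b g * bessel_series t (y * g))%:E| <= C%:E)%E.
Proof.
move=> t0 t12; have [C C0 HC] := bessel_primitive_bounded t0 t12.
have t1 : 0 < t + 1 by rewrite addr_gt0.
exists (C + C) => [|b y M b1 y1 M0]; first exact: addr_ge0.
have b0 := lt_le_trans ltr01 b1; have y0 := lt_le_trans ltr01 y1.
pose K g := g `^ t * bessel_series (t + 1) (y * g).
have KC g : 0 < g -> `|K g| <= C.
  move=> g0; have yg : 0 < y * g by rewrite mulr_gt0.
  apply: le_trans (HC _ yg); rewrite /K !normrM ler_wpM2r// !ger0_norm ?powR_ge0//.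
  by rewrite ge0_ler_powR ?nnegrE ?(ltW t0) ?(ltW g0) ?(ltW yg)// ler_peMl// ltW.
pose f1 g := gamma_kernel t b g * bessel_series t (y * g).
pose f2 g := gamma_kernel (t + 1) b g * bessel_series (t + 1) (y * g).
have f2E g : f2 g = expR (- (b * g)) * K g.
  by rewrite /f2 /K /gamma_kernel addrK mulrAC mulrC.
have dexp (c g : R) : is_derive g (1 : R) (fun g => expR (c * g)) (c * expR (c * g)).
  have h : is_derive g (1 : R) (fun g => c * g) c.
    by apply: is_derive_eq; rewrite /GRing.scale/= !mulr1.
  by apply: is_derive_eq; rewrite /GRing.scale/= mulrC.
have dK (g : R) : 0 < g -> is_derive g (1 : R) K (g `^ (t - 1) * bessel_series t (y * g)).
  move=> g0.
  have h : is_derive g (1 : R) (fun g => bessel_series (t + 1) (y * g))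
      (- bessel_series (t + 1 + 1) (y * g) * y).
    have hy : is_derive g (1 : R) (fun g => y * g) y.
      by apply: is_derive_eq; rewrite /GRing.scale/= !mulr1.
    have := @is_derive1_comp _ (bessel_series (t + 1)) (fun g => y * g) g _ _
      (is_derive_bessel (y * g) t1) hy.
    exact.
  apply: (is_derive_eq (is_derive_mul (is_derive1_powR t g0) h)).
  rewrite (bessel_series_recurrence (y * g) t0).
  have -> : g `^ t = g `^ (t - 1) * g by rewrite powR_mulr// subrK.
  move: (_ `^ _) (bessel_series (t + 1) (y * g)) (bessel_series (t + 1 + 1) (y * g)).
  by move=> p v w; ring.
pose f g := f1 g - b * f2 g; pose F g := expR (- b * g) * K g.
have dF (g : R) : 0 < g -> is_derive g (1 : R) F (f g).
  move=> g0; apply: (is_derive_eq (is_derive_mul (dexp (- b) g) (dK g g0))).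
  rewrite /f f2E /f1 /gamma_kernel !mulNr.
  by move: (_ `^ _) (bessel_series _ _) (expR _) (K g) => p u e k; ring.
have cF g : 0 < g -> {for g, continuous f}.
  move=> g0; have cj s : 0 < s -> {for g, continuous (fun g => bessel_series s (y * g))}.
    move=> s0; apply: continuous_comp; last exact: continuous_bessel_series.
    by apply: cvgM; [exact: cvg_cst|exact: cvg_id].
  apply: cvgB; first by apply: cvgM; [exact: continuous_gamma_kernel|exact: cj].
  apply: cvgM; first exact: cvg_cst.
  by apply: cvgM; [exact: continuous_gamma_kernel|exact: cj].
have F0 : F g @[g --> 0^'+] --> 0.
  rewrite -[X in _ --> X](mulr0 (expR (- b * 0))); apply: cvgM.
    by apply: cvg_at_right_filter; exact: is_derive_continuous (dexp (- b) 0).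
  rewrite -[X in _ --> X](mul0r (bessel_series (t + 1) (y * 0))).
  apply: cvgM; first exact: powR_cvg0.
  apply: cvg_at_right_filter; apply: continuous_comp; last exact: continuous_bessel_series.
  by apply: cvgM; [exact: cvg_cst|exact: cvg_id].
have sub : `]0, M]%classic `<=` (`]0, +oo[%classic : set R).
  by move=> g; rewrite /= !in_itv/= => /andP[->].
have i1 : leb.-integrable `]0, M] (EFin \o f1).
  exact: (@integrableS _ _ _ leb _ _ _ (measurable_itv _) (measurable_itv _) sub
    (integrable_gamma_bessel t0 b0 (ltW y0))).
have i2' : leb.-integrable `]0, M] (EFin \o f2).
  exact: (@integrableS _ _ _ leb _ _ _ (measurable_itv _) (measurable_itv _) sub
    (integrable_gamma_bessel t1 b0 (ltW y0))).
have i2 := @integrableZl _ _ _ leb _ (measurable_itv `]0, M]) b _ i2'.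
have fi : leb.-integrable `]0, M] (EFin \o f) by exact: integrableB i1 i2.
have -> : (\int[leb]_(g in `]0%R, M]) (f1 g)%:E =
    \int[leb]_(g in `]0%R, M]) ((EFin \o f) g + b%:E * (EFin \o f2) g))%E.
  by apply: eq_integral => g _; rewrite /= -EFinM -EFinD subrK.
rewrite integralD//= (integral_FTC_0M M0 dF cF F0 fi) subr0 EFinD.
apply: (le_trans (lee_abs_add _ _)); apply: leeD.
  rewrite lee_fin normrM (ger0_norm (expR_ge0 _)) -[leRHS]mul1r ler_pM ?expR_ge0 ?KC//.
  by rewrite -expR0 ler_expR mulNr oppr_le0 mulr_ge0// ltW.
have -> : (\int[leb]_(g in `]0%R, M]) (b%:E * (f2 g)%:E) =
   \int[leb]_(g in `]0%R, M]) (b * f2 g)%:E)%E by [].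
apply: (le_trans (@le_integral_ray _ (fun g => b * C * gamma_kernel 1 b g) _ _ _ _)).
- by apply: measurable_funM => //; exact: measurable_gamma_bessel.
- by apply: measurable_funM => //; exact: measurable_gamma_kernel.
- move=> g g0; rewrite f2E !normrM (ger0_norm (expR_ge0 _)) (gtr0_norm b0).
  rewrite /gamma_kernel subrr powRr0 mul1r -!mulrA ler_wpM2l ?(ltW b0)// mulrC.
  by rewrite -normrM ler_wpM2r ?expR_ge0//; exact: KC.
rewrite integral_scaled_gamma// Gamma1 mul1r powRN powRr1 ?(ltW b0)// lee_fin.
by rewrite mulrAC divff ?mul1r// gt_eqF.
Qed.

(** Uniformity in M is essential: for t < 1/2 the integral of the absolute value
    over the half-line is not bounded uniformly in y. *)
Lemma gamma_bessel_bound t : 0 < t -> exists2 C : R, 0 <= C &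
  forall b y M, 1 <= b -> 0 <= y -> 0 < M ->
  (`|\int[leb]_(g in `]0%R, M]) (gamma_kernel t b g * bessel_series t (y * g))%:E| <= C%:E)%E.
Proof.
move=> t0; have [t12|t12] := leP (1 / 2) t.
  by exists 1 => // b y M b1 y0 M0; exact: gamma_bessel_bound_high.
have [C1 C10 H1] := gamma_bessel_bound_small t0.
have [C2 C20 H2] := gamma_bessel_bound_large t0 t12.
exists (C1 + C2) => [|b y M b1 y0 M0]; first exact: addr_ge0.
have [y1|y1] := leP y 1.
  by apply: (le_trans (H1 b y M b1 y0 y1)); rewrite lee_fin lerDl.
by apply: (le_trans (H2 b y M b1 (ltW y1) M0)); rewrite lee_fin lerDr.
Qed.

Lemma besselJ_series (t z : R) : 0 < t -> 0 < z ->
  besselJ (t - 1) (2 * z) = z `^ (t - 1) * bessel_series t (z ^+ 2).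
Proof.
move=> t0 z0; apply/cvg_lim => //.
have c : z `^ (t - 1) * pseries (bessel_coef t) (z ^+ 2) n @[n --> \oo] -->
    z `^ (t - 1) * bessel_series t (z ^+ 2).
  by apply: cvgM; [exact: cvg_cst|exact: is_cvg_bessel].
apply: cvg_trans c; apply: near_eq_cvg; apply: nearW => n.
rewrite /pseries/series/= mulr_sumr; apply: eq_bigr => k _.
rewrite [2 * z]mulrC mulfK ?pnatr_eq0// Gamma_nat /bessel_coef.
have -> : k%:R + (t - 1) + 1 = k%:R + t by ring.
have -> : z `^ (t - 1 + 2 * k%:R) = z `^ (t - 1) * (z ^+ 2) ^+ k.
  by rewrite -natrM (powR_addr (t - 1)) ?powR_mulrn ?(ltW z0)// exprM.
by ring.
Qed.

End bessel_series.

(** * Laws on the half-line and the gamma factor *)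

Section nonnegative_laws.
Context {R : realType}.
Local Notation leb := (@lebesgue_measure R).

Lemma probability_finite d (T : measurableType d) (P : probability T R) : (P setT < +oo)%E.
Proof. by rewrite probability_setT ltry. Qed.

(** Monotone convergence as the rate 1/(n+1) decreases to 0; the mass of a
    measure is thus part of its Laplace transform. *)
Lemma laplace_mass d (T : measurableType d) (m : {measure set T -> \bar R}) (X : T -> R) :
  measurable_fun [set: T] X -> (forall w, 0 <= X w) ->
  (\int[m]_w (expR (- (n.+1%:R^-1 * X w)))%:E)%E @[n --> \oo] --> m setT.
Proof.
move=> mX X0.
have -> : m setT = (\int[m]_w limn (fun n => (expR (- (n.+1%:R^-1 * X w)))%:E))%E.
  rewrite -[LHS]mul1e -integral_cst//; apply: eq_integral => w _; apply/esym/cvg_lim => //.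
  apply: cvg_EFin; first by near=> n.
  rewrite -[X in _ --> X](@expR0 R).
  apply: (@continuous_cvg _ _ _ _ _ _ (@expR R)); first exact: continuous_expR.
  rewrite -[X in _ --> X](@oppr0 R) -[X in _ --> - X](mul0r (X w)).
  apply: cvgN; apply: cvgM; last exact: cvg_cst.
  exact: cvg_harmonic.
apply: (@cvg_monotone_convergence _ _ _ m setT _ (fun n w => (expR (- (n.+1%:R^-1 * X w)))%:E)) => //.
- move=> n; apply/measurable_EFinP; apply: measurableT_comp => //; apply: measurable_funN.
  exact: measurable_funM.
- by move=> w _ i j ij; rewrite lee_fin ler_expR lerN2 ler_wpM2r// lef_pV2 ?posrE// ler_nat.
Unshelve. all: by end_near. Qed.

Lemma eq_law_laplace d1 (T1 : measurableType d1) d2 (T2 : measurableType d2)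
    (m1 : {measure set T1 -> \bar R}) (m2 : {measure set T2 -> \bar R})
    (X1 : T1 -> R) (X2 : T2 -> R) :
  measurable_fun [set: T1] X1 -> measurable_fun [set: T2] X2 ->
  (forall w, 0 <= X1 w) -> (forall w, 0 <= X2 w) -> (m1 setT < +oo)%E ->
  (forall l : R, 0 < l -> (\int[m1]_w (expR (- (l * X1 w)))%:E =
    \int[m2]_w (expR (- (l * X2 w)))%:E)%E) ->
  eq_law m1 m2 X1 X2.
Proof.
move=> mX1 mX2 X10 X20 m1fin L; split => // A mA.
rewrite !preimage_EFin; apply: laplace_uniqueness => //;
  [exact/measurable_EFinP|exact/measurable_EFinP| |exact: measurable_image_EFin].
have c1 := laplace_mass (m := m1) mX1 X10; have c2 := laplace_mass (m := m2) mX2 X20.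
suff c2' : (\int[m1]_w (expR (- (n.+1%:R^-1 * X1 w)))%:E)%E @[n --> \oo] --> m2 setT.
  exact: cvg_unique c1 c2'.
by under eq_fun do rewrite L ?invr_gt0//; exact: c2.
Qed.

(** The positive and negative parts have equal integrals separately. *)
Lemma integral_eq_law d1 (T1 : measurableType d1) d2 (T2 : measurableType d2)
    d3 (E : measurableType d3) (m1 : {measure set T1 -> \bar R})
    (m2 : {measure set T2 -> \bar R}) (X : T1 -> E) (Y : T2 -> E) (f : E -> \bar R) :
  eq_law m1 m2 X Y -> measurable_fun [set: E] f ->
  (\int[m1]_w f (X w) = \int[m2]_w f (Y w))%E.
Proof.
move=> XY mf; pose fp := (f^\+)%E; pose fn := (f^\-)%E.
have mp : measurable_fun [set: E] fp by exact: measurable_funepos.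
have mn : measurable_fun [set: E] fn by exact: measurable_funeneg.
have -> : (\int[m1]_w f (X w) = \int[m1]_w fp (X w) - \int[m1]_w fn (X w))%E.
  by rewrite integralE; congr (_ - _)%E; apply: eq_integral => w _; rewrite /fp /fn !unlock.
have -> : (\int[m2]_w f (Y w) = \int[m2]_w fp (Y w) - \int[m2]_w fn (Y w))%E.
  by rewrite integralE; congr (_ - _)%E; apply: eq_integral => w _; rewrite /fp /fn !unlock.
rewrite (ge0_integral_eq_law XY mp); last by move=> x; exact: funepos_ge0.
by rewrite (ge0_integral_eq_law XY mn)// => x; exact: funeneg_ge0.
Qed.

Lemma measurable_max0 : measurable_fun [set: R] (fun x : R => Num.max 0 x).
Proof. exact: measurable_maxr. Qed.

Local Notation pos := (`]0, +oo[%classic : set R).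

Section halfline_law.
Variable r : R -> R.
Hypotheses (mr : measurable_fun [set: R] r) (r0 : forall x, 0 <= r x).

(** The measure with this density is compared with the law of a nonnegative
    variable through x |-> max(0, x), which is nonnegative everywhere and is the
    identity on the support. *)
Definition halfline_density (x : R) : R := \1_pos x * r x.

Lemma halfline_density_ge0 x : 0 <= halfline_density x.
Proof. by rewrite mulr_ge0// indicE. Qed.

Lemma measurable_halfline_density : measurable_fun [set: R] halfline_density.
Proof. by apply: measurable_funM => //; exact: measurable_indic. Qed.

Local Notation halfline_law :=
  (density_measure leb measurable_halfline_density halfline_density_ge0).

Lemma integral_halfline_law (f : R -> R) : measurable_fun [set: R] f ->
  (\int[halfline_law]_x (f (Num.max 0%R (x : R)))%:E = \int[leb]_(x in pos) (f x * r x)%:E)%E.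
Proof.
move=> mf; have mfm : measurable_fun [set: R] (fun x => f (Num.max 0 x)).
  by apply: (measurableT_comp mf); exact: measurable_max0.
rewrite integral_density// [RHS]integral_mkcond; apply: eq_integral => x _.
rewrite patchE /halfline_density indicE; case: ifPn => [|_]; last by rewrite mul0r mulr0.
by rewrite inE/= in_itv/= andbT => x0; rewrite mul1r max_r// ltW.
Qed.

End halfline_law.

Local Notation halfline_law mr r0 :=
  (density_measure leb (measurable_halfline_density mr) (halfline_density_ge0 r0)).

Section gamma_law.
Context d (T : measurableType d) (P : probability T R) (gam : gamma_process P).
Variable t : R.
Hypothesis t0 : 0 < t.

Lemma gamma_laplace l : 0 < l ->
  (\int[P]_w (expR (- (l * gam t w)))%:E = ((1 + l) `^ (- t))%:E)%E.
Proof.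
move=> l0; have := sub_laplace gam (ltW t0) (ltW l0).
rewrite unlock levy_exponent_gamma// => ->.
rewrite -EFinM/= /powR gt_eqF; last by rewrite addr_gt0.
by rewrite mulNr.
Qed.

Definition gamma_density (x : R) : R := gamma_kernel t 1 x / Gamma t.

Lemma gamma_density_ge0 x : 0 <= gamma_density x.
Proof. by rewrite divr_ge0 ?gamma_kernel_ge0// (ltW (Gamma_gt0 t0)). Qed.

Lemma measurable_gamma_density : measurable_fun [set: R] gamma_density.
Proof. by apply: measurable_funM => //; exact: measurable_gamma_kernel. Qed.

Lemma gamma_ge0 w : 0 <= gam t w.
Proof. by rewrite -(sub_start gam w) sub_nondecreasing// ltW. Qed.

(** Both sides have Laplace transform (1 + l)^(-t). *)
Lemma eq_law_gamma : eq_law P (halfline_law measurable_gamma_density gamma_density_ge0)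
  (gam t) (fun x => Num.max 0 x).
Proof.
apply: eq_law_laplace => //.
- exact: measurable_max0.
- exact: gamma_ge0.
- by move=> x; rewrite le_max lexx.
- exact: (probability_finite P).
move=> l l0; rewrite gamma_laplace//.
have mE : measurable_fun [set: R] (fun x => expR (- (l * x))).
  by apply: measurableT_comp => //; apply: measurable_funN; exact: measurable_funM.
rewrite (integral_halfline_law _ _ mE).
have -> : (\int[leb]_(x in pos) (expR (- (l * x)) * gamma_density x)%:E =
    \int[leb]_(x in pos) ((Gamma t)^-1 * gamma_kernel t (1 + l) x)%:E)%E.
  apply: eq_integral => x _; congr EFin; rewrite /gamma_density /gamma_kernel.
  have -> : - ((1 + l) * x) = - (l * x) + - (1 * x) by ring.
  by rewrite expRD; move: (_ `^ _) (expR _) (expR _) (Gamma t)^-1 => a b c e; ring.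
rewrite integral_scaled_gamma//; last exact: addr_gt0.
by rewrite mulrA mulVf ?mul1r// gt_eqF// Gamma_gt0.
Qed.

Lemma integral_gamma (f : R -> R) : measurable_fun [set: R] f ->
  (\int[P]_w (f (gam t w))%:E =
   \int[leb]_(g in pos) (f g * (gamma_kernel t 1 g / Gamma t))%:E)%E.
Proof.
move=> mf; have mfE : measurable_fun [set: R] (EFin \o f) by exact/measurable_EFinP.
by rewrite (integral_eq_law eq_law_gamma mfE) integral_halfline_law.
Qed.

End gamma_law.

Section gamma_factor.
Context d1 (T1 : measurableType d1) (P1 : probability T1 R) (X : T1 -> R).
Context d2 (T2 : measurableType d2) (P2 : probability T2 R) (gam : gamma_process P2).
Context d3 (T3 : measurableType d3) (P3 : probability T3 R) (D : {RV P3 >-> R}).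
Variable t : R.
Hypotheses (t0 : 0 < t) (XD : gamma_factor P1 X gam t D).

Let D0 : {ae P3, forall w, 0 < D w}. Proof. by have [] := XD. Qed.

Let mprod : measurable_fun [set: T2 * T3] (fun w => gam t w.1 * D w.2).
Proof. by have [_ []] := XD. Qed.

(** Conditionally on D, the product is a gamma variable scaled by D. The
    positive part of D is D almost surely and keeps the base of the power
    positive. *)
Lemma laplace_gamma_factor s : 0 < s -> (forall w, 0 <= X w) ->
  (\int[P1]_w (expR (- (s * X w)))%:E =
   \int[P3]_w ((1 + s * Num.max 0 (D w)) `^ (- t))%:E)%E.
Proof.
move=> s0 X0; have mE : measurable_fun [set: R] (fun x => (expR (- (s * x)))%:E).
  apply/measurable_EFinP; apply: measurableT_comp => //; apply: measurable_funN.
  exact: measurable_funM.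
rewrite (ge0_integral_eq_law XD.2 mE); last by move=> x; rewrite lee_fin expR_ge0.
pose F (z : T2 * T3) := (expR (- (s * (gam t z.1 * D z.2))))%:E.
have mF : measurable_fun [set: T2 * T3] F by exact: (measurableT_comp mE).
have F0 z : (0 <= F z)%E by rewrite lee_fin expR_ge0.
apply: (etrans (fubini_tonelli2 F mF F0)).
apply: ae_eq_integral => //.
- exact: (measurable_fun_fubini_tonelli_G F mF F0).
- apply/measurable_EFinP; apply: (measurableT_comp (measurable_powR (- t))).
  apply: measurable_funD => //; apply: measurable_funM => //.
  exact: measurable_maxr.
apply: filterS D0 => w Dw _.
have sD : 0 < s * D w by rewrite mulr_gt0.
rewrite /fubini_G/= max_r ?(ltW Dw)// -(gamma_laplace gam t0 sD).
by apply: eq_integral => v _; rewrite /F/= mulrAC -mulrA.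
Qed.

End gamma_factor.
End nonnegative_laws.

(** * The density *)

Section density.
Context {R : realType}.
Local Notation leb := (@lebesgue_measure R).
Local Notation pos := (`]0, +oo[%classic : set R).
Local Notation halfline_law mr r0 :=
  (density_measure leb (measurable_halfline_density mr) (halfline_density_ge0 r0)).

Context d (T : measurableType d) (P : probability T R).
Variables (u : R) (G : {RV P >-> R}).
Hypotheses (u0 : 0 <= u) (G0 : {ae P, forall w, 0 < G w}).
Hypothesis Glog : ('E_P[fun w => Num.max 0%R (ln (1 / G w))] < +oo)%E.
Hypothesis Glog0 : u = 0 -> ('E_P[fun w => Num.max 0%R (ln (G w))] < +oo)%E.
Variable t : R.
Hypothesis t0 : 0 < t.
Context d1 (T1 : measurableType d1) (P1 : probability T1 R).
Variable Y : ggc_subordinator P (sigma u \o G) P1.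
Context d2 (T2 : measurableType d2) (P2 : probability T2 R).
Variable X : ggc_subordinator P G P2.
Context d3 (T3 : measurableType d3) (P3 : probability T3 R) (gam : gamma_process P3).
Context d4 (T4 : measurableType d4) (P4 : probability T4 R) (D : {RV P4 >-> R}).
Hypothesis XD : gamma_factor P2 (X t) gam t D.

Local Notation ch := (cosh u).
Local Notation sh := (sinh u).
Local Notation k := (fine (kconst P u G)).
(** D is positive only almost surely; its positive part satisfies all
    inequalities at every point. *)
Let Dp w : R := Num.max 0 (D w).
Let aff w : R := ch + Dp w * sh.

Lemma ggc_ge0 w : 0 <= X t w.
Proof. by rewrite -(sub_start X w) sub_nondecreasing// ltW. Qed.

Let Dp0 w : 0 <= Dp w. Proof. by rewrite le_max lexx. Qed.

Let ch0 : 0 < ch. Proof. exact: cosh_gt0. Qed.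
Let sh0 : 0 <= sh. Proof. exact: sinh_ge0. Qed.
Let th0 : 0 <= tanh u. Proof. by rewrite divr_ge0// ltW. Qed.

Let aff_ge1 w : 1 <= aff w.
Proof. by rewrite (le_trans (cosh_ge1 u))// lerDl mulr_ge0. Qed.

Let aff0 w : 0 < aff w. Proof. exact: lt_le_trans (aff_ge1 w). Qed.

Let mDp : measurable_fun [set: T4] Dp.
Proof. exact: measurable_maxr. Qed.

Let maff : measurable_fun [set: T4] aff.
Proof. by apply: measurable_funD => //; exact: measurable_funM. Qed.

Let rate w : R := Dp w / (ch * aff w).

Let rate0 w : 0 <= rate w.
Proof. by rewrite divr_ge0// mulr_ge0// ltW. Qed.

Let mrate : measurable_fun [set: T4] rate.
Proof.
apply: measurable_funM => //; apply: (measurableT_comp measurable_invr).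
exact: measurable_funM.
Qed.

(** As a function of x, a multiple of the gamma density of rate
    tanh u + D/(cosh u (cosh u + D sinh u)). *)
Definition density_kernel (x : R) (w : T4) : R :=
  x `^ (t - 1) * expR (- (x * tanh u) - t * k) / Gamma t *
  (aff w `^ (- t) * expR (- (x * rate w))).

Let density_kernel_ge0 x w : 0 <= density_kernel x w.
Proof.
by rewrite mulr_ge0 ?mulr_ge0 ?powR_ge0 ?expR_ge0// invr_ge0 (ltW (Gamma_gt0 t0)).
Qed.

Let m_density_kernel : measurable_fun [set: R * T4] (fun z => density_kernel z.1 z.2).
Proof.
have mexp (f : R * T4 -> R) : measurable_fun [set: R * T4] f ->
    measurable_fun [set: R * T4] (fun z => expR (f z)) by exact: measurableT_comp.
apply: measurable_funM.
  apply: measurable_funM => //; apply: measurable_funM.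
    exact: (measurableT_comp (measurable_powR (t - 1))).
  apply: mexp; apply: measurable_funB => //; apply: measurable_funN.
  exact: measurable_funM.
apply: measurable_funM.
  apply: (measurableT_comp (measurable_powR (- t))).
  exact: (measurableT_comp maff).
apply: mexp; apply: measurable_funN; apply: measurable_funM => //.
exact: (measurableT_comp mrate).
Qed.

Let m_density_kernelE : measurable_fun [set: R * T4] (fun z => (density_kernel z.1 z.2)%:E).
Proof. exact/measurable_EFinP. Qed.

Let c_ x : R := x `^ (t - 1) * expR (- (x * tanh u) - t * k) / Gamma t.

Let c_ge0 x : 0 <= c_ x.
Proof. by rewrite mulr_ge0 ?mulr_ge0 ?powR_ge0 ?expR_ge0// invr_ge0 (ltW (Gamma_gt0 t0)). Qed.

Let weight01 x w : 0 <= x -> 0 <= aff w `^ (- t) * expR (- (x * rate w)) <= 1.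
Proof.
move=> x0; rewrite mulr_ge0 ?powR_ge0 ?expR_ge0//= -[leRHS]mulr1 ler_pM ?powR_ge0 ?expR_ge0//.
  rewrite powRN invf_le1 ?powR_gt0// -(@powRr0 R (aff w)).
  by apply: ler_powR => //; exact: ltW.
by rewrite -expR0 ler_expR oppr_le0 mulr_ge0.
Qed.

Let m_density_kernel1 x : measurable_fun [set: T4] (fun w => density_kernel x w).
Proof. exact: (measurableT_comp m_density_kernel (measurable_pair1 x)). Qed.

Let integral_density_kernel_fin x : 0 <= x ->
  (\int[P4]_w (density_kernel x w)%:E \is a fin_num)%E.
Proof.
move=> x0; rewrite ge0_fin_numE; last by apply: integral_ge0 => w _; rewrite lee_fin.
apply: (@le_lt_trans _ _ (\int[P4]_w (cst (c_ x)%:E w))%E); last first.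
  by rewrite integral_cst//= probability_setT mule1 ltry.
apply: ge0_le_integral => //.
- by move=> w _; rewrite lee_fin.
- by apply/measurable_EFinP; exact: m_density_kernel1.
- move=> w _; rewrite lee_fin /density_kernel -/(c_ x) -[leRHS]mulr1 ler_wpM2l//.
  by have /andP[] := weight01 w x0.
Qed.

Definition sigma_density_radial (x : R) : R := fine (\int[P4]_w (density_kernel x w)%:E)%E.
Local Notation rad := sigma_density_radial.

Let radE x : 0 <= x -> (rad x)%:E = (\int[P4]_w (density_kernel x w)%:E)%E.
Proof. by move=> x0; rewrite fineK// integral_density_kernel_fin. Qed.

Lemma sigma_density_radial_ge0 x : 0 <= rad x.
Proof. by apply: fine_ge0; apply: integral_ge0 => w _; rewrite lee_fin. Qed.

Lemma measurable_sigma_density_radial : measurable_fun [set: R] rad.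
Proof.
apply: (measurableT_comp (@fine_measurable R setT measurableT)).
apply: (@measurable_integral_on _ _ _ _ _ P4 setT (fun w x => (density_kernel x w)%:E)) => //.
  by have := measurableT_comp m_density_kernelE (@measurable_swap _ _ T4 R).
by move=> w x; rewrite lee_fin.
Qed.

Local Notation flaw := (halfline_law measurable_sigma_density_radial sigma_density_radial_ge0).

(** The rates of the gamma densities, shifted by l, factor so that the
    dependence on D is through 1 + sigma_u(l) D alone; this uses cosh^2 u = 1 +
    sinh^2 u. *)
Let rate_identity l w : 0 < l ->
  aff w * (l + tanh u + rate w) = (l * ch + sh) * (1 + sigma u l * Dp w).
Proof.
move=> l0; have c2 := @cosh2_sinh2 R u.
have ls : l * ch + sh != 0 by rewrite gt_eqF// affine_gt0.
have a0 : aff w != 0 by rewrite gt_eqF.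
have c0 : ch != 0 by rewrite gt_eqF.
have -> : aff w * (l + tanh u + rate w) = aff w * (l + tanh u) + Dp w / ch.
  by rewrite /rate; field; rewrite a0 c0.
have -> : (l * ch + sh) * (1 + sigma u l * Dp w) =
    l * ch + sh + (l * sh + ch) * Dp w by rewrite /sigma; field.
rewrite /aff /tanh.
have -> : (ch + Dp w * sh) * (l + sh / ch) + Dp w / ch =
   ch * l + sh + Dp w * sh * l + Dp w * (1 + sh ^+ 2) / ch by field.
by rewrite -c2; field.
Qed.

Let laplace_kernel_x l w : 0 < l ->
  (\int[leb]_(x in pos) (expR (- (l * x)) * density_kernel x w)%:E =
   (expR (- (t * k)) * (l * ch + sh) `^ (- t) * (1 + sigma u l * Dp w) `^ (- t))%:E)%E.
Proof.
move=> l0; have b0 : 0 < l + tanh u + rate w.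
  by apply: ltr_pwDl; [exact: ltr_pwDl|exact: rate0].
have s0 := sigma_gt0 u0 l0.
have sD : 0 <= 1 + sigma u l * Dp w by rewrite addr_ge0// mulr_ge0// ltW.
have lc : 0 <= l * ch + sh by exact/ltW/affine_gt0.
have -> : (\int[leb]_(x in pos) (expR (- (l * x)) * density_kernel x w)%:E =
    \int[leb]_(x in pos) (expR (- (t * k)) / Gamma t * aff w `^ (- t) *
      gamma_kernel t (l + tanh u + rate w) x)%:E)%E.
  apply: eq_integral => x _; congr EFin; rewrite /density_kernel /gamma_kernel.
  have -> : - ((l + tanh u + rate w) * x) = - (l * x) + (- (x * tanh u)) + (- (x * rate w)).
    by ring.
  rewrite !expRD -[- (t * k)]/(- (t * k)).
  move: (expR (- (l * x))) (expR (- (x * tanh u))) (expR (- (x * rate w))) (expR (- (t * k))).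
  by move: (Gamma t)^-1 (x `^ _) (aff w `^ _) => g p a e1 e2 e3 e4; ring.
rewrite integral_scaled_gamma//; congr EFin.
rewrite -[RHS]mulrA -powRM// -rate_identity// powRM ?(ltW b0) ?(ltW (aff0 _))//.
have : Gamma t != 0 by rewrite gt_eqF// Gamma_gt0.
move: (Gamma t) (expR (- (t * k))) (aff w `^ (- t)) ((l + tanh u + rate w) `^ (- t)).
by move=> g e a p g0; field.
Qed.

(** Integration in x first leaves e^(-t k) (l cosh u + sinh u)^(-t) times
    E (1 + sigma_u(l) D)^(-t), and this last factor is the Laplace transform of
    Gamma_t(G) at sigma_u(l). *)
Let laplace_flaw l : 0 < l ->
  (\int[flaw]_x (expR (- (l * Num.max 0%R (x : R))))%:E =
   expeR (- (t%:E * psi P (sigma u \o G) l)))%E.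
Proof.
move=> l0; have s0 := sigma_gt0 u0 l0.
have mE : measurable_fun [set: R] (fun x => expR (- (l * x))).
  by apply: measurableT_comp => //; apply: measurable_funN; exact: measurable_funM.
rewrite (integral_halfline_law _ _ mE).
have -> : (\int[leb]_(x in pos) (expR (- (l * x)) * rad x)%:E =
    \int[leb]_(x in pos) \int[P4]_(w in setT) (expR (- (l * x)) * density_kernel x w)%:E)%E.
  apply: eq_integral => x /set_mem/=; rewrite in_itv/= andbT => x0.
  have mk : measurable_fun [set: T4] (fun w => (density_kernel x w)%:E).
    by apply/measurable_EFinP; exact: m_density_kernel1.
  have k0 w : [set: T4] w -> (0 <= (density_kernel x w)%:E)%E by rewrite lee_fin.
  have e0 : (0 <= (expR (- (l * x)))%:E)%E by rewrite lee_fin expR_ge0.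
  by rewrite EFinM radE ?(ltW x0)// -(ge0_integralZl P4 measurableT mk k0 e0).
have mk2 : measurable_fun [set: R * T4]
    (fun z => (expR (- (l * z.1)) * density_kernel z.1 z.2)%:E).
  apply/measurable_EFinP; apply: measurable_funM => //.
  exact: (measurableT_comp mE).
have k20 x w : (0 <= (expR (- (l * x)) * density_kernel x w)%:E)%E.
  by rewrite lee_fin mulr_ge0 ?expR_ge0.
apply: (etrans (tonelli_on leb P4 (measurable_itv _) measurableT mk2 k20)).
have -> : (\int[P4]_(w in setT) \int[leb]_(x in pos) (expR (- (l * x)) * density_kernel x w)%:E =
    \int[P4]_w ((expR (- (t * k)) * (l * ch + sh) `^ (- t))%:E *
      ((1 + sigma u l * Dp w) `^ (- t))%:E))%E.
  by apply: eq_integral => w _; rewrite laplace_kernel_x// EFinM.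
have mp : measurable_fun [set: T4] (fun w => ((1 + sigma u l * Dp w) `^ (- t))%:E).
  apply/measurable_EFinP; apply: (measurableT_comp (measurable_powR (- t))).
  by apply: measurable_funD => //; exact: measurable_funM.
have p0 w : [set: T4] w -> (0 <= ((1 + sigma u l * Dp w) `^ (- t))%:E)%E.
  by rewrite lee_fin powR_ge0.
have q0 : (0 <= (expR (- (t * k)) * (l * ch + sh) `^ (- t))%:E)%E.
  by rewrite lee_fin mulr_ge0 ?expR_ge0 ?powR_ge0.
rewrite (ge0_integralZl P4 measurableT mp p0 q0).
rewrite -(laplace_gamma_factor t0 XD s0 ggc_ge0).
have := sub_laplace X (ltW t0) (ltW s0); rewrite unlock -/(psi P G (sigma u l)) => ->.
have := psi_duality u0 (measurable_funP G) G0 Glog Glog0 l0.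
have kfin := kconst_fin_num u0 (measurable_funP G) G0 Glog Glog0.
have pfin := psi_fin_num (measurable_funP G) G0 Glog s0.
have ls := affine_gt0 u0 l0.
rewrite -(fineK kfin) -(fineK pfin).
case: (psi P (sigma u \o G) l) => [q||]//; rewrite -EFinD => -[e].
have {e}-> : q = fine (psi P G (sigma u l)) + ln (l * ch + sh) + k.
  by move: e => /(congr1 (+%R (fine (psi P G (sigma u l))))); rewrite addrA subrr add0r => ->; ring.
pose p := fine (psi P G (sigma u l)).
transitivity ((expR (- (t * k)) * (l * ch + sh) `^ (- t) * expR (- (t * p)))%:E).
  by [].
transitivity ((expR (- (t * (p + ln (l * ch + sh) + k))))%:E); last by [].
congr EFin; rewrite /powR gt_eqF// -!expRD; congr expR; ring.
Qed.

Lemma eq_law_sigma_density : eq_law P1 flaw (Y t) (fun x => Num.max 0 x).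
Proof.
apply: eq_law_laplace => //.
- exact: measurable_max0.
- by move=> w; rewrite -(sub_start Y w) sub_nondecreasing// ltW.
- by move=> x; rewrite le_max lexx.
- exact: (probability_finite P1).
move=> l l0; rewrite laplace_flaw//.
have := sub_laplace Y (ltW t0) (ltW l0); rewrite /psi => <-.
by rewrite unlock.
Qed.

(** The positive part is the identity where the density is positive. *)
Lemma is_density_sigma : is_density (distribution P1 (Y t)) (halfline_density rad).
Proof.
have mr := measurable_sigma_density_radial; have r0 := sigma_density_radial_ge0.
split; [exact: measurable_halfline_density|by move=> x; exact: halfline_density_ge0|].
move=> A mA; have [_ _ law] := eq_law_sigma_density.
apply: (etrans (law A mA)).
have E B : (\int[leb]_(x in B) (halfline_density rad x)%:E =
    \int[leb]_x ((fun x => (halfline_density rad x)%:E) \_ B) x)%E.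
  exact: integral_mkcond.
apply: (etrans (E _)); apply: (etrans _ (esym (E _))).
apply: eq_integral => x _; rewrite !patchE.
have [x0|x0] := leP x 0; last first.
  rewrite (_ : (x \in _) = (x \in A))//.
  by apply/idP/idP; rewrite !inE/= max_r// ltW.
have -> : halfline_density rad x = 0.
  by rewrite /halfline_density indicE memNset ?mul0r//= in_itv/= andbT ltNge x0.
by case: ifP; case: ifP.
Qed.

Lemma sigma_density_expectation x : 0 < x ->
  (halfline_density rad x)%:E =
  ((x `^ (t - 1) * expR (- (x * tanh u) - t * k) / Gamma t)%:E *
   'E_P4[fun w => ((ch + D w * sh) `^ (- t) *
     expR (- (x * D w / (ch * (ch + D w * sh)))))%R])%E.
Proof.
move=> x0; have [Dpos _] := XD.
rewrite /halfline_density indicE mem_set ?mul1r; last by rewrite /= in_itv/= andbT.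
rewrite radE ?(ltW x0)// -/(c_ x).
have mw : measurable_fun [set: T4] (fun w => (aff w `^ (- t) * expR (- (x * rate w)))%:E).
  apply/measurable_EFinP; apply: measurable_funM.
    exact: (measurableT_comp (measurable_powR (- t))).
  by apply: measurableT_comp => //; apply: measurable_funN; exact: measurable_funM.
have w0 w : [set: T4] w -> (0 <= (aff w `^ (- t) * expR (- (x * rate w)))%:E)%E.
  by rewrite lee_fin; have /andP[] := weight01 w (ltW x0).
have c0 : (0 <= (c_ x)%:E)%E by rewrite lee_fin.
have -> : (\int[P4]_w (density_kernel x w)%:E =
    \int[P4]_w ((c_ x)%:E * (aff w `^ (- t) * expR (- (x * rate w)))%:E))%E.
  by apply: eq_integral => w _; rewrite -EFinM.
rewrite (ge0_integralZl P4 measurableT mw w0 c0); congr (_ * _)%E.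
rewrite unlock; apply: ae_eq_integral => //.
  apply/measurable_EFinP; have mD : measurable_fun [set: T4] (fun w => ch + D w * sh).
    by apply: measurable_funD => //; exact: measurable_funM.
  apply: measurable_funM; first exact: (measurableT_comp (measurable_powR (- t))).
  apply: measurableT_comp => //; apply: measurable_funN; apply: measurable_funM.
    exact: measurable_funM.
  by apply: (measurableT_comp measurable_invr); exact: measurable_funM.
apply: filterS Dpos => w Dw _; rewrite /rate /aff /Dp max_r ?(ltW Dw)//.
by rewrite [x * (_ / _)]mulrA.
Qed.

Section bessel_representation.
Variable x : R.
Hypothesis x0 : 0 < x.

Definition bessel_integrand (v : R) : R :=
  expR (- (v * tanh u)) * (v / x) `^ ((1 - t) / 2) *
  besselJ (t - 1) (2 * Num.sqrt (x * v) / ch).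

Let kappa : R := x `^ (t - 1) * ch `^ (1 - t).

Let kappa0 : 0 <= kappa. Proof. by rewrite mulr_ge0 ?powR_ge0. Qed.

(** The integrand written with the entire series, so that it is continuous up to
    0 and its bounds follow from those on j_t. *)
Let regular (v : R) : R := expR (- (v * tanh u)) * (kappa * bessel_series t (x * v / ch ^+ 2)).

(** The powers of x, v and cosh u are compared through their logarithms. *)
Lemma bessel_integrandE v : 0 < v -> bessel_integrand v = regular v.
Proof.
move=> v0; rewrite /bessel_integrand /regular -[LHS]mulrA; congr (_ * _).
have xv : 0 < x * v by rewrite mulr_gt0.
pose z := Num.sqrt (x * v) / ch.
have z0 : 0 < z by rewrite divr_gt0 ?sqrtr_gt0.
have -> : 2 * Num.sqrt (x * v) / ch = 2 * z by rewrite /z mulrA.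
rewrite besselJ_series//.
have -> : z ^+ 2 = x * v / ch ^+ 2 by rewrite expr_div_n sqr_sqrtr ?(ltW xv).
rewrite [LHS]mulrA; congr (_ * _).
have lz : ln z = (ln x + ln v) / 2 - ln ch.
  rewrite /z ln_div ?posrE ?sqrtr_gt0// -powR12_sqrt ?(ltW xv)// ln_powR lnM ?posrE//.
  by rewrite mulrC.
have pE (a b : R) : 0 < a -> a `^ b = expR (b * ln a) by move=> a0; rewrite /powR gt_eqF.
rewrite (pE _ _ (divr_gt0 v0 x0)) (pE _ _ z0) /kappa (pE _ _ x0) (pE _ _ ch0) -!expRD.
congr expR.
by rewrite lz ln_div ?posrE//; field.
Qed.

(** A Borel version of the integrand on [0, +oo[: the series for positive
    arguments and, at 0, the value given by the conventions for real powers. *)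
Let phi (v : R) : R := if 0 < v then regular v else bessel_integrand 0.

Let phiE v : 0 <= v -> phi v = bessel_integrand v.
Proof.
rewrite /phi le_eqVlt => /predU1P[<-|v0]; first by rewrite ltxx.
by rewrite v0 bessel_integrandE.
Qed.

Let mregular : measurable_fun [set: R] regular.
Proof.
apply: measurable_funM.
  by apply: measurableT_comp => //; apply: measurable_funN; exact: measurable_funM.
apply: measurable_funM => //.
apply: (measurableT_comp (measurable_bessel_series t0)).
by apply: measurable_funM => //; exact: measurable_funM.
Qed.

Let mphi : measurable_fun [set: R] phi.
Proof.
apply: measurable_fun_ifT => //.
exact: measurable_fun_ltr.
Qed.

Let phi_bounded_on N : exists2 B : R, 0 <= B & forall v, v <= N -> `|phi v| <= B.
Proof.
have [C C0 HC] := bessel_series_le_affine t0.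
exists (`|bessel_integrand 0| + kappa * (C * (1 + x * `|N| / ch ^+ 2))).
  rewrite addr_ge0// mulr_ge0// mulr_ge0// addr_ge0// divr_ge0 ?exprn_ge0 ?(ltW ch0)//.
  by rewrite mulr_ge0// ltW.
have c20 : 0 <= (ch ^+ 2)^-1 by rewrite invr_ge0 exprn_ge0// ltW.
move=> v vN; rewrite /phi; case: ifPn => [v0|_]; last first.
  by rewrite lerDl mulr_ge0// mulr_ge0// addr_ge0// !mulr_ge0// ltW.
apply: ler_wpDl => //; rewrite /regular normrM ger0_norm ?expR_ge0// -[leRHS]mul1r.
have y0 : 0 <= x * v / ch ^+ 2 by rewrite !mulr_ge0// ltW.
apply: ler_pM; rewrite ?expR_ge0//.
  by rewrite -expR0 ler_expR oppr_le0 mulr_ge0// ltW.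
rewrite normrM (ger0_norm kappa0) ler_wpM2l// (le_trans (HC _ y0))// ler_wpM2l//.
by rewrite lerD2l ler_wpM2r// ler_wpM2l ?(ltW x0)// (le_trans vN) ?ler_norm.
Qed.

(** For t >= 1/2 the series is bounded; for u > 0 the factor e^(-v tanh u)
    absorbs its linear growth. *)
Let phi_bounded : 0 < u \/ 1 / 2 <= t -> exists2 B : R, 0 <= B & forall v, `|phi v| <= B.
Proof.
have c20 : 0 <= (ch ^+ 2)^-1 by rewrite invr_ge0 exprn_ge0// ltW.
move=> h; suff [B B0 HB] : exists2 B : R, 0 <= B & forall v, 0 < v -> `|regular v| <= B.
  exists (`|bessel_integrand 0| + B) => [|v]; first exact: addr_ge0.
  rewrite /phi; case: ifPn => [v0|_]; last by rewrite lerDl.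
  by apply: ler_wpDl => //; exact: HB.
case: h => [u_gt0|t12].
  have th_gt0 : 0 < tanh u by rewrite divr_gt0// sinh_gt0.
  have [C C0 HC] := bessel_series_le_affine t0.
  have [E E0 HE] := exp_poly_bound 1 th_gt0.
  have xc : 0 <= x / ch ^+ 2 by rewrite mulr_ge0// ltW.
  have kCr : 0 <= kappa * C * (1 + x / ch ^+ 2).
    exact: mulr_ge0 (mulr_ge0 kappa0 C0) (addr_ge0 ler01 xc).
  exists (kappa * C * (1 + x / ch ^+ 2) * E).
    exact: mulr_ge0 kCr (ltW E0).
  move=> v v0; have y0 : 0 <= x * v / ch ^+ 2 by rewrite !mulr_ge0// ltW.
  rewrite /regular normrM ger0_norm ?expR_ge0// normrM (ger0_norm kappa0).
  have HEv := HE v (ltW v0); rewrite expr1 [tanh u * v]mulrC in HEv.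
  apply: (@le_trans _ _ (expR (- (v * tanh u)) * (kappa * (C * ((1 + x / ch ^+ 2) * (1 + v)))))).
    rewrite ler_wpM2l ?expR_ge0// ler_wpM2l// (le_trans (HC _ y0))// ler_wpM2l//.
    rewrite mulrDl mul1r mulrDr mulr1 mulrAC; move: xc; set r := x / ch ^+ 2 => r0.
    have : 0 <= v by exact: ltW.
    by move: (r * v) => rv; lra.
  have -> : expR (- (v * tanh u)) * (kappa * (C * ((1 + x / ch ^+ 2) * (1 + v)))) =
      kappa * C * (1 + x / ch ^+ 2) * ((1 + v) * expR (- (v * tanh u))) by ring.
  exact: ler_wpM2l.
exists (kappa * (Gamma t)^-1); first by rewrite mulr_ge0// invr_ge0 (ltW (Gamma_gt0 t0)).
move=> v v0; have y0 : 0 <= x * v / ch ^+ 2 by rewrite !mulr_ge0// ltW.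
rewrite /regular normrM ger0_norm ?expR_ge0// -[leRHS]mul1r ler_pM ?expR_ge0//.
  by rewrite -expR0 ler_expR oppr_le0 mulr_ge0// ltW.
by rewrite normrM (ger0_norm kappa0) ler_wpM2l// bessel_series_bounded.
Qed.

Let ZE w : bessel_integrand (X t w) = phi (X t w).
Proof. by rewrite phiE// ggc_ge0. Qed.

Lemma integrable_bessel_integrand : 0 < u \/ 1 / 2 <= t ->
  P2.-integrable setT (EFin \o (fun w => bessel_integrand (X t w))).
Proof.
move=> /phi_bounded[B B0 HB].
have -> : (fun w => bessel_integrand (X t w)) = (fun w => phi (X t w)).
  by apply/funext => w; exact: ZE.
apply: (@le_integrable _ _ _ P2 setT measurableT _ (cst B%:E)).
- by apply/measurable_EFinP; exact: (measurableT_comp mphi).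
- by move=> w _; rewrite lee_fin [leRHS]ger0_norm.
- exact: finite_measure_integrable_cst.
Qed.

Let trunc (N v : R) : R := phi v * \1_(`]-oo, N]%classic) v.

Let mtrunc N : measurable_fun [set: R] (trunc N).
Proof. by apply: measurable_funM => //; exact: measurable_indic. Qed.

Let mprod : measurable_fun [set: T3 * T4] (fun z => gam t z.1 * D z.2).
Proof. by have [_ []] := XD. Qed.

Let truncated (N : R) (z : T3 * T4) : \bar R := (trunc N (gam t z.1 * D z.2))%:E.

Let prod_finite : ((P3 \x P4) setT < +oo)%E.
Proof.
rewrite -setXTT product_measure1E//; apply: (@le_lt_trans _ _ (1%:E * 1%:E)%E).
  by apply: lee_pmul => //; exact: probability_le1.
by rewrite mule1 ltry.
Qed.

Let integrable_truncated N : (P3 \x P4)%E.-integrable setT (truncated N).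
Proof.
have [B B0 HB] := phi_bounded_on N.
apply: (@measurable_bounded_integrable _ _ _ (P3 \x P4)%E
  (fun z => trunc N (gam t z.1 * D z.2))) => //.
  exact: (measurableT_comp (mtrunc N)).
exists B; split; first exact: num_real.
move=> M BM z _ /=; apply: (le_trans _ (ltW BM)).
rewrite /trunc indicE; case: (boolP (_ \in _)) => [|_]; last by rewrite mulr0 normr0.
by rewrite inE/= in_itv/= mulr1 => /HB.
Qed.

(** The truncated integrand is bounded, so Fubini's theorem applies to the
    product of a gamma variable and D even when the full integrand is not
    integrable. *)
Lemma integral_truncated N :
  (\int[P2]_(w in [set w | X t w <= N]%R) (bessel_integrand (X t w))%:E =
   \int[P4]_w fubini_G P3 (truncated N) w)%E.
Proof.
rewrite (integral21_prod_meas1 (integrable_truncated N)).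
have mtE : measurable_fun [set: R] (EFin \o trunc N) by exact/measurable_EFinP.
have := integral_eq_law XD.2 mtE; rewrite /truncated/= => <-.
rewrite integral_mkcond; apply: eq_integral => w _; rewrite patchE /trunc indicE ZE.
have -> : (w \in [set w | X t w <= N]) = (X t w \in `]-oo, N]%classic).
  by apply/idP/idP => /set_mem h; apply/mem_set; move: h; rewrite /= in_itv.
by case: ifPn => _; rewrite ?mulr1 ?mulr0.
Qed.

Let b_ w : R := 1 + Dp w * tanh u.
Let beta w : R := x * Dp w / ch ^+ 2.

Let b_ge1 w : 1 <= b_ w. Proof. by rewrite lerDl mulr_ge0. Qed.
Let b_gt0 w : 0 < b_ w. Proof. exact: lt_le_trans (b_ge1 w). Qed.
Let beta_ge0 w : 0 <= beta w.
Proof. by rewrite /beta divr_ge0 ?exprn_ge0 ?(ltW ch0)// mulr_ge0// ltW. Qed.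

Let integrand w (g : R) : R := gamma_kernel t (b_ w) g * bessel_series t (beta w * g).

Let integrable_integrand w : leb.-integrable pos (EFin \o integrand w).
Proof. exact: integrable_gamma_bessel. Qed.

(** The change of variable v = g D turns the truncation at N into the truncation
    at N/D and adds D tanh u to the rate of the gamma density. *)
Let inner N w : 0 < D w ->
  (fubini_G P3 (truncated N) w = (kappa / Gamma t)%:E *
    \int[leb]_(g in `]0%R, (N / D w)%R]) (integrand w g)%:E)%E.
Proof.
move=> Dw; have DpE : Dp w = D w by rewrite /Dp max_r// ltW.
have mf : measurable_fun [set: R] (fun g => trunc N (g * D w)).
  by apply: (measurableT_comp (mtrunc N)); exact: measurable_funM.
rewrite /fubini_G/= (integral_gamma gam t0 mf).
have sub : `]0, N / D w]%classic `<=` pos.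
  by move=> g; rewrite /= !in_itv/= => /andP[->].
have ii : leb.-integrable `]0, N / D w]%classic (EFin \o integrand w).
  exact: (@integrableS _ _ _ leb _ _ _ (measurable_itv _) (measurable_itv _) sub
    (integrable_integrand w)).
rewrite -(@integralZl _ _ _ leb _ (measurable_itv _) _ ii).
rewrite [LHS]integral_mkcond [RHS]integral_mkcond; apply: eq_integral => g _.
rewrite !patchE.
have [g0|g0] := ltP 0 g; last first.
  have -> : (g \in pos) = false by apply/negbTE/negP => /set_mem; rewrite /= in_itv/= andbT ltNge g0.
  by rewrite ifF//; apply/negbTE/negP => /set_mem; rewrite /= in_itv/= ltNge g0.
have -> : (g \in pos) = true by apply/mem_set; rewrite /= in_itv/= g0.
have gD : 0 < g * D w by rewrite mulr_gt0.
have -> : (g \in `]0, N / D w]%classic) = (g * D w \in `]-oo, N]%classic).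
  by apply/idP/idP => /set_mem h; apply/mem_set; move: h; rewrite /= !in_itv/= g0/= ler_pdivlMr.
rewrite /trunc indicE; case: ifPn => _; last by rewrite mulr0 mul0r.
rewrite mulr1 /phi gD /regular /integrand /gamma_kernel /beta /b_ DpE -EFinM; congr EFin.
have -> : - ((1 + D w * tanh u) * g) = - (1 * g) + - (g * D w * tanh u) by ring.
have -> : x * D w / ch ^+ 2 * g = x * (g * D w) / ch ^+ 2 by ring.
rewrite expRD; move: (expR _) (expR _) (g `^ _) (bessel_series _ _) (Gamma t)^-1.
by move=> e1 e2 p j i; ring.
Qed.

Let limit_weight w : R := kappa / Gamma t * (b_ w `^ (- t) * expR (- (beta w / b_ w))).

(** For fixed D the integrand is integrable on the half-line, and its integral
    there is known. *)
Let inner_cvg (N_ : nat -> R) w : 0 < D w -> N_ n @[n --> \oo] --> +oo ->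
  fubini_G P3 (truncated (N_ n)) w @[n --> \oo] --> (limit_weight w)%:E.
Proof.
move=> Dw Noo; under eq_fun do rewrite inner//.
rewrite /limit_weight EFinM; apply: cvgeZl => //.
rewrite -(integral_gamma_bessel t0 (b_gt0 w) (beta_ge0 w)).
have -> : (fun n => (\int[leb]_(g in `]0%R, (N_ n / D w)%R]) (integrand w g)%:E)%E) =
    (fun n => (\int[leb]_(g in pos) (integrand w g * \1_(`]-oo, N_ n / D w]%classic) g)%:E)%E).
  apply/funext => n; rewrite [LHS]integral_mkcond [RHS]integral_mkcond.
  apply: eq_integral => g _; rewrite !patchE indicE.
  have [g0|g0] := ltP 0 g; last first.
    have -> : (g \in pos) = false by apply/negbTE/negP => /set_mem; rewrite /= in_itv/= andbT ltNge g0.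
    by rewrite ifF//; apply/negbTE/negP => /set_mem; rewrite /= in_itv/= ltNge g0.
  have -> : (g \in pos) = true by apply/mem_set; rewrite /= in_itv/= g0.
  have -> : (g \in `]0, N_ n / D w]%classic) = (g \in `]-oo, N_ n / D w]%classic).
    by apply/idP/idP => /set_mem h; apply/mem_set; move: h; rewrite /= !in_itv/= g0.
  by case: ifPn => _; rewrite ?mulr1 ?mulr0.
have mi : measurable_fun [set: R] (integrand w) by exact: measurable_gamma_bessel.
have ia := integrable_abse (integrable_integrand w).
apply: (@dominated_cvg _ _ _ leb pos (measurable_itv _) _ _ (abse \o (EFin \o integrand w))) => //.
- move=> n; have m1 : measurable_fun [set: R]
      (fun g => integrand w g * \1_(`]-oo, N_ n / D w]%classic) g).
    by apply: measurable_funM => //; exact: measurable_indic.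
  by apply/measurable_EFinP; exact: measurable_funTS m1.
- move=> g _; apply: (@cvg_trans _ (cst (integrand w g)%:E @ \oo)); last exact: cvg_cst.
  apply: near_eq_cvg; near=> n => /=; rewrite indicE mem_set ?mulr1//= in_itv/=.
  by rewrite ler_pdivlMr//; near: n; exact: (cvgryPge _).1.
- move=> n g _; rewrite /= lee_fin indicE; case: (_ \in _); first by rewrite mulr1.
  by rewrite mulr0 normr0.
Unshelve. all: by end_near. Qed.

(** The bound has to be uniform in the truncation level and in D, since it
    dominates the integrals over D. *)
Let inner_bound : exists2 C : R, 0 <= C & forall N w, 0 < D w ->
  (`|fubini_G P3 (truncated N) w| <= C%:E)%E.
Proof.
have [C C0 HC] := gamma_bessel_bound t0.
have kG : 0 <= kappa / Gamma t by rewrite divr_ge0// (ltW (Gamma_gt0 t0)).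
exists (kappa / Gamma t * C) => [|N w Dw]; first exact: mulr_ge0.
rewrite inner// abseM gee0_abs ?lee_fin// [leRHS]EFinM; apply: lee_wpmul2l; first by rewrite lee_fin.
have [M0|M0] := ltP 0 (N / D w); first exact: HC.
by rewrite set_itv_ge -?leNgt ?bnd_simp -?leNgt// integral_set0 abse0 lee_fin.
Qed.

Let c : R := expR (- (x * tanh u) - t * k).

(** Here b = (cosh u + D sinh u)/cosh u, so b^(-t) absorbs the factor
    cosh^(1-t) u of the Bessel normalisation up to one cosh u. *)
Let limit_weightE w : c / ch * limit_weight w = density_kernel x w.
Proof.
have be : b_ w = aff w / ch by rewrite /b_ /aff /tanh; field; rewrite gt_eqF.
have re : beta w / b_ w = x * rate w.
  by rewrite be /beta /rate; field; rewrite !gt_eqF.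
have pw : ch `^ (1 - t) * b_ w `^ (- t) = ch * aff w `^ (- t).
  have pE (a b : R) : 0 < a -> a `^ b = expR (b * ln a) by move=> a0; rewrite /powR gt_eqF.
  rewrite (pE _ _ ch0) (pE _ _ (b_gt0 w)) (pE _ _ (aff0 w)) be ln_div ?posrE//.
  transitivity (expR (ln ch) * expR (- t * ln (aff w))); last by rewrite lnK ?posrE.
  by rewrite -!expRD; congr expR; ring.
rewrite /limit_weight /density_kernel re -/c /kappa.
have -> : c / ch * (x `^ (t - 1) * ch `^ (1 - t) / Gamma t * (b_ w `^ (- t) * expR (- (x * rate w)))) =
  c / ch * x `^ (t - 1) / Gamma t * (ch `^ (1 - t) * b_ w `^ (- t)) * expR (- (x * rate w)) by ring.
rewrite pw; move: ch0 => /lt0r_neq0; move: ch (aff w `^ _) (expR (- (x * rate w))) (x `^ _) (Gamma t)^-1.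
by move=> h a e p g h0; field.
Qed.

Let measurable_limit_weight : measurable_fun [set: T4] (fun w => (limit_weight w)%:E).
Proof.
have mb : measurable_fun [set: T4] b_.
  by apply: measurable_funD => //; exact: measurable_funM.
apply/measurable_EFinP; apply: measurable_funM => //; apply: measurable_funM.
  exact: (measurableT_comp (measurable_powR (- t))).
apply: measurableT_comp => //; apply: measurable_funN; apply: measurable_funM.
  by apply: measurable_funM => //; exact: measurable_funM.
exact: (measurableT_comp measurable_invr).
Qed.

Let integral_limit_weight :
  ((c / ch)%:E * \int[P4]_w (limit_weight w)%:E = (halfline_density rad x)%:E)%E.
Proof.
have w0 w : [set: T4] w -> (0 <= (limit_weight w)%:E)%E.
  rewrite lee_fin mulr_ge0 ?divr_ge0 ?(ltW (Gamma_gt0 t0))//.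
  by rewrite mulr_ge0 ?powR_ge0 ?expR_ge0.
have mw := measurable_limit_weight.
have c0 : (0 <= (c / ch)%:E)%E by rewrite lee_fin divr_ge0 ?expR_ge0 ?(ltW ch0).
rewrite -(ge0_integralZl P4 measurableT mw w0 c0).
rewrite /halfline_density indicE mem_set ?mul1r; last by rewrite /= in_itv/= andbT.
by rewrite radE ?(ltW x0)//; apply: eq_integral => w _; rewrite -EFinM limit_weightE.
Qed.

Lemma cvg_truncated_expectation :
  ((c / ch)%:E *
    \int[P2]_(w in [set w | X t w <= N]%R) (bessel_integrand (X t w))%:E)%E
    @[N --> +oo%R] --> (halfline_density rad x)%:E.
Proof.
apply/cvge_pinftyP => N_ Noo; rewrite -integral_limit_weight; apply: cvgeZl => //.
under eq_fun do rewrite integral_truncated.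
have [Dpos _] := XD; have [C C0 HC] := inner_bound.
pose A : set T4 := [set w | 0 < D w].
have mA : measurable A.
  rewrite (_ : A = D @^-1` `]0, +oo[%classic).
    by rewrite -[X in measurable X]setTI; exact: measurable_funP.
  by apply/seteqP; split => w /=; rewrite in_itv/= andbT.
have mF N : measurable_fun [set: T4] (fubini_G P3 (truncated N)).
  exact: (measurable_fubini_G (integrable_truncated N)).
have E (f : T4 -> \bar R) : measurable_fun [set: T4] f ->
    (\int[P4]_w f w = \int[P4]_(w in A) f w)%E.
  move=> mf; rewrite [RHS]integral_mkcond; apply: ae_eq_integral => //.
    by apply/(measurable_restrictT f mA); exact: measurable_funTS mf.
  by apply: filterS Dpos => w Dw _; rewrite patchE mem_set.
rewrite E; last exact: measurable_limit_weight.
have -> : (fun n => (\int[P4]_w fubini_G P3 (truncated (N_ n)) w)%E) =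
    (fun n => (\int[P4]_(w in A) fubini_G P3 (truncated (N_ n)) w)%E).
  by apply/funext => n; exact: E.
apply: (@dominated_cvg _ _ _ P4 A mA _ _ (cst C%:E)) => //.
- by move=> n; exact: measurable_funTS (mF (N_ n)).
- by move=> w Dw; exact: inner_cvg.
- by apply: (integrableS measurableT mA) => //; exact: finite_measure_integrable_cst.
- by move=> n w Dw; exact: HC.
Qed.

(** When the integrand is integrable, its truncated integrals converge to its
    expectation as well, and limits are unique. *)
Lemma sigma_density_bessel :
  P2.-integrable setT (EFin \o (fun w => bessel_integrand (X t w))) ->
  (halfline_density rad x)%:E =
  ((c / ch)%:E * 'E_P2[fun w => bessel_integrand (X t w)])%E.
Proof.
move=> iZ; pose Z w := bessel_integrand (X t w).
have mZ : measurable_fun [set: T2] (EFin \o Z) by have /integrableP[] := iZ.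
have noo : (n%:R : R) @[n --> \oo] --> +oo by exact: cvgr_idn.
have c1 := (cvge_pinftyP _ _).1 cvg_truncated_expectation _ noo.
have c2 : ((c / ch)%:E *
    \int[P2]_(w in [set w | X t w <= n%:R]%R) (bessel_integrand (X t w))%:E)%E @[n --> \oo]
    --> ((c / ch)%:E * \int[P2]_w (Z w)%:E)%E.
  apply: cvgeZl => //.
  have -> : (fun n => (\int[P2]_(w in [set w | X t w <= n%:R]%R) (bessel_integrand (X t w))%:E)%E)
      = (fun n => (\int[P2]_w ((EFin \o Z) \_ [set w | (X t w <= n%:R)%R]) w)%E).
    by apply/funext => n; rewrite integral_mkcond.
  have mS n : measurable [set w | X t w <= n%:R].
    rewrite (_ : [set w | _] = X t @^-1` `]-oo, n%:R]%classic); last first.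
      by apply/seteqP; split => w /=; rewrite in_itv.
    by rewrite -[X in measurable X]setTI; exact: measurable_funP.
  apply: (@dominated_cvg _ _ _ P2 setT measurableT _ _ (abse \o (EFin \o Z))) => //.
  - by move=> n; apply/(measurable_restrictT _ (mS n)); exact: measurable_funTS mZ.
  - move=> w _; apply: (@cvg_trans _ (cst (Z w)%:E @ \oo)); last exact: cvg_cst.
    apply: near_eq_cvg; near=> n => /=; rewrite patchE mem_set//=.
    by near: n; exact: nbhs_infty_ger.
  - exact: integrable_abse.
  - by move=> n w _; rewrite patchE; case: ifPn => //= _; rewrite normr0 lee_fin.
rewrite unlock; exact: cvg_unique c1 c2.
Unshelve. all: by end_near. Qed.

End bessel_representation.

End density.

Theorem theoremA1 (R : realType) (d : measure_display) (T : measurableType d)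
    (P : probability T R) (u : R) (G : {RV P >-> R})
    (u_ge0 : 0 <= u)
    (G_gt0 : {ae P, forall w, 0 < G w})
    (G_log : ('E_P[fun w => Num.max 0%R (ln (1 / G w))] < +oo)%E)
    (G_log0 : u = 0 -> ('E_P[fun w => Num.max 0%R (ln (G w))] < +oo)%E) :
  (kconst P u G \is a fin_num /\
   forall lambda : R, 0 < lambda ->
     (- psi P G (sigma u lambda) + psi P (sigma u \o G) lambda =
      (ln (lambda * cosh u + sinh u))%:E + kconst P u G)%E) /\
  ({ae @lebesgue_measure R, forall y, y \in `[0, 1] ->
      cdf_inv (sigma u \o G : {RV P >-> R}) y = sigma u (cdf_inv G (1 - y))} /\
   forall t : R, 0 < t ->
   forall (d1 : measure_display) (T1 : measurableType d1)
     (P1 : probability T1 R) (Y : ggc_subordinator P (sigma u \o G) P1)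
     (d2 : measure_display) (T2 : measurableType d2)
     (P2 : probability T2 R) (gam : gamma_process P2),
     eq_law P1 P2 (fun w => (Y t w)%:E)
       (stieltjes_integral gam
          (fun s => 1 / sigma u (cdf_inv G (1 - s / t))) t) /\
     eq_law P2 P2
       (stieltjes_integral gam
          (fun s => 1 / sigma u (cdf_inv G (1 - s / t))) t)
       (stieltjes_integral gam
          (fun s => 1 / sigma u (cdf_inv G (s / t))) t)) /\
  (forall t : R, 0 < t ->
   forall (d1 : measure_display) (T1 : measurableType d1)
     (P1 : probability T1 R) (Y : ggc_subordinator P (sigma u \o G) P1)
     (d2 : measure_display) (T2 : measurableType d2)
     (P2 : probability T2 R) (X : ggc_subordinator P G P2)
     (d3 : measure_display) (T3 : measurableType d3)
     (P3 : probability T3 R) (gam : gamma_process P3)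
     (d4 : measure_display) (T4 : measurableType d4)
     (P4 : probability T4 R) (D : {RV P4 >-> R}),
     gamma_factor P2 (X t) gam t D ->
     exists f : R -> R,
       is_density (distribution P1 (Y t)) f /\
       forall x : R, 0 < x ->
       let c := expR (- (x * tanh u) - t * fine (kconst P u G)) in
       let Z := fun w =>
         expR (- (X t w * tanh u)) * (X t w / x) `^ ((1 - t) / 2) *
         besselJ (t - 1) (2 * Num.sqrt (x * X t w) / cosh u) in
       let W := fun w =>
         (cosh u + D w * sinh u) `^ (- t) *
         expR (- (x * D w / (cosh u * (cosh u + D w * sinh u)))) in
       [/\ (0 < u \/ 1 / 2 <= t -> P2.-integrable setT (EFin \o Z)),
           (P2.-integrable setT (EFin \o Z) ->
              (f x)%:E = ((c / cosh u)%:E * 'E_P2[Z])%E),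
           ((c / cosh u)%:E *
              \int[P2]_(w in [set w | (X t w <= N)%R]) (Z w)%:E)%E
             @[N --> +oo%R] --> (f x)%:E &
           (f x)%:E =
           ((x `^ (t - 1) * c / Gamma t)%:E *
            'E_P4[W])%E ]).
Proof.
have mG : measurable_fun [set: T] G by exact: measurable_funP.
split; [|split].
- split; first exact: (kconst_fin_num u_ge0 mG G_gt0 G_log G_log0).
  by move=> lambda l0; exact: (psi_duality u_ge0 mG G_gt0 G_log G_log0).
- split; first exact: (cdf_inv_sigma u_ge0 G_gt0).
  move=> t t0 d1 T1 P1 Y d2 T2 P2 gam.
  exact: (eq_law_quantile_representation u_ge0 G_gt0 t0 Y gam).
- move=> t t0 d1 T1 P1 Y d2 T2 P2 X d3 T3 P3 gam d4 T4 P4 D XD.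
  exists (halfline_density (sigma_density_radial u G t D)); split.
    exact: (is_density_sigma u_ge0 G_gt0 G_log G_log0 t0 Y XD).
  move=> x x0 c Z W; split.
  + exact: (integrable_bessel_integrand u_ge0 t0 X x0).
  + exact: (sigma_density_bessel u_ge0 t0 XD x0).
  + exact: (cvg_truncated_expectation u_ge0 t0 XD x0).
  + exact: (sigma_density_expectation u_ge0 t0 XD x0).
Qed.
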